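(* Define $\mathbf{H}_{0}(z)=\frac{1}{2-z}$. For each $n\geq 1$ there exists a unique function $\mathbf{H}_{n}$, analytic in $\mathbb{C}\setminus\{2\}$ with $\mathbf{H}_{n}(z)\to 0$ as $z\to\infty$, satisfying (given $\mathbf{H}_{0},\dots,\mathbf{H}_{n-1}$) \[ \sum_{j=1}^{n}\frac{2}{j!}\mathbf{H}^{(j)}_{n-j}(2z)z^{j}+\sum_{j=0}^{n-1}\frac{1}{j!}\mathbf{H}^{(j)}_{n-j-1}(2z)z^{j}-\sum_{j=1}^{n}\frac{2}{j!}\mathbf{H}^{(j)}_{n-j}\Big(\frac{2}{z}\Big)\frac{1}{z^{j+2}}-\sum_{j=0}^{n-1}\frac{1}{j!}\mathbf{H}^{(j)}_{n-j-1}\Big(\frac{2}{z}\Big)\frac{1}{z^{j+2}} =2\mathbf{H}_{n}(z+1)-2\mathbf{H}_{n}(2z)+\frac{2}{z^{2}}\mathbf{H}_{n}\Big(\frac{2}{z}\Big). \] Each $\mathbf{H}_{n}$ is a rational function of the form $\mathbf{H}_{n}(z)=\frac{\mathscr{B}_{n}(z)}{(z-2)^{n+1}}$, where $\mathscr{B}_{0}=-1$ and, for $n\geq1$, $\mathscr{B}_{n}$ is a polynomial with rational coefficients of degree at most $n-1$ satisfying \[ \mathscr{B}_{n}(z+1)=(-1)^{n}z^{n-1}\mathscr{B}_{n}\Big(\frac{1}{z}+1\Big),\qquad \mathscr{B}_{n}(0)=0 . \] Moreover, for every $z$ in $\{|z|\leq \frac34\}\cup\{|z+\frac97|\leq\frac{12}{7}\}$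 the series $\sum_{n=0}^{\infty}(-1)^{n}\mathbf{H}_{n}(z)$ converges absolutely and \[ G(z)=\int_{0}^{\infty}\frac{1}{x+1-z}\,dF(x)=\sum_{n=0}^{\infty}(-1)^{n}\mathbf{H}_{n}(z). \]
   Context: $F:[0,\infty)\to[0,1)$ is the (rescaled) Minkowski question mark function: for $x=[a_{0};a_{1},a_{2},\dots]$ (regular continued fraction, $a_0\ge 0$, $a_i\ge1$), $F(x)=1-2^{-a_{0}}+2^{-(a_{0}+a_{1})}-2^{-(a_{0}+a_{1}+a_{2})}+\cdots$, the series terminating for rational $x$. It is continuous and increasing, with $F(1)=\tfrac12$ and $F(x)\to1$ as $x\to\infty$. The function $G(z)=\int_0^\infty \frac{dF(x)}{x+1-z}$ is analytic in $\mathbb{C}\setminus(1,\infty)$. Notation $f^{(j)}(w)$ means the $j$-th derivative of $f$ evaluated at the point $w$. *)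

(* Defs.v *)
From HB Require Import structures.
From mathcomp Require Import all_boot all_order all_algebra.
From mathcomp Require Import all_classical all_reals all_analysis.
From mathcomp Require Import complex ring lra.
Set Implicit Arguments. Unset Strict Implicit. Unset Printing Implicit Defensive.
Import Order.TTheory GRing.Theory Num.Theory numFieldNormedType.Exports.
Local Open Scope classical_set_scope.
Local Open Scope ring_scope.

(* The partial quotient a_k of the regular continued fraction of x >= 0, or
   None when the expansion of x stops before index k. *)
Fixpoint cf_quot (R : realType) (k : nat) (x : R) : option nat :=
  let a := Num.truncn x in
  if k is k'.+1 then
    if x == a%:R then None else cf_quot k' (x - a%:R)^-1
  else Some a.

Definition qmark_term (R : realType) (x : R) (k : nat) : R :=
  if cf_quot k x is Some _
  then (-1) ^+ k.+1 * 2 ^- (\sum_(i < k.+1) odflt 0%N (cf_quot i x))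
  else 0.

(* Extended by 0 to the negative axis: as qmark 0 = 0 and qmark is continuous,
   the Stieltjes measure of qmark puts no mass on ]-oo, 0]. *)
Definition qmark (R : realType) (x : R) : R :=
  if x < 0 then 0 else 1 + limn (series (qmark_term x)).

(* Towards the monotonicity and right-continuity of qmark: qs n x and qq x are
   the partial sums and the limit of 1 - qmark x. *)
Definition qs (R : realType) (n : nat) (x : R) : R := - series (qmark_term x) n.
Definition qq (R : realType) (x : R) : R := - limn (series (qmark_term x)).

Lemma cf_cases (R : realType) (x : R) : 0 <= x ->
  x = (Num.truncn x)%:R \/ exists2 v, 1 < v & x = (Num.truncn x)%:R + v^-1.
Proof.
move=> /truncn_itv /andP[ax xa]; have [->|xNa] := eqVneq x (Num.truncn x)%:R.
  by left; rewrite natrK.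
right; exists (x - (Num.truncn x)%:R)^-1; last by rewrite invrK addrC subrK.
have t0 : 0 < x - (Num.truncn x)%:R by rewrite subr_gt0 lt_neqAle eq_sym xNa.
by rewrite invf_gt1 // ltrBlDr addrC natr1.
Qed.

Lemma truncnDV (R : realType) (a : nat) (v : R) :
  1 < v -> Num.truncn (a%:R + v^-1) = a.
Proof.
move=> v1; apply: truncn_def; rewrite -natr1.
have v0 : 0 < v^-1 by rewrite invr_gt0; lra.
have v2 : v^-1 < 1 by rewrite invf_lt1; lra.
by apply/andP; split; lra.
Qed.

Lemma term0 (R : realType) (x : R) : qmark_term x 0 = - 2 ^- Num.truncn x.
Proof. by rewrite /qmark_term /= big_ord1 /= expr1 mulN1r. Qed.

Lemma termS_nat (R : realType) (a k : nat) : qmark_term (a%:R : R) k.+1 = 0.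
Proof. by rewrite /qmark_term /= natrK eqxx. Qed.

Lemma termS (R : realType) (a k : nat) (v : R) : 1 < v ->
  qmark_term (a%:R + v^-1) k.+1 = - 2 ^- a * qmark_term v k.
Proof.
move=> v1; rewrite /qmark_term /= truncnDV //.
have v0 : 0 < v^-1 by rewrite invr_gt0; lra.
have xa : a%:R + v^-1 - a%:R = v^-1 by rewrite addrAC subrr add0r.
have xNa : (a%:R + v^-1 == a%:R) = false by rewrite -subr_eq0 xa gt_eqF.
rewrite xNa xa invrK.
case: (cf_quot k v) => [b|]; last by rewrite mulr0.
rewrite big_ord_recl /= truncnDV //.
rewrite (eq_bigr (fun i : 'I_k.+1 => odflt 0%N (cf_quot i v))); last first.
  by move=> i _; rewrite /= xNa xa invrK.
by rewrite exprS exprD invfM; ring.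
Qed.

Lemma term_le (R : realType) (n : nat) (x : R) : 0 <= x ->
  `|qmark_term x n| <= 2 ^- (Num.truncn x + n).
Proof.
elim: n x => [|n IH] x x0.
  by rewrite term0 addn0 normrN ger0_norm // invr_ge0 exprn_ge0.
have [->|[v v1 ->]] := cf_cases x0.
  by rewrite termS_nat normr0 invr_ge0 exprn_ge0.
rewrite termS // truncnDV // normrM normrN (@ger0_norm _ (2 ^- _)); last first.
  by rewrite invr_ge0 exprn_ge0.
rewrite exprD invfM ler_wpM2l ?invr_ge0 ?exprn_ge0 //.
have v0 : 0 <= v by lra.
apply: (le_trans (IH _ v0)); rewrite lef_pV2 ?posrE ?exprn_gt0 //.
rewrite ler_weXn2l ?ler1n // -addn1 addnC leq_add2r truncn_gt0; lra.
Qed.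

Lemma qs0 (R : realType) (x : R) : qs 0 x = 0.
Proof. by rewrite /qs /series /= big_geq // oppr0. Qed.

Lemma qsS_nat (R : realType) (n a : nat) : qs n.+1 (a%:R : R) = 2 ^- a.
Proof.
rewrite /qs /series /= big_nat_recl //= big1 ?addr0 => [|i _].
  by rewrite term0 natrK opprK.
exact: termS_nat.
Qed.

Lemma qsS (R : realType) (n a : nat) (v : R) : 1 < v ->
  qs n.+1 (a%:R + v^-1) = 2 ^- a * (1 - qs n v).
Proof.
move=> v1; rewrite /qs /series /= big_nat_recl //= term0 truncnDV //.
rewrite (eq_bigr (fun i => - 2 ^- a * qmark_term v i)); last first.
  by move=> i _; rewrite termS.
by rewrite -mulr_sumr; ring.
Qed.

Lemma half_ge0 (R : realType) (n : nat) : 0 <= 2 ^- n :> R.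
Proof. by rewrite invr_ge0 exprn_ge0. Qed.

Lemma half_le (R : realType) (m n : nat) : (m <= n)%N -> 2 ^- n <= 2 ^- m :> R.
Proof.
by move=> mn; rewrite lef_pV2 ?posrE ?exprn_gt0 // ler_weXn2l ?ler1n.
Qed.

Lemma halfS (R : realType) (n : nat) : 2 ^- n.+1 = 2 ^- n / 2 :> R.
Proof. by rewrite exprSr invfM mulrC. Qed.

Lemma qs_bound (R : realType) (n : nat) (x : R) : 0 <= x ->
  0 <= qs n x <= 2 ^- Num.truncn x.
Proof.
elim: n x => [|n IH] x x0; first by rewrite qs0 lexx half_ge0.
have [->|[v v1 ->]] := cf_cases x0.
  by rewrite qsS_nat natrK half_ge0 lexx.
rewrite qsS // truncnDV //.
have /IH/andP[s0 s1] : 0 <= v by lra.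
have := half_le R (leq0n (Num.truncn v)); rewrite expr0 invr1 => h.
rewrite mulr_ge0 ?half_ge0 //=; last lra.
by rewrite ler_piMr ?half_ge0 //; lra.
Qed.

Lemma qs_half (R : realType) (n : nat) (v : R) : 1 <= v -> qs n v <= 2^-1.
Proof.
move=> v1; have /(qs_bound n)/andP[_ h] : 0 <= v by lra.
apply: (le_trans h); rewrite -[leRHS]expr1; rewrite exprVn half_le //.
by rewrite truncn_gt0.
Qed.

Lemma qs_nincr (R : realType) (n : nat) (x y : R) : 0 <= x -> x <= y ->
  qs n y <= qs n x.
Proof.
elim: n x y => [|n IH] x y x0 xy; first by rewrite !qs0.
have y0 : 0 <= y by lra.
have := le_truncn xy; rewrite leq_eqVlt => /orP[/eqP ab|ab].
  have [xE|[v v1 xE]] := cf_cases x0.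
    rewrite [in leRHS]xE qsS_nat.
    by have /andP[_] := qs_bound n.+1 y0; rewrite -ab.
  have [yE|[w w1 yE]] := cf_cases y0.
    have : 0 < v^-1 by rewrite invr_gt0; lra.
    by move: xy; rewrite xE yE ab; lra.
  rewrite [in leLHS]yE [in leRHS]xE !qsS // ab ler_wpM2l ?half_ge0 //.
  suff : qs n v <= qs n w by lra.
  apply: IH; first lra.
  move: xy; rewrite xE yE ab lerD2l lef_pV2 // posrE; lra.
have /andP[_ h] := qs_bound n.+1 y0; apply: (le_trans h).
apply: (le_trans (half_le R ab)).
have [->|[v v1 ->]] := cf_cases x0; first by rewrite qsS_nat natrK half_le.
rewrite qsS // truncnDV // halfS ler_wpM2l ?half_ge0 //.
by have := qs_half n (ltW v1); lra.
Qed.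

Lemma qs_cvg (R : realType) (x : R) : 0 <= x -> (@qs R)^~ x @ \oo --> qq x.
Proof.
move=> x0; apply: cvgN.
apply: normed_cvg; apply: (series_le_cvg (v_ := geometric 1 (2^-1))).
- by move=> n /=.
- by move=> n /=; rewrite mul1r exprn_ge0 // invr_ge0.
- move=> n /=; rewrite mul1r exprVn; apply: (le_trans (term_le n x0)).
  by rewrite half_le // leq_addl.
- by apply: is_cvg_geometric_series; rewrite ger0_norm ?invr_ge0 //; lra.
Qed.

Lemma qq_nat (R : realType) (a : nat) : qq (a%:R : R) = 2 ^- a.
Proof.
have := qs_cvg (ler0n R a); rewrite -cvg_shiftS => /(cvg_lim (@Rhausdorff R)) <-.
by under eq_fun do rewrite qsS_nat; rewrite lim_cst //; exact: Rhausdorff.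
Qed.

Lemma qqS (R : realType) (a : nat) (v : R) : 1 < v ->
  qq (a%:R + v^-1) = 2 ^- a * (1 - qq v).
Proof.
move=> v1; have v0 : 0 <= v by lra.
have /qs_cvg : 0 <= a%:R + v^-1 by rewrite addr_ge0 ?invr_ge0.
rewrite -cvg_shiftS => /(cvg_lim (@Rhausdorff R)) <-.
under eq_fun do rewrite qsS //; apply: (cvg_lim (@Rhausdorff R)).
by apply: cvgMr; apply: cvgB; [exact: cvg_cst|exact: qs_cvg].
Qed.

Lemma qq_bound (R : realType) (x : R) : 0 <= x ->
  0 <= qq x <= 2 ^- Num.truncn x.
Proof.
move=> x0; have h := qs_cvg x0; rewrite -(cvg_lim (@Rhausdorff R) h).
have hc := cvgP _ h.
by rewrite limr_ge ?limr_le //; apply: nearW => n;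
  have /andP[] := qs_bound n x0.
Qed.

Lemma qq_le1 (R : realType) (x : R) : 0 <= x -> qq x <= 1.
Proof.
move=> /qq_bound/andP[_ h]; apply: (le_trans h).
by have := half_le R (leq0n (Num.truncn x)); rewrite expr0 invr1.
Qed.

Lemma qq_nincr (R : realType) (x y : R) : 0 <= x -> x <= y -> qq y <= qq x.
Proof.
move=> x0 xy; have y0 : 0 <= y by lra.
have hx := qs_cvg x0; have hy := qs_cvg y0.
rewrite -(cvg_lim (@Rhausdorff R) hx) -(cvg_lim (@Rhausdorff R) hy).
apply: ler_lim; [exact: cvgP hy|exact: cvgP hx|].
by apply: nearW => n; exact: qs_nincr.
Qed.

Lemma qq_right_nat (R : realType) (n a : nat) :
  exists2 y : R, a%:R < y & qq a%:R - qq y <= 2 ^- n.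
Proof.
have v1 : 1 < (n.+2)%:R :> R by rewrite ltr1n.
exists (a%:R + (n.+2)%:R^-1); first by rewrite ltrDl invr_gt0; lra.
rewrite qq_nat qqS // qq_nat mulrBr mulr1 opprB addrC subrK.
rewrite -invfM -exprD half_le //.
by apply: (@leq_trans n.+2); rewrite ?leq_addl ?leq_addr // -addn2 leq_addr.
Qed.

Lemma qq_cts (R : realType) (n : nat) (x : R) : 1 <= x ->
  (exists2 y, x < y & qq x - qq y <= 2 ^- n) /\
  (1 < x -> exists y, [/\ 1 < y, y < x & qq y - qq x <= 2 ^- n]).
Proof.
elim: n x => [|n IH] x x1; have x0 : 0 <= x by lra.
  rewrite expr0 invr1; split.
    exists (x + 1); first lra.
    have := qq_le1 x0; have /qq_bound/andP[] : 0 <= x + 1 by lra.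
    lra.
  move=> lt1x; exists ((1 + x) / 2); split; [lra|lra|].
  have /qq_le1 : 0 <= (1 + x) / 2 by lra.
  by have /andP[] := qq_bound x0; lra.
have a1 : (0 < Num.truncn x)%N by rewrite truncn_gt0.
have scale (a : nat) (d : R) : (0 < a)%N -> d <= 2 ^- n ->
    2 ^- a * d <= 2 ^- n.+1.
  move=> a0 dn; apply: (le_trans (ler_wpM2l (half_ge0 R a) dn)).
  rewrite halfS mulrC ler_wpM2l ?half_ge0 //.
  by rewrite -[leRHS]expr1 exprVn half_le.
have [xE|[u u1 xE]] := cf_cases x0.
  split; first by rewrite xE; exact: qq_right_nat.
  rewrite xE ltr1n; case: (Num.truncn x) => // -[//|a] _.
  have [[v v1 hv] _] := IH 1 (lexx _).
  have v0 : 0 < v^-1 by rewrite invr_gt0; lra.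
  have v2 : v^-1 < 1 by rewrite invf_lt1; lra.
  exists (a.+1%:R + v^-1); split.
  - have : 1 <= a.+1%:R :> R by rewrite ler1n.
    lra.
  - by rewrite -[in ltRHS]natr1; lra.
  - rewrite qqS // qq_nat [2 ^- a.+2]halfS -mulrBr; apply: scale => //.
    by move: hv; rewrite (qq_nat R 1) expr1; lra.
set a := Num.truncn x in a1 xE.
have [[v vu hv] /(_ u1)[w [w1 wu hw]]] := IH u (ltW u1).
have v1 : 1 < v by lra.
have a1' : 1 <= a%:R :> R by rewrite ler1n.
split.
  exists (a%:R + w^-1).
    by rewrite xE ltrD2l ltf_pV2 // posrE; lra.
  by rewrite xE !qqS // -mulrBr; apply: scale => //; lra.
move=> _; exists (a%:R + v^-1); split.
- have : 0 < v^-1 by rewrite invr_gt0; lra.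
  lra.
- by rewrite xE ltrD2l ltf_pV2 // posrE; lra.
- by rewrite xE !qqS // -mulrBr; apply: scale => //; lra.
Qed.

Lemma qq_right (R : realType) (n : nat) (x : R) : 0 <= x ->
  exists2 y, x < y & qq x - qq y <= 2 ^- n.
Proof.
move=> x0; have [->|[u u1 ->]] := cf_cases x0; first exact: qq_right_nat.
set a := Num.truncn x.
have [_ /(_ u1)[w [w1 wu hw]]] := qq_cts n (ltW u1).
exists (a%:R + w^-1); first by rewrite ltrD2l ltf_pV2 // posrE; lra.
rewrite !qqS // -mulrBr.
have h : 1 - qq u - (1 - qq w) <= 2 ^- n by lra.
apply: (le_trans (ler_wpM2l (half_ge0 R a) h)).
rewrite ler_piMl ?half_ge0 //.
by have := half_le R (leq0n a); rewrite expr0 invr1.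
Qed.

Lemma qmarkE (R : realType) (x : R) : 0 <= x -> qmark x = 1 - qq x.
Proof. by move=> x0; rewrite /qmark ltNge x0 /= /qq opprK. Qed.

Lemma qmark_nd (R : realType) : {homo @qmark R : x y / x <= y}.
Proof.
move=> x y xy; have [x0|x0] := ltP x 0; last first.
  by rewrite !qmarkE; [have := qq_nincr x0 xy| |]; lra.
rewrite {1}/qmark x0; have [y0|y0] := ltP y 0; first by rewrite /qmark y0.
by rewrite qmarkE // subr_ge0 qq_le1.
Qed.

Lemma qmark_rc (R : realType) (x : R) : @qmark R @ at_right x --> qmark x.
Proof.
have step (e : R) : 0 < e -> exists2 y, x < y & qmark y - qmark x < e.
  move=> e0; have [x0|x0] := ltP x 0.
    exists (x / 2); first lra.
    have x20 : x / 2 < 0 by lra.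
    by rewrite /qmark x0 x20 subr0.
  have [n hn] : exists n, 2 ^- n < e :> R.
    exists (Num.bound e^-1).
    rewrite -[ltRHS]invrK ltf_pV2 ?posrE ?invr_gt0 ?exprn_gt0 //.
    apply: lt_trans (archi_boundP _) _; first by rewrite invr_ge0 ltW.
    by rewrite -natrX ltr_nat ltn_expl.
  have [y xy hy] := qq_right n x0; exists y => //.
  by rewrite !qmarkE; lra.
apply/cvgrPdist_lt => e /step[y xy hy].
near=> z; have xz : x < z by near: z; exact: nbhs_right_gt.
have zy : z < y by near: z; exact: nbhs_right_lt.
have := qmark_nd (ltW xz); have := qmark_nd (ltW zy) => h1 h2.
by rewrite distrC ger0_norm; lra.
Unshelve. all: by end_near. Qed.

HB.instance Definition _ (R : realType) :=
  isCumulative.Build R _ R (@qmark R) (@qmark_nd R) (@qmark_rc R).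

(* R[i] with the normed-space topology of a numFieldType; the modulus `|z| is
   itself an element of Cplx R, lying on the real axis. *)
Definition Cplx (R : realType) : numFieldType := R[i]%C.

Definition of_real (R : realType) (x : R) : Cplx R := (x%:C)%C.

Definition analytic_at (R : realType) (f : Cplx R -> Cplx R) (z0 : Cplx R) :=
  exists a : nat -> Cplx R, exists2 r : R, 0 < r &
    forall z : Cplx R, `|z - z0| < of_real r ->
      series (fun k => a k * (z - z0) ^+ k) @ \oo --> f z.

Definition vanishes_at_infinity (R : realType) (f : Cplx R -> Cplx R) :=
  forall e : R, 0 < e ->
    exists M : R, forall z : Cplx R, of_real M < `|z| -> `|f z| < of_real e.

Definition Cintegrable d (T : measurableType d) (R : realType)
    (mu : {measure set T -> \bar R}) (D : set T) (f : T -> Cplx R) :=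
  mu.-integrable D (fun x => (complex.Re (f x))%:E) /\
  mu.-integrable D (fun x => (complex.Im (f x))%:E).

Definition Cintegral d (T : measurableType d) (R : realType)
    (mu : {measure set T -> \bar R}) (D : set T) (f : T -> Cplx R) : Cplx R :=
  (\int[mu]_(x in D) complex.Re (f x) +i* \int[mu]_(x in D) complex.Im (f x))%C.

Definition dqmark (R : realType) :
    {measure set (measurableTypeR R) -> \bar R} :=
  lebesgue_stieltjes_measure (@qmark R).

Definition G_integrand (R : realType) (z : Cplx R) (x : R) : Cplx R :=
  (of_real x + 1 - z)^-1.

Definition G (R : realType) (z : Cplx R) : Cplx R :=
  Cintegral (@dqmark R) `[0, +oo[ (G_integrand z).

Definition H_lhs (R : realType) (H : nat -> Cplx R -> Cplx R) (n : nat)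
    (z : Cplx R) : Cplx R :=
  \sum_(1 <= j < n.+1) 2 / j`!%:R * derive1n j (H (n - j)%N) (2 * z) * z ^+ j
  + \sum_(0 <= j < n) j`!%:R^-1 * derive1n j (H (n - j - 1)%N) (2 * z) * z ^+ j
  - \sum_(1 <= j < n.+1)
      2 / j`!%:R * derive1n j (H (n - j)%N) (2 / z) * (1 / z ^+ (j + 2))
  - \sum_(0 <= j < n)
      j`!%:R^-1 * derive1n j (H (n - j - 1)%N) (2 / z) * (1 / z ^+ (j + 2)).

Definition H_rhs (R : realType) (K : Cplx R -> Cplx R) (z : Cplx R) : Cplx R :=
  2 * K (z + 1) - 2 * K (2 * z) + 2 / z ^+ 2 * K (2 / z).

(* K is a solution of the n-th equation, given H 0, ..., H n.-1.  All arguments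
   of K and of the H m in the equation avoid 2 exactly when z is not 0 or 1. *)
Definition solves_H (R : realType) (H : nat -> Cplx R -> Cplx R) (n : nat)
    (K : Cplx R -> Cplx R) :=
  [/\ forall z : Cplx R, z != 2 -> analytic_at K z,
      vanishes_at_infinity K &
      forall z : Cplx R, z != 0 -> z != 1 -> H_lhs H n z = H_rhs K z].

Definition eval_rat (R : realType) (p : {poly rat}) (z : Cplx R) : Cplx R :=
  (map_poly ratr p).[z].

(* Main.v *)
(** For [|e| < 1] let [T1 x = (x + 1) / (2 + e)] and [T2 x = (2 + e) x / (x + 1)],
    and let [f_N(e)] be the mean of [1 / (x + 1 - z)] over the [2 ^ N] points [x]
    that [N] applications of [T1] and [T2] produce from [1].
    - Near [e = 0] the points cluster at [1]; in the variable [v = 1 / (z - 2)]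
      the passage from [f_N] to [f_{N+1}] is an affine contraction whose expansion
      in powers of [e] is the system of equations for the [H_n].  So the [n]-th
      Taylor coefficient of [f_N] tends to [H_n(z)].
    - At [e = -1] the points are those of the Stern-Brocot tree, and the question
      mark function gives mass [2 ^ -N] to each interval of level [N]; so
      [f_N(-1)] tends to [G(z)].
    - For [|e| < 1] all the points avoid the disc [|x + c| <= rho], where
      [c ^ 2 - rho ^ 2 = 1] makes the disc symmetric under [x -> 1/x].  This bounds
      [f_N'] on the unit disc uniformly in [N], and Parseval's identity gives a
      uniform bound on [\sum_n n ^ 2 |c_n| ^ 2].  Hence the series of the [H_n]
      converges absolutely, with enough uniformity to let [e] tend to [-1].
    The second disc is the image of the first one under [z -> z / (z - 1)]. *)

(* The bound on [f_N'] must hold up to the unit circle, where the points spread without limit. The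
   logarithmic derivatives of [T1 x] and [T2 x] in [e] are that of [x] times [x / (x + 1)] and
   [1 / (x + 1)], up to bounded terms. So their sum over the tree is [O(2 ^ N)] as soon as
   [(1 + |x|) / |x + 1|] stays below a constant smaller than 2; off the disc it does, because
   [c > 2]. The disc meets the real axis in [[-m, -1/m]], so off it [|x + 1| > 1 - 1/m]; the choice
   [m = 29/7], just above 4, makes this exceed the bound [3/4] on [|z|]. Why the points avoid the
   disc: [T1] is affine with fixed point [w = 1 / (1 + e)] and multiplier [q = 1 / (2 + e)], so its
   iterates follow a spiral around [w]; [T2] is [T1] conjugated by inversion, which preserves the
   disc. What remains are runs of [T1] after an inversion. They start from
   [T1 (1 / T1 x) = 1 / (x + 1) + q], a point of the disc of centre [q + 1/2] and radius [9/11]. As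
   [q = w / (1 + w)], this becomes an inequality in [w] and [j], to be shown for all
   [re w >= 1/2]. *)
Require Import Defs.
From mathcomp Require Import all_boot all_order all_algebra.
From mathcomp Require Import all_classical all_reals all_analysis.
From mathcomp Require Import measurable_realfun complex ring lra zify.
Set Implicit Arguments. Unset Strict Implicit. Unset Printing Implicit Defensive.
Import Order.TTheory GRing.Theory Num.Theory numFieldNormedType.Exports.
Local Open Scope classical_set_scope.
Local Open Scope ring_scope.

(** * Inequalities for the logarithmic spiral [q ^ j] *)

(* [c = 445/203] and [rho = 396/203] are [(m + 1/m) / 2] and [(m - 1/m) / 2] for
   [m = 29/7]; [x -> 1 / (x + 1)] maps the complement of the disc [|x + c| <= rho]
   onto the disc of centre [1/2] whose radius [9/11] is the square root of
   [(c + 1) / (4 (c - 1))]. *)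
Section real_ineq.
Variable R : realFieldType.

(** Here and below [X], [Y] are the parts of [w], [q1], [q2] those of [q], [a], [b] those of
    [u = q ^ j], with [g = |u|] and [N = |1 + w| ^ 2]. The right-hand side is the real part of the
    point that [spiral_far_upper] has to keep away from 0; in this quadrant it suffices alone. *)
Lemma first_quadrant_bound (X Y a b g q1 q2 N : R) : 1/2 <= X -> 0 <= Y ->
  N = (1 + X)^+2 + Y^+2 -> q1 * N = X + X^+2 + Y^+2 -> q2 * N = Y ->
  0 <= a -> 0 <= b -> 0 <= g -> g ^+ 2 = a ^+ 2 + b ^+ 2 -> g <= 1 ->
  g ^+ 2 * N <= X ^+ 2 + Y ^+ 2 ->
  396/203 + 9/11 * g <= 445/203 + X - a * (X - 1/2 - q1) + b * (Y - q2).
Proof.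
move=> hX hY hN hq1 hq2 ha hb hg hg2 hg1 hgq.
have N0 : 9/4 + Y^+2 <= N by rewrite hN; nra.
have Np : 0 < N by nra.
have q1l : 1/3 <= q1.
  rewrite -(ler_pM2r Np) hq1 hN; nra.
have a1 : a <= 1 by nra.
have q20 : 0 <= q2 by rewrite -(ler_pM2r Np) mul0r hq2.
have q2l : q2 <= 1/3.
  by rewrite -(ler_pM2r Np) hq2; have := sqr_ge0 (Y - 3/2); rewrite !expr2; nra.
have q2Y : q2 <= Y.
  rewrite -(ler_pM2r Np) hq2; have := mulr_ge0 hY (ltW Np); nra.
have gab : g <= a + b.
  have h := mulr_ge0 ha hb; rewrite leNgt; apply/negP => h2; nra.
(* The threshold is set by [0.58 + c - rho > 9/11]. For smaller [X], either [Y] is large and the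
   term in [b] helps, or [|q|], hence [g], stays below [0.78]. *)
have [X58|X58] := lerP (58/100) X.
  have h1 : 0 <= b * (Y - q2) by apply: mulr_ge0 => //; lra.
  have h2 : 58/100 <= X - a * (X - 1/2 - q1).
    have -> : X - a * (X - 1/2 - q1) = (1 - a) * X + a * (1/2 + q1) by ring.
    nra.
  lra.
have h2 : 1/2 + a / 3 <= X - a * (X - 1/2 - q1).
  have -> : X - a * (X - 1/2 - q1) = (1 - a) * X + a * (1/2 + q1) by ring.
  nra.
have [Y16|Y16] := lerP (16/10) Y.
  have h1 : b * (12/10) <= b * (Y - q2) by apply: ler_wpM2l => //; lra.
  lra.
have h1 : 0 <= b * (Y - q2) by apply: mulr_ge0 => //; lra.
have g78 : g <= 78/100.
  rewrite leNgt; apply/negP => h.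
  have : 608/1000 < g^+2 by nra.
  move=> h'; have : 608/1000 * N <= X^+2 + Y^+2 by nra.
  rewrite hN; nra.
lra.
Qed.

(** With [Z = Y ^ 2]: a large [|u|] needs [q] close to the unit circle, hence a large [Z]. The last
    hypothesis bounds [Z (1 - g)] below by a concave function of [X]; it is replaced by its chord
    over [[1/2, 3/2]], and then by a multiple of [1 - g] that is linear in [g] after division. *)
Lemma second_quadrant_aux (X Z g : R) : 1/2 <= X -> X <= 3/2 -> 4/10 <= g -> g <= 1 ->
  g * ((1 + X)^+2 + Z) <= X ^+ 2 + Z ->
  (396/203 + 9/11 * g) ^+ 2 <= (445/203 + 1/2 - g)^+2 + Z.
Proof.
move=> X1 X2 g1 g2 h.
have h11 : 0 <= (X - 1/2) * (3/2 - X) by apply: mulr_ge0; rewrite subr_ge0.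
have h12 : 0 <= (1 - g) * ((X - 1/2) * (3/2 - X)) by rewrite mulr_ge0 // subr_ge0.
have h13 : g * (9/4) - 1/4 + (X - 1/2) * (4 * g - 2) <= Z * (1 - g) by lra.
have h14 : (832/100 * g - 338/100) * (1 - g) <= Z * (1 - g).
  apply: le_trans h13; have [g3|g3] := lerP (1/2) g.
    have h1 : 0 <= (X - 1/2) * (4 * g - 2) by apply: mulr_ge0; lra.
    have := sqr_ge0 (g - 57/100); rewrite expr2 => h2; lra.
  have h1 : 0 <= (3/2 - X) * (2 - 4 * g) by apply: mulr_ge0; lra.
  have := sqr_ge0 (g - 33/100); rewrite expr2 => h2; lra.
have Zl : 832/100 * g - 338/100 <= Z.
  have [gE|gE] := eqVneq g 1; last by rewrite -(@ler_pM2r _ (1 - g)) // subr_gt0 lt_neqAle gE.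
  by move: h; rewrite gE; lra.
have h2 := sqr_ge0 (g - 4/10).
rewrite !expr2 in h2 *; lra.
Qed.

Lemma ler_sqr_ge0 (u v : R) : 0 <= u -> u <= v -> u ^+ 2 <= v ^+ 2.
Proof. by move=> u0 uv; rewrite ler_sqr ?nnegrE // (le_trans u0). Qed.

Lemma sqr_le_inv (x y : R) : 0 <= y -> x ^+ 2 <= y ^+ 2 -> x <= y.
Proof.
move=> y0 h; have [x0|x0] := ltP x 0; first by apply: le_trans y0; exact: ltW.
by rewrite -ler_sqr ?nnegrE.
Qed.

(** As [re q > 0], a power of [q] with negative real part has [j >= 2], so [g <= |q| ^ 2], which is
    the last hypothesis. If [X >= 1/2 + q1] the real part suffices; otherwise it is at least
    [c + X - g], and the imaginary part is at least [Y]. *)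
Lemma second_quadrant_bound (X Y a b g q1 q2 N : R) : 1/2 <= X -> 0 <= Y ->
  N = (1 + X)^+2 + Y^+2 -> 1/3 <= q1 -> q1 <= 1 -> q2 <= Y ->
  a <= 0 -> 0 <= b -> 0 <= g -> - a <= g -> g <= 1 ->
  g * N <= X ^+ 2 + Y ^+ 2 ->
  (396/203 + 9/11 * g) ^+ 2 <= (445/203 + X - a * (X - 1/2 - q1) + b * (Y - q2)) ^+ 2
     + (Y - a * (Y - q2) - b * (X - 1/2 - q1)) ^+ 2.
Proof.
move=> hX hY hN q1l q1u q2Y ha hb hg hag g1 hgN.
have h1 : 0 <= b * (Y - q2) by rewrite mulr_ge0 // subr_ge0.
have h3 : 0 <= - a * (Y - q2) by rewrite mulr_ge0 ?oppr_ge0 // subr_ge0.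
have [A0|A0] := lerP 0 (X - 1/2 - q1).
  have h2 : 0 <= - a * (X - 1/2 - q1) by rewrite mulr_ge0 ?oppr_ge0 // subr_ge0.
  apply: ler_wpDr; first exact: sqr_ge0.
  by apply: ler_sqr_ge0; clear hgN hN; lra.
have h2 : 0 <= b * - (X - 1/2 - q1) by rewrite mulr_ge0 // oppr_ge0 ltW.
have h5 : 0 <= - a * (X - 1/2) by rewrite mulr_ge0 ?oppr_ge0 // subr_ge0.
have h6 : - a * q1 <= g.
  by apply: le_trans hag; rewrite ler_piMr // oppr_ge0.
have X32 : X <= 3/2 by clear - q1u A0; lra.
rewrite hN in hgN.
have := second_quadrant_aux hX X32 _ g1 hgN.
move: hgN => _.
have h7 : (445/203 + X - g)^+2 <= (445/203 + X - a * (X - 1/2 - q1) + b * (Y - q2)) ^+ 2.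
  by apply: ler_sqr_ge0; clear h3 h2; lra.
have h8 : Y^+2 <= (Y - a * (Y - q2) - b * (X - 1/2 - q1)) ^+ 2.
  by apply: ler_sqr_ge0 => //; clear h1 h5 h6; lra.
have h9 : (445/203 + 1/2 - g)^+2 <= (445/203 + X - g)^+2.
  by apply: ler_sqr_ge0; clear - hX g1; lra.
move=> h; apply: (le_trans _ (lerD h7 h8)).
apply: (le_trans _ (lerD h9 (lexx _))).
have [g4|g4] := lerP g (4/10); last by apply: h; apply: ltW.
apply: ler_wpDr; [exact: sqr_ge0|apply: ler_sqr_ge0; clear - hg g4; lra].
Qed.

(** The imaginary part is at least [Y - 1], and [38/10] is chosen so that [38/10 - 1] exceeds
    [rho + 9/11]. *)
Lemma third_quadrant_bound (X Y a b g q1 q2 : R) : 1/2 <= X -> 38/10 <= Y ->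
  q1 <= 1 -> q2 <= Y -> a <= 0 -> b <= 0 -> -1 <= b -> 0 <= g -> g <= 1 ->
  396/203 + 9/11 * g <= Y - a * (Y - q2) - b * (X - 1/2 - q1).
Proof.
move=> hX hY q1u q2Y ha hb hb1 g0 g1.
have h3 : 0 <= - a * (Y - q2) by rewrite mulr_ge0 ?oppr_ge0 // subr_ge0.
have h4 : 0 <= - b * (X - 1/2 + (1 - q1)).
  by rewrite mulr_ge0 ?oppr_ge0 // addr_ge0 // subr_ge0.
lra.
Qed.

(** The premise of [conclude_of_decay] for [L = 9/2], with [k] replaced by its upper bound
    [s = |c + w|]. *)
Lemma late_turn_bound_high (X Y s : R) : 1/2 <= X -> 38/10 <= Y -> 0 <= s ->
  s ^+ 2 = (445/203 + X)^+2 + Y ^+ 2 ->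
  (9/11 + 396/203) * Y <= (s - 396/203) * (9/4 + 9/2 * X).
Proof.
move=> hX hY s0 sE.
have sl : 81/100 * Y + 15/10 <= s.
  apply: sqr_le_inv => //.
  have h1 := sqr_ge0 (Y - 38/10).
  have h2 : (445/203 + 1/2) ^+ 2 <= (445/203 + X)^+2.
    by apply: ler_sqr_ge0; lra.
  rewrite sE; apply: (le_trans _ (lerD h2 (lexx _))).
  rewrite !expr2 in h1 *; lra.
have h3 : (s - 396/203) * (9/2) <= (s - 396/203) * (9/4 + 9/2 * X).
  by apply: ler_wpM2l; lra.
lra.
Qed.

(** The premise of [conclude_of_decay] for [L = 3]. With this smaller [L] the difference [s - k] is
    exploited: [s ^ 2 - k ^ 2 >= 6.24], the worst case being [X = 1/2] and [q1 = 1], and therefore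
    [s - k >= 3.12 / s]. *)
Lemma late_turn_bound_low (X Y s k q1 q2 : R) : 1/2 <= X -> 0 <= Y -> Y <= 38/10 ->
  0 <= s -> 0 <= k ->
  1/3 <= q1 -> q1 <= 1 -> 0 <= q2 -> q2 <= Y ->
  s ^+ 2 = (445/203 + X)^+2 + Y ^+ 2 ->
  k ^+ 2 = (X - 1/2 - q1) ^+ 2 + (Y - q2) ^+ 2 ->
  (k + 9/11 + 396/203 - s) * Y <= (s - 396/203) * (3/2 + 3 * X).
Proof.
move=> hX hY Y38 s0 k0 q1l q1u q20 q2Y sE kE.
have hk2 : k ^+ 2 <= (X - 1/2 - q1) ^+ 2 + Y ^+ 2.
  by rewrite kE lerD2l ler_sqr_ge0 // ?subr_ge0 // lerBlDr lerDl.
have hs0 : (445/203 + 1/2) ^+ 2 + Y ^+ 2 <= s ^+ 2.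
  by rewrite sE lerD2r; apply: ler_sqr_ge0; lra.
have hsr : 396/203 <= s.
  apply: sqr_le_inv => //; apply: le_trans hs0; have := sqr_ge0 Y; lra.
have hd : 624/100 <= (s - k) * (s + k).
  have -> : (s - k) * (s + k) = s ^+ 2 - k ^+ 2 by ring.
  have h1 : 0 <= (1 - q1) * (1 + q1) by rewrite mulr_ge0 ?subr_ge0; lra.
  have h2 : 0 <= (X - 1/2) * (445/203 + 1/2 + q1) by rewrite mulr_ge0 ?subr_ge0; lra.
  rewrite sE; rewrite !expr2 in hk2 h1 h2 *; lra.
have hks : k <= s.
  rewrite leNgt; apply/negP => h.
  have : (s - k) * (s + k) <= 0 by rewrite mulr_le0_ge0 ?addr_ge0 // subr_le0 ltW.
  by move: hd; clear; lra.
have h3 : (s - 396/203) * 3 <= (s - 396/203) * (3/2 + 3 * X).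
  by apply: ler_wpM2l; lra.
apply: le_trans h3.
have h4 : 312/100 <= (s - k) * s.
  have : (s - k) * (s + k) <= (s - k) * (2 * s) by apply: ler_wpM2l; lra.
  by move: hd; clear; lra.
have sp : 0 < s by lra.
rewrite -(ler_pM2r sp).
suff : (9/11 + 396/203) * Y * s - 312/100 * Y <= (s - 396/203) * 3 * s.
  have : (312/100) * Y <= (s - k) * s * Y by apply: ler_wpM2r.
  by clear; lra.
have : 0 <= (s - Y * (9/10)) ^+ 2 by exact: sqr_ge0.
have : 0 <= (38/10 - Y) * Y by rewrite mulr_ge0 ?subr_ge0.
clear hk2 sE kE h4 hd; nra.
Qed.

End real_ineq.

(** * Rational bounds on angles *)

Section trig.
Variable R : realType.

Lemma sin_le (x : R) : 0 <= x -> sin x <= x.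
Proof.
move=> x0.
have [|c _ h] := @MVT_segment R (@sin R) (@cos R) 0 x x0 (fun y _ => is_derive_sin y).
  by apply: continuous_subspaceT; exact: continuous_sin.
move: h; rewrite sin0 !subr0 => ->.
by rewrite ler_piMl // cos_le1.
Qed.

Lemma atan_le (x : R) : 0 <= x -> atan x <= x.
Proof.
move=> x0.
have [|c _ h] := @MVT_segment R (@atan R) (fun y => (1 + y ^+ 2)^-1) 0 x x0 (fun y _ => is_derive1_atan y).
  by apply: continuous_subspaceT; exact: continuous_atan.
move: h; rewrite atan0 !subr0 => ->.
rewrite ler_piMl // invf_le1; last by rewrite ltr_pwDl // sqr_ge0.
by rewrite lerDl sqr_ge0.
Qed.

(** Doubling the angle twice turns [sin (3/8) <= 3/8] into [cos (3/2) > 0], which puts [pi / 2]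
    above [3/2]. *)
Lemma pi_ge3 : 3 <= pi :> R.
Proof.
have h1 : sin (3 / 8) <= 3 / 8 :> R by apply: sin_le; lra.
have h2 : 0 <= sin (3 / 8) :> R.
  by apply: sin_ge0_pi; have := pi_ge2 R; lra.
have h3 : 71 / 100 <= cos (3 / 4) :> R.
  have -> : 3 / 4 = (3 / 8) *+ 2 :> R by lra.
  rewrite cos_mulr2n cos2sin2 mulr2n; nra.
have h4 : 0 < cos (3 / 2) :> R.
  have -> : 3 / 2 = (3 / 4) *+ 2 :> R by lra.
  rewrite cos_mulr2n mulr2n; nra.
have := pi_ge2 R => p2; rewrite leNgt; apply/negP => p3.
have : cos (3 / 2) <= cos (pi / 2) :> R.
  have i1 : 3 / 2 \in `[0, pi : R] by rewrite in_itv /=; apply/andP; split; lra.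
  have i2 : pi / 2 \in `[0, pi : R] by rewrite in_itv /=; apply/andP; split; lra.
  by rewrite leNgt (ltr_cos i1 i2) -leNgt; lra.
by rewrite cos_pihalf; lra.
Qed.

Lemma sin_lt0_gt_pi (x : R) : 0 <= x -> sin x < 0 -> 3 <= x.
Proof.
move=> x0 sx; apply: (le_trans pi_ge3); rewrite leNgt; apply/negP => h.
by move: sx; rewrite ltNge sin_ge0_pi // x0 ltW.
Qed.

(** Such an angle is at least [3 pi / 2]. The numbers 3 and [9/2] obtained here are the turnings [L]
    of [decay_of_turning]. *)
Lemma fourth_quadrant (x : R) : 0 <= x -> sin x < 0 -> 0 < cos x -> 9 / 2 <= x.
Proof.
move=> x0 sx cx.
have xpi : pi <= x.
  by rewrite leNgt; apply/negP => h; move: sx; rewrite ltNge sin_ge0_pi // x0 ltW.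
have := pi_ge3 => p3; rewrite leNgt; apply/negP => h.
have : 0 <= cos (x - pi) by apply: cos_ge0_pihalf; apply/andP; split; lra.
have -> : cos (x - pi) = - cos x by rewrite cosB cospi sinpi; ring.
by lra.
Qed.

End trig.

(* The modulus and the real and imaginary parts as elements of [R], so that real
   arithmetic applies to them. *)
Section modulus.
Variable R : realType.
Local Notation C := (Cplx R).
Implicit Types z y : C.

Definition nm (z : Cplx R) : R := Normc.normc (z : R[i]%C).
Definition re (z : Cplx R) : R := complex.Re (z : R[i]%C).
Definition im (z : Cplx R) : R := complex.Im (z : R[i]%C).
#[local] Arguments nm : simpl never.

Lemma normE z : `|z| = of_real (nm z).
Proof. by case: z. Qed.

Lemma ler_norm_nm z (r : R) : (`|z| <= of_real r) = (nm z <= r).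
Proof. by rewrite normE /of_real lecR. Qed.

Lemma ltr_norm_nm z (r : R) : (`|z| < of_real r) = (nm z < r).
Proof. by rewrite normE /of_real ltcR. Qed.

Lemma nm_ge0 z : 0 <= nm z.
Proof. by case: z => a b; exact: sqrtr_ge0. Qed.

Lemma nm0 : nm (0 : C) = 0.
Proof. exact: Normc.normc0. Qed.

Lemma nm1 : nm (1 : C) = 1.
Proof. exact: Normc.normc1. Qed.

Lemma nm_eq0 z : (nm z == 0) = (z == 0).
Proof. by apply/eqP/eqP => [/Normc.eq0_normc|->] //; exact: nm0. Qed.

Lemma nm_gt0 z : (0 < nm z) = (z != 0).
Proof. by rewrite lt_def nm_ge0 andbT nm_eq0. Qed.

Lemma nmM z y : nm (z * y) = nm z * nm y.
Proof. exact: Normc.normcM. Qed.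

Lemma nmV z : nm z^-1 = (nm z)^-1.
Proof. exact: Normc.normcV. Qed.

Lemma nmN z : nm (- z) = nm z.
Proof. exact: normcN. Qed.

Lemma nmX z n : nm (z ^+ n) = nm z ^+ n.
Proof. by elim: n => [|n IH]; rewrite ?expr0 ?nm1 // !exprS nmM IH. Qed.

Lemma nm_le_add z y : nm (z + y) <= nm z + nm y.
Proof. exact: le_normcD. Qed.

Lemma nm_le_sub z y : nm (z - y) <= nm z + nm y.
Proof. by rewrite -(nmN y) nm_le_add. Qed.

Lemma nm_ge_sub z y : nm z - nm y <= nm (z + y).
Proof. by have := nm_le_sub (z + y) y; rewrite addrK lerBlDr. Qed.

Lemma nm_sum (I : Type) (s : seq I) (P : pred I) (F : I -> C) :
  nm (\sum_(i <- s | P i) F i) <= \sum_(i <- s | P i) nm (F i).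
Proof.
elim/big_ind2: _ => [|x1 x2 y1 y2 h1 h2|//]; first by rewrite nm0.
by apply: le_trans (nm_le_add _ _) _; exact: lerD.
Qed.

Lemma sqr_nm z : nm z ^+ 2 = re z ^+ 2 + im z ^+ 2.
Proof. by case: z => a b; rewrite /nm /= sqr_sqrtr // addr_ge0 // sqr_ge0. Qed.

Lemma re_le_nm z : `|re z| <= nm z.
Proof.
by rewrite -ler_sqr ?nnegrE ?nm_ge0 ?normr_ge0 // sqr_nm real_normK ?num_real // lerDl sqr_ge0.
Qed.

Lemma im_le_nm z : `|im z| <= nm z.
Proof.
by rewrite -ler_sqr ?nnegrE ?nm_ge0 ?normr_ge0 // sqr_nm real_normK ?num_real // lerDr sqr_ge0.
Qed.

Lemma nm_le_reim z : nm z <= `|re z| + `|im z|.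
Proof.
rewrite -ler_sqr ?nnegrE ?nm_ge0 ?addr_ge0 // sqr_nm sqrrD !real_normK ?num_real //.
by rewrite addrAC lerDl mulrn_wge0 // mulr_ge0.
Qed.

Lemma nm_of_real (r : R) : nm (of_real r) = `|r|.
Proof. by rewrite /nm /of_real /= expr0n /= addr0 sqrtr_sqr. Qed.

Lemma nm_nat n : nm (n%:R : C) = n%:R.
Proof. by rewrite -[n%:R](rmorph_nat (real_complex R)) nm_of_real ger0_norm. Qed.

Lemma reD z y : re (z + y) = re z + re y. Proof. by case: z; case: y. Qed.
Lemma imD z y : im (z + y) = im z + im y. Proof. by case: z; case: y. Qed.
Lemma reN z : re (- z) = - re z. Proof. by case: z. Qed.
Lemma imN z : im (- z) = - im z. Proof. by case: z. Qed.
Lemma reM z y : re (z * y) = re z * re y - im z * im y.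
Proof. by case: z; case: y. Qed.
Lemma imM z y : im (z * y) = re z * im y + im z * re y.
Proof. by case: z; case: y. Qed.
Lemma re_of_real (r : R) : re (of_real r) = r. Proof. by []. Qed.
Lemma im_of_real (r : R) : im (of_real r) = 0. Proof. by []. Qed.
Lemma re1 : re (1 : C) = 1. Proof. by []. Qed.
Lemma im1 : im (1 : C) = 0. Proof. by []. Qed.
Lemma re_nat n : re (n%:R : C) = n%:R.
Proof. by have := rmorph_nat (real_complex R) n; rewrite /= => <-. Qed.
Lemma im_nat n : im (n%:R : C) = 0.
Proof. by have := rmorph_nat (real_complex R) n; rewrite /= => <-. Qed.

Lemma of_realD (a b : R) : of_real (a + b) = of_real a + of_real b.
Proof. exact: (rmorphD (real_complex R)). Qed.
Lemma of_realM (a b : R) : of_real (a * b) = of_real a * of_real b.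
Proof. exact: (rmorphM (real_complex R)). Qed.
Lemma of_realN (a : R) : of_real (- a) = - of_real a.
Proof. exact: (rmorphN (real_complex R)). Qed.
Lemma of_realV (a : R) : of_real a^-1 = (of_real a)^-1.
Proof. exact: (fmorphV (real_complex R)). Qed.
Lemma of_realX (a : R) n : of_real (a ^+ n) = (of_real a) ^+ n.
Proof. exact: (rmorphXn (real_complex R)). Qed.
Lemma of_real_nat n : of_real (n%:R : R) = n%:R.
Proof. exact: (rmorph_nat (real_complex R)). Qed.

Lemma of_real1 : of_real (1 : R) = 1.
Proof. by []. Qed.
Lemma of_real0 : of_real (0 : R) = 0.
Proof. by []. Qed.

Lemma reim_eq z y : re z = re y -> im z = im y -> z = y.
Proof. by case: z => a b; case: y => c d /= -> ->. Qed.

Definition cj (z : Cplx R) : Cplx R := (conjc (z : R[i]%C)).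
Lemma re_cj z : re (cj z) = re z. Proof. by case: z. Qed.
Lemma im_cj z : im (cj z) = - im z. Proof. by case: z. Qed.
Lemma nm_cj z : nm (cj z) = nm z.
Proof. by case: z => a b; rewrite /nm /= sqrrN. Qed.
Lemma cjD z y : cj (z + y) = cj z + cj y.
Proof. exact: (rmorphD (@conjc R)). Qed.
Lemma cjM z y : cj (z * y) = cj z * cj y.
Proof. exact: (rmorphM (@conjc R)). Qed.
Lemma cjN z : cj (- z) = - cj z.
Proof. exact: (rmorphN (@conjc R)). Qed.
Lemma cjX z n : cj (z ^+ n) = cj z ^+ n.
Proof. exact: (rmorphXn (@conjc R)). Qed.
Lemma cj_of_real (r : R) : cj (of_real r) = of_real r.
Proof. by rewrite /cj /of_real /= oppr0. Qed.

End modulus.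
Arguments nm : simpl never.
Arguments re : simpl never.
Arguments im : simpl never.

(** * The spiral keeps its distance from the excluded disc *)

Section spiral.
Variable R : realType.
Local Notation C := (Cplx R).

Lemma polar_pow (q : C) (j : nat) : 0 < re q -> 0 <= im q ->
  let th := atan (im q / re q) in
  re (q ^+ j) = nm q ^+ j * cos (j%:R * th) /\ im (q ^+ j) = nm q ^+ j * sin (j%:R * th).
Proof.
move=> q0 iq0 th.
have cth : cos th = re q / nm q.
  rewrite /th cos_atan.
  have -> : 1 + (im q / re q) ^+ 2 = (nm q / re q) ^+ 2.
    by rewrite !expr_div_n sqr_nm mulrDl divff // expf_neq0 // gt_eqF.
  by rewrite sqrtr_sqr ger0_norm ?divr_ge0 ?nm_ge0 ?ltW // invf_div.
have nq : 0 < nm q.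
  by rewrite nm_gt0; apply/eqP => qE; move: q0; rewrite qE ltxx.
have sth : sin th = im q / nm q.
  have ct0 : cos th != 0 by rewrite cth gt_eqF // divr_gt0.
  have : tan th = im q / re q by rewrite /th atanK.
  rewrite /tan => h; rewrite -[LHS](divfK ct0) h cth.
  by field; rewrite !gt_eqF.
elim: j => [|j [IH1 IH2]].
  by rewrite !expr0 !mul0r sin0 cos0 mul1r mul1r.
rewrite exprS reM imM IH1 IH2 -natr1 mulrDl mul1r cosD sinD cth sth exprS.
by split; field; rewrite gt_eqF.
Qed.

(** Compare with the binomial expansion to second order: [j ^ 2 / 4 <= j (j - 1) / 2] for [j >= 2].
    The square on the left is there because it is applied to [x = |q| ^ -2 - 1], to bound [|q| ^ j]
    itself. *)
Lemma pow_bernoulli2 (x : R) (j : nat) : 0 <= x -> (2 <= j)%N ->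
  (1 + j%:R * x / 2) ^+ 2 <= (1 + x) ^+ j.
Proof.
move=> x0; case: j => [//|[//|j] _].
have e1 i : i.+1%:R = i%:R + 1 :> R by rewrite -addn1 natrD.
have e2 i : i.+2%:R = i%:R + 2 :> R by rewrite -addn2 natrD.
have e3 i : i.+3%:R = i%:R + 3 :> R by rewrite -addn3 natrD.
have : 1 + j.+2%:R * x + j.+2%:R * j.+1%:R / 2 * x ^+ 2 <= (1 + x) ^+ j.+2.
  elim: j => [|j IH]; first by rewrite !expr2; lra.
  rewrite exprS; apply: le_trans (ler_wpM2l _ IH); last lra.
  rewrite (e3 j) (e2 j) (e1 j); have := ler0n R j; set k := j%:R => k0.
  have : 0 <= x * x * x by rewrite !mulr_ge0.
  have : 0 <= k * (x * x * x) by rewrite !mulr_ge0.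
  have : 0 <= k * (k * (x * x * x)) by rewrite !mulr_ge0.
  rewrite !expr2; lra.
apply: le_trans; rewrite (e2 j) (e1 j); have := ler0n R j; set k := j%:R => k0.
have : 0 <= k * (x * x) by rewrite !mulr_ge0.
have : 0 <= k * (k * (x * x)) by rewrite !mulr_ge0.
have : 0 <= (x * x) by rewrite !mulr_ge0.
rewrite !expr2; lra.
Qed.


(** A spiral that has turned by [L] has shrunk. The angle per step is at most
    [q2 / q1 = Y / (X + X ^ 2 + Y ^ 2)], which bounds [j] below, while [|q| ^ -2 - 1 = (1 + 2 X) /
    (X ^ 2 + Y ^ 2)]; together [j (|q| ^ -2 - 1) >= L (1 + 2 X) / Y], and [pow_bernoulli2]
    applies. *)
Lemma decay_of_turning (X Y q1 q2 N nq th L : R) (j : nat) : 1 / 2 <= X -> 0 <= Y ->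
  N = (1 + X) ^+ 2 + Y ^+ 2 -> q1 * N = X + X ^+ 2 + Y ^+ 2 -> q2 * N = Y ->
  0 <= nq -> nq ^+ 2 * N = X ^+ 2 + Y ^+ 2 -> 0 <= th -> th <= q2 / q1 ->
  2 <= L -> L <= j%:R * th -> nq ^+ j * (Y + L / 2 * (1 + 2 * X)) <= Y.
Proof.
move=> hX hY NE hq1 hq2 nq0 hqN th0 th_le L2 Lj.
have N0 : 0 < N.
  by rewrite NE ltr_wpDr ?sqr_ge0 // exprn_gt0 // ltr_wpDr //; lra.
have S0 : 0 < X ^+ 2 + Y ^+ 2.
  by rewrite ltr_wpDr ?sqr_ge0 // exprn_gt0 //; lra.
have q1p : 0 < q1.
  by rewrite -(pmulr_lgt0 _ N0) hq1 -addrA addr_gt0 //; lra.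
have YS : Y <= X + X ^+ 2 + Y ^+ 2.
  by have := sqr_ge0 (Y - 1/2); have := sqr_ge0 X; rewrite !expr2; clear -hX; lra.
have th1 : th <= 1.
  apply: (le_trans th_le); rewrite ler_pdivrMr // mul1r -(ler_pM2r N0) hq1 hq2.
  exact: YS.
have j2 : (2 <= j)%N.
  rewrite -(ler_nat R); apply: (le_trans (le_trans L2 Lj)).
  by rewrite ler_piMr.
have nqp : 0 < nq.
  rewrite lt_neqAle nq0 eq_sym andbT; apply/eqP => qE.
  by move: S0; rewrite -hqN qE expr0n mul0r ltxx.
pose x := nq ^- 2 - 1.
have xE : x * (X ^+ 2 + Y ^+ 2) = 1 + 2 * X.
  have -> : 1 + 2 * X = N - (X ^+ 2 + Y ^+ 2) by rewrite NE; ring.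
  by rewrite -hqN /x; field; rewrite gt_eqF.
have x0 : 0 <= x by have : 0 <= x * (X ^+ 2 + Y ^+ 2); [rewrite xE; lra|rewrite pmulr_lge0].
have Yp : 0 < Y.
  rewrite lt_neqAle hY andbT eq_sym; apply/eqP => Y0.
  have q20 : q2 = 0 by apply: (mulIf (lt0r_neq0 N0)); rewrite mul0r hq2.
  have thz : th = 0 by apply/eqP; rewrite eq_le th0 andbT (le_trans th_le) // q20 mul0r.
  by move: Lj; rewrite thz mulr0; lra.
have LY : L * (1 + 2 * X) <= j%:R * x * Y.
  have h1 : L * q1 <= j%:R * q2.
    by rewrite -ler_pdivlMr // -mulrA; apply: (le_trans Lj); exact: ler_wpM2l.
  have h2 : L * (X ^+ 2 + Y ^+ 2) <= j%:R * Y.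
    move: h1; rewrite -(ler_pM2r N0) -!mulrA hq1 hq2; apply: le_trans.
    by apply: ler_wpM2l; lra.
  have := ler_wpM2l x0 h2; rewrite mulrCA xE; lra.
have B1 : nq ^+ j * (1 + j%:R * x / 2) <= 1.
  have jx0 : 0 <= j%:R * x / 2 by rewrite !mulr_ge0.
  have g0 : 0 <= nq ^+ j by rewrite exprn_ge0.
  rewrite -(@ler_pXn2r _ 2) ?nnegrE ?mulr_ge0 ?addr_ge0 //.
  rewrite exprMn expr1n.
  apply: (le_trans (ler_wpM2l (sqr_ge0 _) (pow_bernoulli2 x0 j2))).
  rewrite /x addrC subrK -exprM mulnC exprM exprVn mulfV //.
  by rewrite expf_neq0 // gt_eqF ?exprn_gt0.
have g0 : 0 <= nq ^+ j by rewrite exprn_ge0.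
by have := ler_wpM2r (ltW Yp) B1; have := ler_wpM2l g0 LY; lra.
Qed.

(** By the triangle inequality [s - g k] bounds the modulus below, with [s = |c + w|] and
    [k = |w - q - 1/2|]. The conclusion is linear in [g], so inserting the upper bound for [g]
    leaves the second premise. *)
Lemma conclude_of_decay (X Y s k g L : R) : 1 / 2 <= X -> 0 <= Y -> 0 <= k -> 0 < L ->
  g * (Y + L / 2 * (1 + 2 * X)) <= Y ->
  (k + 9/11 + 396/203 - s) * Y <= (s - 396/203) * (L / 2 * (1 + 2 * X)) ->
  396/203 + 9/11 * g <= s - g * k.
Proof.
move=> hX hY k0 L0 h1 h2.
have D0 : 0 < L / 2 * (1 + 2 * X) by rewrite mulr_gt0; lra.
have Dp : 0 < Y + L / 2 * (1 + 2 * X) by rewrite ltr_wpDl.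
have k9 : 0 <= k + 9/11 by lra.
by rewrite -(ler_pM2r Dp); have := ler_wpM2l k9 h1; lra.
Qed.

(* With [u = q ^ j], the four quadrants of [u] are treated apart; in the fourth,
   and in the third for small [im w], the argument of [u] exceeds [pi], so that
   [nm u] is already small. *)
Lemma spiral_far_upper (w q : C) (j : nat) : 1 / 2 <= re w -> 0 <= im w ->
  q * (1 + w) = w ->
  396/203 + 9/11 * nm (q ^+ j) <=
  nm (of_real (445/203) + w - q ^+ j * (w - q - of_real (1/2))).
Proof.
move=> hX hY qw.
set X := re w in hX *; set Y := im w in hY *; pose N := (1 + X) ^+ 2 + Y ^+ 2.
have X0 : 0 < 1 + X by lra.
have N0 : 0 < N by rewrite /N ltr_wpDr ?sqr_ge0 // exprn_gt0.
pose q1 := re q; pose q2 := im q.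
have qre : q1 * (1 + X) - q2 * Y = X.
  by have := congr1 (@re R) qw; rewrite reM reD imD re1 im1 add0r.
have qim : q1 * Y + q2 * (1 + X) = Y.
  by have := congr1 (@im R) qw; rewrite imM reD imD re1 im1 add0r.
have hq1 : q1 * N = X + X ^+ 2 + Y ^+ 2.
  have -> : q1 * N = (1 + X) * (q1 * (1 + X) - q2 * Y) + Y * (q1 * Y + q2 * (1 + X)) by rewrite /N; ring.
  by rewrite qre qim; ring.
have hq2 : q2 * N = Y.
  have -> : q2 * N = (1 + X) * (q1 * Y + q2 * (1 + X)) - Y * (q1 * (1 + X) - q2 * Y) by rewrite /N; ring.
  by rewrite qre qim; ring.
have hqN : nm q ^+ 2 * N = X ^+ 2 + Y ^+ 2.
  have -> : N = nm (1 + w) ^+ 2 by rewrite sqr_nm reD imD re1 im1 add0r.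
  by rewrite -exprMn -nmM qw sqr_nm.
have Y2 := sqr_ge0 Y.
have q1l : 1 / 3 <= q1.
  by rewrite -(ler_pM2r N0) hq1 /N; have := mulr_ge0 (ltW X0) (ltW X0); nra.
have q1u : q1 <= 1.
  by rewrite -(ler_pM2r N0) hq1 /N; rewrite !expr2; lra.
have q20 : 0 <= q2 by rewrite -(ler_pM2r N0) mul0r hq2.
have q2Y : q2 <= Y.
  by rewrite -(ler_pM2r N0) hq2 ler_peMr // /N; have := mulr_ge0 (ltW X0) (ltW X0); nra.
have q1p : 0 < q1 by lra.
have nq1 : nm q <= 1.
  rewrite -(@ler_pXn2r _ 2) ?nnegrE ?nm_ge0 // expr1n -(ler_pM2r N0) hqN mul1r /N !expr2; lra.
have nq0 := nm_ge0 q.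
set u := q ^+ j; pose a := re u; pose b := im u; pose g := nm u.
have g0 : 0 <= g := nm_ge0 u.
have gE : g = nm q ^+ j by rewrite /g /u nmX.
have g1 : g <= 1 by rewrite gE exprn_ile1.
have g2 : g ^+ 2 = a ^+ 2 + b ^+ 2 by rewrite sqr_nm.
have ag : - a <= g by have := re_le_nm u; rewrite -/a -/g ler_norml => /andP[]; lra.
have bg : -1 <= b.
  by have := im_le_nm u; rewrite -/b -/g ler_norml => /andP[h _]; lra.
set z := (X in _ <= nm X).
have zre : re z = 445/203 + X - a * (X - 1/2 - q1) + b * (Y - q2).
  rewrite /z !(reD, reN, reM, imD, imN, re_of_real, im_of_real) -/a -/b -/q1 -/q2 -/X -/Y; ring.
have zim : im z = Y - a * (Y - q2) - b * (X - 1/2 - q1).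
  rewrite /z !(imD, imN, imM, reD, reN, re_of_real, im_of_real) -/a -/b -/q1 -/q2 -/X -/Y; ring.
have by_re : 396/203 + 9/11 * g <= re z -> 396/203 + 9/11 * g <= nm z.
  by move=> h; apply: (le_trans h); apply: le_trans (re_le_nm z); exact: ler_norm.
have by_im : 396/203 + 9/11 * g <= im z -> 396/203 + 9/11 * g <= nm z.
  by move=> h; apply: (le_trans h); apply: le_trans (im_le_nm z); exact: ler_norm.
have [j0|j0] := posnP j.
  apply: by_re; have u1 : u = 1 by rewrite /u j0 expr0.
  rewrite zre /a /b /g u1 re1 im1 nm1; lra.
have gq : g <= nm q.
  by rewrite gE -(prednK j0) exprS ler_piMr // exprn_ile1.
have [b0|b0] := lerP 0 b.
  have [a0|a0] := lerP 0 a.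
    apply: by_re; rewrite zre; apply: (@first_quadrant_bound _ X Y a b g q1 q2 N) => //.
    by rewrite -hqN ler_pM2r // ler_sqr_ge0.
  have j2 : (2 <= j)%N.
    rewrite ltn_neqAle j0 andbT; apply/eqP => j1.
    by move: a0; rewrite /a /u -j1 expr1 ltNge (ltW q1p).
  have gqq : g <= nm q ^+ 2.
    by rewrite gE -(subnK j2) exprD ler_piMl ?exprn_ge0 // exprn_ile1.
  apply: (sqr_le_inv (nm_ge0 z)).
  rewrite sqr_nm zre zim; apply: (@second_quadrant_bound _ X Y a b g q1 q2 N) => //; first exact: ltW.
  by rewrite -hqN ler_pM2r.
have [Y38a|a0'] : (38/10 <= Y /\ a <= 0) \/ (Y < 38/10 \/ 0 < a).
  by have [?|?] := ltP Y (38/10); [right; left|have [?|?] := ltP 0 a; [right; right|left]].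
  case: Y38a => Y38 a0; apply: by_im; rewrite zim; apply: third_quadrant_bound => //; exact: ltW.
have [uc us] := @polar_pow q j q1p q20.
set th := atan _ in uc us.
have th_le : th <= q2 / q1 by apply: atan_le; rewrite divr_ge0 // ltW.
have th0 : 0 <= th by rewrite /th -(@atan0 R); apply: le_atan; rewrite divr_ge0 // ltW.
have gp : 0 < g.
  rewrite lt_neqAle g0 andbT eq_sym /g nm_eq0; apply/eqP => uE.
  by move: b0; rewrite /b uE ltxx.
have sj : sin (j%:R * th) < 0.
  by move: b0; rewrite /b /u us -nmX -/u -/g pmulr_rlt0.
have jth : 0 <= j%:R * th by rewrite mulr_ge0.
pose s := nm (of_real (445/203) + w); pose k := nm (w - q - of_real (1/2)).
have s2 : s ^+ 2 = (445/203 + X) ^+ 2 + Y ^+ 2.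
  by rewrite sqr_nm reD imD re_of_real im_of_real add0r.
have k2 : k ^+ 2 = (X - 1/2 - q1) ^+ 2 + (Y - q2) ^+ 2.
  rewrite sqr_nm !(reD, imD, reN, imN, re_of_real, im_of_real) -/X -/Y -/q1 -/q2.
  by congr (_ ^+ 2 + _ ^+ 2); ring.
have s0 : 0 <= s := nm_ge0 _.
have k0 : 0 <= k := nm_ge0 _.
have zsk : s - g * k <= nm z.
  have := nm_ge_sub (of_real (445/203) + w) (- (u * (w - q - of_real (1/2)))).
  by rewrite nmN nmM -/s -/g -/k -/z.
have gd (L : R) : 2 <= L -> L <= j%:R * th -> g * (Y + L / 2 * (1 + 2 * X)) <= Y.
  move=> L2 Lj; rewrite gE.
  exact: (@decay_of_turning X Y q1 q2 N (nm q) th L j).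
have nc (L : R) := @conclude_of_decay X Y s k g L hX hY k0.
apply: le_trans zsk.
(* For [Y < 38/10] the power lies in the lower half plane, so it has turned by at least 3. Otherwise
   [a > 0] remains, which is the fourth quadrant and a turning of at least [9/2]. *)
have [Y38|Y38] := lerP (38/10) Y; last first.
  apply: (nc 3) => //; first by apply: gd; [clear; lra|exact: sin_lt0_gt_pi].
  have -> : 3 / 2 * (1 + 2 * X) = 3 / 2 + 3 * X by clear; lra.
  by apply: (@late_turn_bound_low _ X Y s k q1 q2) => //; exact: ltW.
have cj : 0 < cos (j%:R * th).
  have a0 : 0 < a by case: a0' => //; rewrite ltNge Y38.
  by move: a0; rewrite /a /u uc -nmX -/u -/g pmulr_rgt0.
apply: (nc (9/2)); [by clear; lra|by apply: gd; [clear; lra|exact: fourth_quadrant]|].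
have -> : 9 / 2 / 2 * (1 + 2 * X) = 9 / 4 + 9 / 2 * X by clear; lra.
have kls : k <= s.
  rewrite -ler_sqr ?nnegrE // k2 s2 lerD //.
    by have := mulr_ge0 (ltW X0) (ltW q1p); rewrite !expr2; clear - hX q1l q1u; nra.
  by apply: ler_sqr_ge0; rewrite ?subr_ge0 // gerBl.
by apply: le_trans (late_turn_bound_high hX Y38 s0 s2); apply: ler_wpM2r => //; clear - kls; lra.
Qed.

Lemma spiral_far (w q : C) (j : nat) : 1 / 2 <= re w -> q * (1 + w) = w ->
  396/203 + 9/11 * nm (q ^+ j) <=
  nm (of_real (445/203) + w - q ^+ j * (w - q - of_real (1/2))).
Proof.
move=> hX hq; have [hY|hY] := lerP 0 (im w); first exact: spiral_far_upper.
have := @spiral_far_upper (cj w) (cj q) j.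
rewrite re_cj im_cj oppr_ge0 => /(_ hX (ltW hY)).
have -> : 1 + cj w = cj (1 + w) by rewrite cjD -[1 in RHS](of_real_nat R 1) cj_of_real of_real_nat.
rewrite -cjM hq => /(_ erefl).
rewrite -(cj_of_real (445/203)) -(cj_of_real (1/2)) -cjX -cjD -!cjN -!cjD -cjM -cjN -cjD.
by rewrite !nm_cj cjN !cj_of_real.
Qed.

End spiral.

(** * The region avoiding the disc is stable under both maps *)

Section good.
Variable R : realType.
Local Notation C := (Cplx R).

(** This is [c ^ 2 - rho ^ 2 = 1]. Division by [|x| ^ 2] exchanges the outer terms of the right-hand
    side, whence the invariance under inversion. *)
Lemma outside_iff (x : C) :
  (396/203 < nm (of_real (445/203) + x)) = (0 < nm x ^+ 2 + 2 * (445/203) * re x + 1).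
Proof.
transitivity ((396/203) ^+ 2 < nm (of_real (445/203) + x) ^+ 2).
  have : 0 <= 396/203 :> R by lra.
  by move: (396/203) => r r0; rewrite ltr_sqr ?nnegrE ?nm_ge0.
rewrite !sqr_nm reD imD re_of_real im_of_real add0r.
by apply/idP/idP; rewrite !expr2; lra.
Qed.

Lemma re_inv (x : C) : x != 0 -> re x^-1 * nm x ^+ 2 = re x.
Proof.
move=> x0; have := mulVf x0 => h; rewrite sqr_nm.
have := congr1 (@re R) h; rewrite reM re1 => h1.
have := congr1 (@im R) h; rewrite imM im1 => h2.
transitivity (re x * (re x^-1 * re x - im x^-1 * im x) + im x * (re x^-1 * im x + im x^-1 * re x)).
  by ring.
by rewrite h1 h2 mulr1 mulr0 addr0.
Qed.

Lemma outside_inv (x : C) : x != 0 ->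
  396/203 < nm (of_real (445/203) + x) -> 396/203 < nm (of_real (445/203) + x^-1).
Proof.
move=> x0; rewrite !outside_iff => h.
have nx : 0 < nm x ^+ 2 by rewrite exprn_gt0 // nm_gt0.
set A := (X in 0 < X); suff : 0 < A * nm x ^+ 2 by rewrite pmulr_lgt0.
have -> : A * nm x ^+ 2 = nm x ^+ 2 + 2 * (445/203) * re x + 1.
  have h1 : nm x^-1 ^+ 2 * nm x ^+ 2 = 1 by rewrite nmV exprVn mulVf ?gt_eqF.
  rewrite /A; move: (445/203) => c.
  transitivity (nm x^-1 ^+ 2 * nm x ^+ 2 + 2 * c * (re x^-1 * nm x ^+ 2) + nm x ^+ 2); first by ring.
  by rewrite h1 re_inv //; ring.
exact: h.
Qed.

Lemma outside_shift (x : C) : x + 1 != 0 ->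
  396/203 < nm (of_real (445/203) + x) -> nm ((x + 1)^-1 - of_real (1/2)) < 9/11.
Proof.
move=> x0; rewrite outside_iff => h.
have nx : 0 < nm (x + 1) ^+ 2 by rewrite exprn_gt0 // nm_gt0.
suff : nm ((x + 1)^-1 - of_real (1/2)) ^+ 2 < (9/11) ^+ 2.
  have : 0 <= 9/11 :> R by lra.
  by move: (9/11) => r r0; rewrite ltr_sqr ?nnegrE ?nm_ge0.
have -> : nm ((x + 1)^-1 - of_real (1/2)) ^+ 2 = nm (x+1)^-1 ^+ 2 - re (x+1)^-1 + 1/4.
  rewrite !sqr_nm reD imD reN imN re_of_real im_of_real oppr0 addr0 !expr2; lra.
have h1 : nm (x + 1)^-1 ^+ 2 * nm (x + 1) ^+ 2 = 1 by rewrite nmV exprVn mulVf ?gt_eqF.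
have h2 := re_inv x0; have h3 : nm (x + 1) ^+ 2 = nm x ^+ 2 + 2 * re x + 1.
  by rewrite !sqr_nm reD imD re1 im1 addr0; ring.
have h4 : re (x + 1) = re x + 1 by rewrite reD re1.
suff : (nm (x + 1)^-1 ^+ 2 - re (x + 1)^-1 + 1 / 4) * nm (x + 1) ^+ 2 < (9/11) ^+ 2 * nm (x + 1) ^+ 2.
  by rewrite (ltr_pM2r nx).
have -> : (nm (x + 1)^-1 ^+ 2 - re (x + 1)^-1 + 1 / 4) * nm (x + 1) ^+ 2 =
  1 - (re x + 1) + 1 / 4 * nm (x + 1) ^+ 2.
  transitivity (nm (x + 1)^-1 ^+ 2 * nm (x + 1) ^+ 2 - re (x + 1)^-1 * nm (x + 1) ^+ 2 + 1 / 4 * nm (x + 1) ^+ 2).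
    by ring.
  by rewrite h1 h2 h4.
by rewrite h3; lra.
Qed.

(** The disc ends at [-7/29], which gives [22/29 > 3/4]. By [outside_iff], [|x + 1| ^ 2] exceeds
    [(1 - 1/c) (1 + |x| ^ 2)], and [1 - 1/c = 242/445] is just above [1/2]: this gives the factor
    [24/25 < 1] for the logarithmic derivatives and the bound that absorbs the factor [x] in
    [x' = x (log x)']. *)
Lemma outside_bounds (x : C) : 396/203 < nm (of_real (445/203) + x) ->
  [/\ 22/29 < nm (x + 1), 1 + nm x <= 2 * (24/25) * nm (x + 1) & nm x <= nm (x + 1) ^+ 2].
Proof.
move=> hx; have x0 := nm_ge0 x; have x1 := nm_ge0 (x + 1); split.
- have := nm_le_add (x + 1) (of_real (242/203)).
  have -> : x + 1 + of_real (242/203) = of_real (445/203) + x.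
    rewrite addrAC [x + _]addrC addrAC -of_real1 -of_realD.
    by congr (of_real _ + _); lra.
  by rewrite nm_of_real ger0_norm; lra.
- move: hx; rewrite outside_iff => h; apply: sqr_le_inv; first by rewrite !mulr_ge0.
  rewrite exprMn [nm (x + 1) ^+ 2]sqr_nm reD imD re1 im1 addr0.
  have := sqr_nm x; have := sqr_ge0 (nm x - 1).
  by rewrite !expr2 in h *; lra.
- move: hx; rewrite outside_iff sqr_nm => h.
  rewrite sqr_nm reD imD re1 im1 addr0.
  have := sqr_nm x; have := sqr_ge0 (nm x - 1).
  by rewrite !expr2 in h *; lra.
Qed.

(* The iterates [T1 ^ j x] and [T1 ^ j (1/x)] stay off the disc; [(1 + e)^-1] is
   the fixed point of [T1].  The condition is stable under [T1] and [x -> 1/x],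
   hence under [T2]. *)
Definition good (e x : C) := [/\ x != 0,
  forall j, 396/203 < nm (of_real (445/203) + ((1 + e)^-1 + (2 + e) ^- j * (x - (1 + e)^-1))) &
  forall j, 396/203 < nm (of_real (445/203) + ((1 + e)^-1 + (2 + e) ^- j * (x^-1 - (1 + e)^-1)))].

Section fixed_eps.
Variable e : C.
Hypothesis e1 : nm e < 1.
Let w := (1 + e)^-1.
Let q := (2 + e)^-1.

Lemma eps_neqN1 : 1 + e != 0.
Proof.
apply/eqP => h; move: e1; have -> : e = - 1 by apply/eqP; rewrite -subr_eq0 opprK addrC h.
by rewrite nmN nm1 ltxx.
Qed.

Lemma nm_2eps : 1 < nm (2 + e).
Proof. by have := nm_ge_sub 2 e; rewrite nm_nat; move: e1; lra. Qed.

Lemma eps_neqN2 : 2 + e != 0.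
Proof. by rewrite -nm_gt0; have := nm_2eps; lra. Qed.

Let hqw : q * (1 + w) = w.
Proof.
rewrite /q /w; have := eps_neqN1; have := eps_neqN2 => h1 h2.
by field; rewrite h1 h2.
Qed.

Let hw : 1 / 2 <= re w.
Proof.
have h := re_inv eps_neqN1; have n0 : 0 < nm (1 + e) ^+ 2 by rewrite exprn_gt0 // nm_gt0 eps_neqN1.
rewrite -(ler_pM2r n0) h sqr_nm !reD !imD re1 im1 add0r.
have : nm e ^+ 2 < 1 by rewrite expr_lt1 // nm_ge0.
by rewrite sqr_nm !expr2; lra.
Qed.

(** [T1 ^ j] scales a disc of radius [9/11] by [|q ^ j|], which is exactly the margin provided by
    [spiral_far]. *)
Lemma far_of_near (x : C) j : nm (x - (q + of_real (1/2))) < 9/11 ->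
  396/203 < nm (of_real (445/203) + (w + q ^+ j * (x - w))).
Proof.
move=> hx; have := spiral_far j hw hqw.
have -> : of_real (445/203) + (w + q ^+ j * (x - w)) = of_real (445/203) + w
   - q ^+ j * (w - q - of_real (1/2)) + q ^+ j * (x - (q + of_real (1/2))) by ring.
set A := _ - q ^+ j * _ => hA.
have qj0 : 0 < nm (q ^+ j) by rewrite nm_gt0 expf_neq0 // invr_eq0 eps_neqN2.
have := nm_ge_sub A (q ^+ j * (x - (q + of_real (1/2)))); rewrite nmM.
have : nm (q ^+ j) * nm (x - (q + of_real (1/2))) < nm (q ^+ j) * (9/11) by rewrite ltr_pM2l.
lra.
Qed.

(** The starting point lies in the disc of [far_of_near], since [1 - (q + 1/2) = e q / 2]. *)
Lemma good1 : good e 1.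
Proof.
have h j : 396/203 < nm (of_real (445/203) + (w + q ^+ j * (1 - w))).
  apply: far_of_near.
  have -> : 1 - (q + of_real (1 / 2)) = (1 - of_real (1/2)) - q by ring.
  have -> : 1 - of_real (1/2) = of_real (1/2) :> C.
    by rewrite -of_real1 -of_realN -of_realD; congr of_real; lra.
  have -> : of_real (1/2) - q = of_real (1/2) * (e * q).
    have -> : e = q^-1 - 2 by rewrite /q invrK addrAC subrr add0r.
    have h2 : of_real (1/2) * 2 = 1 :> C.
      by rewrite -(of_real_nat R 2) -of_realM -of_real1; congr of_real; lra.
    have q0 : q != 0 by rewrite invr_eq0 eps_neqN2.
    by rewrite mulrBl mulVf // mulrBr mulr1 mulrA h2 !mul1r.
  rewrite !nmM nm_of_real ger0_norm; last lra.
  have h1 : nm q <= 1 by rewrite /q nmV invf_le1 //; have := nm_2eps; lra.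
  have := nm_ge0 q; have := nm_ge0 e; move: e1 h1; nra.
split; first exact: oner_neq0.
- by move=> j; rewrite -exprVn; exact: h.
- by move=> j; rewrite invr1 -exprVn; exact: h.
Qed.

Lemma goodV x : good e x -> good e x^-1.
Proof. by case=> x0 h1 h2; split; rewrite ?invr_eq0 ?invrK. Qed.

Lemma good_outside x : good e x -> 396/203 < nm (of_real (445/203) + x).
Proof. by case=> _ /(_ 0%N) + _; rewrite expr0 invr1 mul1r [_ + (x - _)]addrC subrK. Qed.

Lemma good_neqN1 x : good e x -> x + 1 != 0.
Proof.
move/good_outside/outside_bounds => [h _ _].
by rewrite -nm_gt0; lra.
Qed.

(** The [T1]-orbit of [T1 x] is that of [x] shifted by one. The orbit of [1 / T1 x] starts off the
    disc by symmetry, and its later points are iterates of [1 / (x + 1) + q], to which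
    [outside_shift] and [far_of_near] apply. *)
Lemma good_step1 x : good e x -> good e ((x + 1) / (2 + e)).
Proof.
move=> gx; have x1 := good_neqN1 gx; have ox := good_outside gx.
have e2 := eps_neqN2; case: gx => x0 h1 h2.
have y0 : (x + 1) / (2 + e) != 0 by rewrite mulf_neq0 ?invr_eq0.
have F j : 396/203 < nm (of_real (445/203) + (w + (2 + e) ^- j * ((x + 1) / (2 + e) - w))).
  have := h1 j.+1; congr (_ < nm (_ + (_ + _))).
  rewrite -!exprVn exprSr -mulrA; congr (_ * _).
  rewrite -/q -/w; transitivity (q * (x + 1) - q * (1 + w)); first by ring.
  by rewrite hqw mulrC.
split=> // -[|j].
  rewrite expr0 invr1 mul1r [(1 + e)^-1 + (_ - _)]addrC subrK.
  apply: outside_inv => //.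
  by have := F 0%N; rewrite expr0 invr1 mul1r [w + _]addrC subrK.
have -> : w + (2 + e) ^- j.+1 * (((x + 1) / (2 + e))^-1 - w) =
    w + q ^+ j * ((x + 1)^-1 + q - w).
  congr (_ + _); rewrite -exprVn -/q exprSr -mulrA; congr (_ * _).
  rewrite -/w invf_div; transitivity (q * (2 + e) * (x + 1)^-1 - (q * (1 + w) - q)); first by ring.
  by rewrite hqw /q mulVf // mul1r opprB addrA.
apply: far_of_near.
have -> : (x + 1)^-1 + q - (q + of_real (1 / 2)) = (x + 1)^-1 - of_real (1/2) by ring.
exact: outside_shift.
Qed.

Lemma good_step2 x : good e x -> good e ((2 + e) * x / (x + 1)).
Proof.
move=> gx; have x1 := good_neqN1 gx; have [x0 _ _] := gx.
have := goodV (good_step1 (goodV gx)).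
congr (good e _).
have -> : x^-1 + 1 = (x + 1) / x by rewrite mulrDl divff // mul1r addrC.
by rewrite !invfM !invrK; ring.
Qed.

End fixed_eps.
End good.

(** * Power series with geometric control *)

Section parseval.
Variable R : realType.
Local Notation C := (Cplx R).

Lemma root_of_unity (m : nat) : (0 < m)%N ->
  exists om : C, [/\ nm om = 1, om ^+ m = 1 & forall k, (0 < k < m)%N -> om ^+ k != 1].
Proof.
move=> m0; pose th : R := 2 * pi / m%:R; pose om : C := (cos th +i* sin th)%C; exists om.
have m0' : m%:R != 0 :> R by rewrite pnatr_eq0 -lt0n.
have reom : re om = cos th by [].
have imom : im om = sin th by [].
have pw k : re (om ^+ k) = cos (k%:R * th) /\ im (om ^+ k) = sin (k%:R * th).
  elim: k => [|k [IH1 IH2]]; first by rewrite expr0 mul0r cos0 sin0.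
  by rewrite exprS reM imM IH1 IH2 reom imom -natr1 mulrDl mul1r cosD sinD; split; ring.
split.
- apply/eqP; rewrite -(@eqrXn2 _ 2) ?nm_ge0 // sqr_nm reom imom.
  by rewrite cos2Dsin2 expr1n.
- have e : m%:R * th = pi *+ 2 by rewrite /th mulrCA divff // mulr1 mulr_natl.
  by apply: reim_eq; rewrite ?(pw m).1 ?(pw m).2 e ?cos2pi ?sin2pi.
- move=> k /andP[k0 km]; apply/eqP => /(congr1 (@re R)); rewrite (pw k).1 re1.
  (* Half the angle: [cos (2 y) = 1] would force [sin y = 0], although [0 < y < pi]. *)
  pose y : R := k%:R * (pi / m%:R).
  have -> : k%:R * th = y *+ 2 by rewrite /y /th mulr2n; field.
  have ys : 0 < sin y.
    apply: sin_gt0_pi; apply/andP; split.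
      by rewrite mulr_gt0 ?ltr0n // divr_gt0 ?pi_gt0 // ltr0n.
    by rewrite /y mulrCA gtr_pMr ?pi_gt0 // ltr_pdivrMr ?ltr0n // mul1r ltr_nat.
  rewrite cos_mulr2n cos2sin2 mulr2n => h.
  have : sin y ^+ 2 = 0 by lra.
  by move/eqP; rewrite expf_eq0 /= gt_eqF.
Qed.

Lemma nm_sqr_cj (z : C) : of_real (nm z ^+ 2) = z * cj z.
Proof.
by apply: reim_eq; rewrite ?reM ?imM re_cj im_cj ?re_of_real ?im_of_real ?sqr_nm; ring.
Qed.

Lemma cj_sum (I : Type) (s : seq I) (P : pred I) (F : I -> C) :
  cj (\sum_(i <- s | P i) F i) = \sum_(i <- s | P i) cj (F i).
Proof. exact: (rmorph_sum (@conjc R)). Qed.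

Lemma of_real_sum (I : Type) (s : seq I) (P : pred I) (F : I -> R) :
  of_real (\sum_(i <- s | P i) F i) = \sum_(i <- s | P i) of_real (F i).
Proof. exact: (rmorph_sum (real_complex R)). Qed.

Lemma sum_root_of_unity (om : C) m n n' : (n < m)%N -> (n' < m)%N ->
  nm om = 1 -> om ^+ m = 1 -> (forall k, (0 < k < m)%N -> om ^+ k != 1) ->
  \sum_(k < m) (om ^+ n * cj (om ^+ n')) ^+ k = if n == n' then m%:R else 0.
Proof.
move=> nm_ n'm om1 omm prim.
have omcj : om * cj om = 1 by rewrite -nm_sqr_cj om1 expr1n.
have omX j : om ^+ j * cj om ^+ j = 1 by rewrite -exprMn omcj expr1n.
have [->|nn'] := eqVneq n n'.
  by under eq_bigr do rewrite cjX omX expr1n; rewrite sumr_const card_ord.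
set z := om ^+ n * _.
have zm : z ^+ m = 1.
  by rewrite /z exprMn cjX exprAC omm expr1n mul1r exprAC -cjX omm -of_real1 cj_of_real of_real1 expr1n.
have z1 : z != 1.
  rewrite /z cjX; apply/eqP => z1.
  have [lt|le] := ltnP n n'.
    have : om ^+ (n' - n) = 1.
      rewrite -[LHS]mulr1 -z1 mulrA -exprD subnK ?(ltnW lt) // omX //.
    by apply/eqP/prim; rewrite subn_gt0 lt (leq_ltn_trans (leq_subr _ _)).
  have lt : (n' < n)%N by rewrite ltn_neqAle eq_sym nn'.
  have : om ^+ (n - n') = 1.
    by rewrite -z1 -[in RHS](subnK le) exprD -mulrA omX mulr1.
  by apply/eqP/prim; rewrite subn_gt0 lt (leq_ltn_trans (leq_subr _ _)).
apply/eqP; have : (z - 1) * \sum_(k < m) z ^+ k = 0 by rewrite -subrX1 zm subrr.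
by move/eqP; rewrite mulf_eq0 subr_eq0 (negbTE z1).
Qed.

Lemma finite_parseval (om : C) m (a : nat -> C) :
  nm om = 1 -> om ^+ m = 1 -> (forall k, (0 < k < m)%N -> om ^+ k != 1) ->
  \sum_(k < m) nm (\sum_(n < m) a n * (om ^+ k) ^+ n) ^+ 2 = m%:R * \sum_(n < m) nm (a n) ^+ 2.
Proof.
move=> om1 omm prim.
suff : of_real (\sum_(k < m) nm (\sum_(n < m) a n * (om ^+ k) ^+ n) ^+ 2) =
   of_real (m%:R * \sum_(n < m) nm (a n) ^+ 2).
  by move/(congr1 (@re R)); rewrite !re_of_real.
rewrite of_realM of_real_nat !of_real_sum.
under eq_bigr => k _ do rewrite nm_sqr_cj cj_sum mulr_suml.
under eq_bigr => k _ do under eq_bigr => n _ do rewrite mulr_sumr.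
rewrite exchange_big /= mulr_sumr; apply: eq_bigr => n _.
rewrite exchange_big /= (bigD1 n) //= [X in _ + X]big1 ?addr0.
  transitivity (a n * cj (a n) * \sum_(k < m) (om ^+ n * cj (om ^+ n)) ^+ k).
    rewrite mulr_sumr; apply: eq_bigr => k _.
    by rewrite cjM !cjX exprMn -!exprM ![(n * k)%N]mulnC; ring.
  by rewrite sum_root_of_unity // eqxx nm_sqr_cj mulrC.
move=> n' nn'.
transitivity (a n * cj (a n') * \sum_(k < m) (om ^+ n * cj (om ^+ n')) ^+ k).
  rewrite mulr_sumr; apply: eq_bigr => k _.
  by rewrite cjM !cjX exprMn -!exprM ![(_ * k)%N]mulnC; ring.
by rewrite sum_root_of_unity // (inj_eq val_inj) eq_sym (negbTE nn') mulr0.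
Qed.

End parseval.

Section pser.
Variable R : realType.
Local Notation C := (Cplx R).
Implicit Types (c d : nat -> C) (f g : C -> C).

Definition psum c (K : nat) (e : C) : C := \sum_(n < K) c n * e ^+ n.

Definition pbound (r : R) c f (B th : R) :=
  [/\ 0 <= B, 0 < th, th < 1, forall n, nm (c n) * r ^+ n <= B * th ^+ n &
   forall e K, nm e <= r -> nm (f e - psum c K e) <= B * th ^+ K].

(* [f] has the Taylor coefficients [c], with a radius of convergence larger
   than [r]; closed under products with rational functions regular on the disc. *)
Definition pser (r : R) c f := exists B th, pbound r c f B th.

Lemma pbound_weaken r c f B th B' th' : pbound r c f B th ->
  B <= B' -> th <= th' -> th' < 1 -> pbound r c f B' th'.
Proof.
move=> [B0 th0 th1 h1 h2] BB tt t1.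
have h n : B * th ^+ n <= B' * th' ^+ n.
  apply: ler_pM => //; first by rewrite exprn_ge0 // ltW.
  by rewrite lerXn2r ?nnegrE // ltW // (lt_le_trans th0).
split=> //; [exact: le_trans BB|exact: lt_le_trans tt| |].
  by move=> n; apply: le_trans (h1 n) (h n).
by move=> e K he; apply: le_trans (h2 e K he) (h K).
Qed.

Lemma pser2 r c f d g : pser r c f -> pser r d g ->
  exists B th, pbound r c f B th /\ pbound r d g B th.
Proof.
move=> [B [th hb]] [B' [th' hb']]; have [B0 t0 t1 _ _] := hb; have [B0' t0' t1' _ _] := hb'.
exists (B + B'), (Num.max th th').
by split; [apply: pbound_weaken hb _ _ _|apply: pbound_weaken hb' _ _ _];
  rewrite ?lerDl ?lerDr ?le_max ?lexx ?orbT // gt_max t1.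
Qed.

Lemma pser_ext r c f d g : (forall n, c n = d n) -> (forall e, nm e <= r -> f e = g e) ->
  pser r c f -> pser r d g.
Proof.
move=> cd fg [B [th [B0 t0 t1 h1 h2]]]; exists B, th; split=> // [n|e K he].
  by rewrite -cd.
rewrite -fg //; have -> : psum d K e = psum c K e by apply: eq_bigr => n _; rewrite cd.
exact: h2.
Qed.

Lemma pser_lin r c f d g (a b : C) : pser r c f -> pser r d g ->
  pser r (fun n => a * c n + b * d n) (fun e => a * f e + b * g e).
Proof.
move=> hf hg; have [B [th [[B0 t0 t1 h1 h2] [_ _ _ h3 h4]]]] := pser2 hf hg.
exists ((nm a + nm b) * B), th; split=> //.
- by rewrite mulr_ge0 ?addr_ge0 ?nm_ge0.
- move=> n; have rn : 0 <= r ^+ n -> nm (a * c n + b * d n) * r ^+ n <= (nm a + nm b) * B * th ^+ n.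
    move=> r0; apply: le_trans (ler_wpM2r r0 (nm_le_add _ _)) _; rewrite !nmM mulrDl.
    by rewrite -mulrA mulrDl; apply: lerD; rewrite -mulrA ler_wpM2l ?nm_ge0.
  have [|rn0] := leP 0 (r ^+ n); first exact: rn.
  apply: le_trans (_ : 0 <= _); first by rewrite mulr_ge0_le0 ?nm_ge0 // ltW.
  by rewrite !mulr_ge0 ?addr_ge0 ?nm_ge0 // exprn_ge0 // ltW.
move=> e K he.
have -> : a * f e + b * g e - psum (fun n => a * c n + b * d n) K e =
   a * (f e - psum c K e) + b * (g e - psum d K e).
  rewrite /psum; under eq_bigr do rewrite mulrDl -!mulrA.
  by rewrite big_split /= -!mulr_sumr; ring.
apply: le_trans (nm_le_add _ _) _; rewrite !nmM -mulrA mulrDl.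
by apply: lerD; rewrite ler_wpM2l ?nm_ge0 ?h2 ?h4.
Qed.

Definition shiftc c n : C := if n is m.+1 then c m else 0.

Lemma psum_shift c K e : psum (shiftc c) K.+1 e = e * psum c K e.
Proof.
rewrite /psum big_ord_recl /= mul0r add0r mulr_sumr; apply: eq_bigr => i _.
by rewrite /= exprS; ring.
Qed.

Lemma pser_shift r c f : 0 <= r -> pser r c f -> pser r (shiftc c) (fun e => e * f e).
Proof.
move=> r0 [B [th [B0 t0 t1 h1 h2]]].
have t0' : 0 <= th by exact: ltW.
have nf e : nm e <= r -> nm (f e) <= B.
  by move=> he; have := h2 e 0%N he; rewrite /psum big_ord0 subr0 expr0 mulr1.
exists (B * (r / th) + r * B), th; split=> //.
- by rewrite addr_ge0 // !mulr_ge0 // invr_ge0.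
- case=> [|n].
    by rewrite /= nm0 mul0r mulr_ge0 // addr_ge0 // !mulr_ge0 // invr_ge0.
  rewrite /= exprS mulrCA mulrDl; apply: ler_wpDr.
    by rewrite !mulr_ge0 // exprn_ge0.
  apply: le_trans (ler_wpM2l r0 (h1 n)) _.
  by rewrite exprS le_eqVlt; apply/orP; left; apply/eqP; field; rewrite gt_eqF.
- move=> e [|K] he.
    rewrite /psum big_ord0 subr0 expr0 mulr1 nmM; apply: ler_wpDl.
      by rewrite !mulr_ge0 // invr_ge0.
    by apply: ler_pM; rewrite ?nm_ge0 ?nf.
  rewrite psum_shift -mulrBr nmM mulrDl; apply: ler_wpDr.
    by rewrite !mulr_ge0 // exprn_ge0.
  apply: le_trans (ler_pM (nm_ge0 _) (nm_ge0 _) he (h2 e K he)) _.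
  by rewrite exprS le_eqVlt; apply/orP; left; apply/eqP; field; rewrite gt_eqF.
Qed.

Lemma pser_const r (a : C) : 0 <= r ->
  pser r (fun n => if n is 0%N then a else 0) (fun=> a).
Proof.
move=> r0; exists (nm a), (1/2); split; [exact: nm_ge0|lra|lra| |].
  move=> [|n] /=; first by rewrite !expr0.
  by rewrite nm0 mul0r mulr_ge0 ?nm_ge0 // exprn_ge0.
move=> e [|K] he; first by rewrite /psum big_ord0 subr0 expr0 mulr1.
rewrite /psum big_ord_recl /= expr0 mulr1 big1 ?addr0 => [|i _]; last by rewrite /= mul0r.
by rewrite subrr nm0 mulr_ge0 ?nm_ge0 // exprn_ge0.
Qed.

Lemma pser_poly r (p : {poly C}) : 0 <= r -> pser r (fun n => p`_n) (fun e => p.[e]).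
Proof.
move=> r0; elim/poly_ind: p => [|p a IH].
  apply: pser_ext (pser_const 0 r0); first by case=> [|n]; rewrite coef0.
  by move=> e _; rewrite horner0.
have := pser_lin 1 1 (pser_shift r0 IH) (pser_const a r0).
apply: pser_ext => [n|e _]; rewrite !mul1r.
  by rewrite coefD coefMX coefC; case: n => [|n] /=; rewrite ?addr0.
by rewrite hornerMXaddC mulrC.
Qed.

(* The coefficients of [f e / (e - rho)]. *)
Fixpoint divc (rho : C) c n : C :=
  if n is m.+1 then (divc rho c m - c n) / rho else - c 0%N / rho.

(** The recursion of [divc] makes the product telescope; only a boundary term survives. *)
Lemma psum_divc rho c K e : rho != 0 ->
  (e - rho) * psum (divc rho c) K.+1 e = psum c K.+1 e + divc rho c K * e ^+ K.+1.
Proof.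
move=> rho0; elim: K => [|K IH].
  by rewrite /psum !big_ord_recl !big_ord0 /= !expr0 expr1; field.
have -> : psum (divc rho c) K.+2 e = psum (divc rho c) K.+1 e + divc rho c K.+1 * e ^+ K.+1.
  by rewrite /psum big_ord_recr.
have -> : psum c K.+2 e = psum c K.+1 e + c K.+1 * e ^+ K.+1 by rewrite /psum big_ord_recr.
have -> : divc rho c K.+1 = (divc rho c K - c K.+1) / rho by [].
rewrite mulrDr IH [e ^+ K.+2]exprS; move: (e ^+ K.+1) (psum _ _ _) => x y.
by field.
Qed.

Lemma pser_div r c f rho : 0 < r -> r < nm rho -> pser r c f ->
  pser r (divc rho c) (fun e => f e / (e - rho)).
Proof.
move=> r0 rrho [B [th [B0 t0 t1 h1 h2]]].
have r0' := ltW r0.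
have rho0 : 0 < nm rho by exact: lt_trans rrho.
have rhoN0 : rho != 0 by rewrite -nm_gt0.
pose la := r / nm rho; have la1 : la < 1 by rewrite /la ltr_pdivrMr // mul1r.
have la0 : 0 < la by rewrite divr_gt0.
pose th' := (1 + Num.max th la) / 2.
have m1 : Num.max th la < 1 by rewrite gt_max t1.
have thm : th <= Num.max th la by rewrite le_max lexx.
have lam : la <= Num.max th la by rewrite le_max lexx orbT.
have th'1 : th' < 1 by rewrite /th'; lra.
have lath' : la < th' by rewrite /th'; lra.
have thth' : th < th' by rewrite /th'; lra.
have th'0 : 0 < th' by exact: lt_trans lath'.
have gap : 0 < 1 - la / th' by rewrite subr_gt0 ltr_pdivrMr // mul1r.
(* [B'] solves [B' = B / |rho| + (la / th') B'], the recursion of [divc] read on bounds; [th' > la]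
   makes it solvable. *)
pose B' := B / nm rho / (1 - la / th').
have B'0 : 0 <= B' by rewrite /B' !mulr_ge0 ?invr_ge0 // ltW.
have B'E : B / nm rho + la / th' * B' = B'.
  by rewrite /B'; field; rewrite !gt_eqF //= subr_gt0.
have hd n : nm (divc rho c n) * r ^+ n <= B' * th' ^+ n.
  elim: n => [|n IH] /=.
    rewrite !expr0 !mulr1 nmM nmN nmV.
    have := h1 0%N; rewrite !expr0 !mulr1 => h.
    rewrite -B'E; apply: ler_wpDr; first by rewrite !mulr_ge0 ?invr_ge0 // ltW.
    by rewrite ler_wpM2r // invr_ge0 ltW.
  rewrite nmM nmV.
  have e1 : nm (divc rho c n - c n.+1) * r ^+ n.+1 <= r * (B' * th' ^+ n) + B * th' ^+ n.+1.
    have rn : 0 <= r ^+ n.+1 by rewrite exprn_ge0.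
    apply: le_trans (ler_wpM2r rn (nm_le_sub _ _)) _; rewrite mulrDl; apply: lerD.
      by rewrite exprS mulrCA ler_wpM2l.
    apply: le_trans (h1 n.+1) _; apply: ler_wpM2l => //.
    by rewrite lerXn2r ?nnegrE ?ltW.
  rewrite mulrAC; apply: le_trans (ler_wpM2r _ e1) _; first by rewrite invr_ge0 ltW.
  rewrite -[in leRHS]B'E exprS le_eqVlt; apply/orP; left; apply/eqP.
  by rewrite /la; field; rewrite !gt_eqF.
have er e : nm e <= r -> nm rho - r <= nm (e - rho).
  by move=> he; have := nm_ge_sub (- rho) e; rewrite nmN addrC [- rho + e]addrC; lra.
have gr : 0 < nm rho - r by rewrite subr_gt0.
pose B2 := (B + r / th' * B') / (nm rho - r).
have B20 : 0 <= B2.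
  by rewrite /B2 mulr_ge0 ?invr_ge0 ?(ltW gr) // addr_ge0 // !mulr_ge0 ?invr_ge0 // ltW.
exists (B2 + B'), th'; split=> //; first by rewrite addr_ge0.
  move=> n; apply: le_trans (hd n) _; apply: ler_wpM2r; first by rewrite exprn_ge0 // ltW.
  by rewrite lerDr.
move=> e K he; have eg := er e he.
have ep : 0 < nm (e - rho) by exact: lt_le_trans eg.
have eN : e - rho != 0 by rewrite -nm_gt0.
suff h : nm (f e - (e - rho) * psum (divc rho c) K e) <= (B + r / th' * B') * th' ^+ K.
  have -> : f e / (e - rho) - psum (divc rho c) K e =
     (f e - (e - rho) * psum (divc rho c) K e) / (e - rho) by field.
  rewrite nmM nmV; apply: (@le_trans _ _ (B2 * th' ^+ K)); last first.
    by apply: ler_wpM2r; [rewrite exprn_ge0 // ltW|rewrite lerDl].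
  rewrite /B2 [leRHS]mulrAC; apply: ler_pM => //; rewrite ?nm_ge0 ?invr_ge0 ?nm_ge0 //.
  by rewrite lef_pV2 ?posrE.
case: K => [|K].
  rewrite /psum big_ord0 mulr0 expr0 mulr1.
  apply: ler_wpDr; first by rewrite !mulr_ge0 ?invr_ge0 // ltW.
  by have := h2 e 0%N he; rewrite /psum big_ord0 expr0 mulr1.
rewrite psum_divc // opprD addrA mulrDl; apply: le_trans (nm_le_sub _ _) _; apply: lerD.
  apply: le_trans (h2 e K.+1 he) _; apply: ler_wpM2l => //.
  by rewrite lerXn2r ?nnegrE // ltW.
rewrite nmM nmX.
apply: (@le_trans _ _ (nm (divc rho c K) * r ^+ K.+1)).
  by apply: ler_wpM2l; rewrite ?nm_ge0 // lerXn2r ?nnegrE ?nm_ge0.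
rewrite exprS mulrCA; apply: le_trans (ler_wpM2l r0' (hd K)) _.
by rewrite exprS le_eqVlt; apply/orP; left; apply/eqP; field; rewrite gt_eqF.
Qed.

End pser.

(** * Mean square bounds for coefficients, and expansions of rational functions *)

Section pser2.
Variable R : realType.
Local Notation C := (Cplx R).
Implicit Types (c d : nat -> C) (f g : C -> C).

Lemma expr_small (th eta : R) : 0 <= th -> th < 1 -> 0 < eta ->
  exists N, forall n, (N <= n)%N -> th ^+ n <= eta.
Proof.
move=> t0 t1 e0; have h : (fun n => th ^+ n) @ \oo --> (0 : R) by apply: cvg_expr; rewrite ger0_norm.
have /cvgrPdist_le/(_ _ e0)[N _ hN] := h.
by exists N => n nN; have := hN n nN; rewrite /= sub0r normrN ger0_norm // exprn_ge0.
Qed.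

(** Parseval without an integral: apply [finite_parseval] to the partial sum of length [L] at the
    [L]-th roots of unity scaled by [r]. On that circle it differs from [f] by at most [B * th ^ L],
    which disappears as [L] grows. *)
Lemma pser_parseval r c f (M : R) : 0 <= r -> pser r c f ->
  (forall e, nm e = r -> nm (f e) <= M) ->
  forall K, \sum_(n < K) (nm (c n) * r ^+ n) ^+ 2 <= M ^+ 2.
Proof.
move=> r0 [B [th [B0 t0 t1 h1 h2]]] hM K; set S := \sum_(n < K) _.
have M0 : 0 <= M.
  by apply: le_trans (nm_ge0 _) (hM (of_real r) _); rewrite nm_of_real ger0_norm.
have key L : (K <= L)%N -> (0 < L)%N -> S <= (M + B * th ^+ L) ^+ 2.
  move=> KL L0; have [om [om1 omL omp]] := root_of_unity R L0.
  have := finite_parseval (fun n => c n * of_real r ^+ n) om1 omL omp.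
  have -> : \sum_(k < L) nm (\sum_(n < L) c n * of_real r ^+ n * (om ^+ k) ^+ n) ^+ 2 =
      \sum_(k < L) nm (psum c L (of_real r * om ^+ k)) ^+ 2.
    apply: eq_bigr => k _; congr (nm _ ^+ 2); apply: eq_bigr => n _.
    by rewrite exprMn mulrA.
  move=> hP; have Lp : 0 < L%:R :> R by rewrite ltr0n.
  apply: (@le_trans _ _ (\sum_(n < L) nm (c n * of_real r ^+ n) ^+ 2)).
    rewrite /S (big_ord_widen L (fun n => (nm (c n) * r ^+ n) ^+ 2)) // big_mkcond /=.
    apply: ler_sum => n _; case: ifP => _; last exact: sqr_ge0.
    by rewrite nmM nmX nm_of_real ger0_norm.
  rewrite -(ler_pM2l Lp) -hP.
  have -> : L%:R * (M + B * th ^+ L) ^+ 2 = \sum_(k < L) (M + B * th ^+ L) ^+ 2.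
    by rewrite sumr_const card_ord mulr_natl.
  apply: ler_sum => k _.
  have ek : nm (of_real r * om ^+ k) = r.
    by rewrite nmM nmX om1 expr1n mulr1 nm_of_real ger0_norm.
  rewrite ler_sqr ?nnegrE ?nm_ge0 ?addr_ge0 ?mulr_ge0 ?exprn_ge0 ?(ltW t0) //.
  have := h2 _ L (_ : nm (of_real r * om ^+ k) <= r); rewrite ek lexx => /(_ isT) h.
  have := nm_le_sub (f (of_real r * om ^+ k)) (f (of_real r * om ^+ k) - psum c L (of_real r * om ^+ k)).
  rewrite subKr => h'; apply: (le_trans h'); apply: lerD => //.
  by rewrite hM // ek.
rewrite leNgt; apply/negP => hS.
have [eta e0 he] : exists2 eta : R, 0 < eta & (M + eta) ^+ 2 < S.
  pose D := S - M ^+ 2; have D0 : 0 < D by rewrite subr_gt0.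
  have Mp : 0 < 2 * M + 2 by lra.
  exists (Num.min 1 (D / (2 * M + 2))); first by rewrite lt_min ltr01 divr_gt0.
  set eta := Num.min _ _.
  have e1 : eta <= 1 by rewrite ge_min lexx.
  have e2 : eta <= D / (2 * M + 2) by rewrite ge_min lexx orbT.
  have e0 : 0 < eta by rewrite lt_min ltr01 divr_gt0.
  have e3 : eta * (2 * M + 2) <= D by rewrite -ler_pdivlMr.
  have -> : S = D + M ^+ 2 by rewrite subrK.
  have : eta * eta <= eta by rewrite ler_piMl // ltW.
  rewrite !expr2; nra.
have Bp : 0 < B + 1 by lra.
have [N hN] := expr_small (ltW t0) t1 (divr_gt0 e0 Bp).
have h := key (maxn K N).+1 (leq_trans (leq_maxl _ _) (leqnSn _)) isT.
have : B * th ^+ (maxn K N).+1 <= eta.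
  apply: (@le_trans _ _ ((B + 1) * (eta / (B + 1)))); last by rewrite mulrCA divff ?mulr1 ?gt_eqF.
  apply: ler_pM => //; [by rewrite exprn_ge0 // ltW|lra|].
  by apply: hN; rewrite (leq_trans (leq_maxr _ _) (leqnSn _)).
have tp : 0 <= B * th ^+ (maxn K N).+1 by rewrite mulr_ge0 // exprn_ge0 // ltW.
move: h tp he; move: (B * th ^+ _) => y h y0 he yeta.
suff : (M + y) ^+ 2 <= (M + eta) ^+ 2 by lra.
by rewrite ler_sqr ?nnegrE; lra.
Qed.

Lemma pser_radius r s c f : 0 <= s -> s <= r -> pser r c f -> pser s c f.
Proof.
move=> s0 sr [B [th [B0 t0 t1 h1 h2]]]; exists B, th; split=> // [n|e K he].
  apply: le_trans (h1 n); rewrite ler_wpM2l ?nm_ge0 // lerXn2r ?nnegrE //.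
  exact: le_trans sr.
by apply: h2; exact: le_trans sr.
Qed.

(** Cauchy's estimate, read off from a single term of Parseval's sum. *)
Lemma pser_coef_bound r s c f (M : R) n : 0 <= s -> s <= r -> pser r c f ->
  (forall e, nm e = s -> nm (f e) <= M) -> nm (c n) * s ^+ n <= M.
Proof.
move=> s0 sr hf hM; have := pser_parseval s0 (pser_radius s0 sr hf) hM n.+1.
have M0 : 0 <= M.
  by apply: le_trans (nm_ge0 _) (hM (of_real s) _); rewrite nm_of_real ger0_norm.
rewrite big_ord_recr /= => h; apply: sqr_le_inv => //; apply: le_trans h.
by rewrite lerDr sumr_ge0 // => i _; exact: sqr_ge0.
Qed.

(** [f] is [A / D] and [f1] is [e f'(e)], whose coefficients are [n c_n]. The latter is specified by
    [e] times the derivative of [D f = A], a purely algebraic identity. The induction divides by one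
    linear factor at a time. *)
Lemma pser_prod (A : {poly C}) (rs : seq C) r : 0 < r -> all (fun rho => r < nm rho) rs ->
  let D := \prod_(rho <- rs) ('X - rho%:P) in
  exists c f f1, [/\ pser r c f, pser r (fun n => n%:R * c n) f1 &
   forall e, nm e <= r -> D.[e] * f e = A.[e] /\
      D.[e] * f1 e + e * D^`().[e] * f e = e * A^`().[e]].
Proof.
move=> r0; elim: rs => [|rho rs IH] /=.
  move=> _; rewrite big_nil; exists (fun n => A`_n), (fun e => A.[e]), (fun e => e * A^`().[e]); split.
  - exact: pser_poly (ltW r0).
  - apply: pser_ext (pser_poly ('X * A^`()) (ltW r0)).
      case=> [|n]; first by rewrite coefXM /= mul0r.
      by rewrite coefXM /= coef_deriv mulr_natl.
    by move=> e _; rewrite hornerM hornerX.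
  - by move=> e _; rewrite derivC hornerC horner0 !mul1r mulr0 mul0r addr0.
move=> /andP[rrho /IH]; set D0 := \prod_(_ <- rs) _.
move=> [c [f [f1 [h1 h2 h3]]]]; rewrite big_cons -/D0.
pose d := divc rho c; pose g e := f e / (e - rho).
have hg : pser r d g by exact: pser_div.
(* The quotient rule for [e g'] with [g = f / (e - rho)]. *)
pose g1 e := (f1 e - e * g e) / (e - rho).
have hg1 : pser r (fun n => n%:R * d n) g1.
  have := pser_div r0 rrho (pser_lin 1 (-1) h2 (pser_shift (ltW r0) hg)).
  apply: pser_ext => [n|e _]; last by rewrite /g1 mul1r mulN1r.
  elim: n => [|n IHn]; first by rewrite /= mulr0 mul0r mulr0 addr0 oppr0 !mul0r.
  have -> : d n.+1 = (d n - c n.+1) / rho by [].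
  have nE : n.+1%:R = n%:R + 1 :> C by rewrite natr1.
  by rewrite [LHS]/= IHn nE; ring.
exists d, g, g1; split=> // e he.
have eN : e - rho != 0.
  rewrite -nm_gt0; have := nm_ge_sub (- rho) e; rewrite nmN addrC [- rho + e]addrC; lra.
have [h4 h5] := h3 e he.
rewrite derivM derivXsubC mul1r hornerD !hornerM hornerXsubC -h4 -h5 /g1 /g.
by split; field.
Qed.

Lemma pser_frac (A D : {poly C}) r : 0 < r -> (forall e, nm e <= r -> D.[e] != 0) ->
  exists c f f1, [/\ pser r c f, pser r (fun n => n%:R * c n) f1 &
   forall e, nm e <= r -> D.[e] * f e = A.[e] /\
      D.[e] * f1 e + e * D^`().[e] * f e = e * A^`().[e]].
Proof.
move=> r0 hD.
have [rs Drs] := @closed_field_poly_normal R[i]%C D.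
have lD : lead_coef D != 0.
  rewrite lead_coef_eq0; apply/eqP => DE.
  by have := hD 0; rewrite DE horner0 eqxx nm0 ltW // => /(_ isT).
have Drs' : D = lead_coef D *: \prod_(rho <- rs) ('X - rho%:P) by exact: Drs.
have hrs : all (fun rho : C => r < nm rho) rs.
  apply/allP => rho hrho; rewrite ltNge; apply/negP => /hD/negP; apply.
  rewrite Drs' hornerZ mulf_eq0 (negbTE lD) /=.
  by rewrite -/(root _ _) root_prod_XsubC.
have [c [f [f1 [h1 h2 h3]]]] := pser_prod ((lead_coef D)^-1 *: A) r0 hrs.
exists c, f, f1; split=> // e /h3[h4 h5]; rewrite Drs' derivZ !hornerZ.
split; first by rewrite -mulrA h4 hornerZ mulrA divff // mul1r.
set l := lead_coef D in lD *; set P := \prod_(_ <- rs) _ in h5 *.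
have -> : l * P.[e] * f1 e + e * (l * P^`().[e]) * f e = l * (P.[e] * f1 e + e * P^`().[e] * f e) by ring.
by rewrite h5 derivZ hornerZ mulrCA; congr (e * _); rewrite mulrA divff // mul1r.
Qed.

End pser2.

(** * The functions H_n *)

Section polyops.
Variable F : numFieldType.
Implicit Types (h r : {poly F}).

(** The binomial is, up to sign, [1 / j!] times the coefficient in the [j]-th derivative of
    [(y - 2) ^ -(l + 2)]; the power of 2 arises because [1 / (2 z - 2)] is [w / 2]. *)
Definition pcoef (l j : nat) : F := 'C(l + j + 1, j)%:R * 2 ^- (l + j + 2).

Definition pmono (l j : nat) : {poly F} :=
  pcoef l j *: ((-1) ^+ j *: ('X^l * (1 + 'X) ^+ j) - (-1) ^+ l *: ('X^j * (1 + 'X) ^+ l)).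

(* If [H y = h(v) v ^ 2] for [v = 1 / (y - 2)], then
   [(H^(j)(2 z) z ^ j - H^(j)(2 / z) / z ^ (j + 2)) / j!] is [(pop j h)(w) w ^ 2]
   for [w = 1 / (z - 1)]; see [Tj_pos]. *)
Definition pop (j : nat) h : {poly F} := \sum_(l < size h) h`_l *: pmono l j.

Lemma popE j h N : (size h <= N)%N -> pop j h = \sum_(l < N) h`_l *: pmono l j.
Proof.
move=> hN; rewrite /pop (big_ord_widen N (fun l => h`_l *: pmono l j)) // big_mkcond /=.
apply: eq_bigr => l _; case: ltnP => // hl.
by rewrite nth_default // scale0r.
Qed.

Lemma popD j h1 h2 : pop j (h1 + h2) = pop j h1 + pop j h2.
Proof.
pose N := maxn (size h1) (size h2).
rewrite (popE j (size_polyD h1 h2)) (popE j (leq_maxl _ _ : (size h1 <= N)%N)) (popE j (leq_maxr _ _ : (size h2 <= N)%N)).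
by rewrite -big_split /=; apply: eq_bigr => l _; rewrite coefD scalerDl.
Qed.

Lemma popXn j (a : F) n : pop j (a *: 'X^n) = a *: pmono n j.
Proof.
have s : (size (a *: 'X^n) <= n.+1)%N by apply: leq_trans (size_scale_leq _ _) _; rewrite size_polyXn.
rewrite (popE j s) (bigD1 ord_max) //= coefZ coefXn eqxx mulr1 big1 ?addr0 // => i ni.
by rewrite coefZ coefXn; move: ni; rewrite -(inj_eq val_inj) /= => /negbTE ->; rewrite mulr0 scale0r.
Qed.

Lemma size_X1n l : size ((1 + 'X : {poly F}) ^+ l) = l.+1.
Proof.
have s : size (1 + 'X : {poly F}) = 2%N by rewrite addrC size_addl ?size_polyX ?size_poly1.
elim: l => [|l IH]; first by rewrite expr0 size_poly1.
by rewrite exprS size_proper_mul ?s ?IH // mulf_neq0 // lead_coef_eq0 -size_poly_eq0 ?s ?IH.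
Qed.

Lemma size_pmono l j : (size (pmono l j) <= (l + j).+1)%N.
Proof.
have h a b (c : F) : (size (c *: ('X^a * (1 + 'X : {poly F}) ^+ b)) <= (a + b).+1)%N.
  apply: leq_trans (size_scale_leq _ _) _; apply: leq_trans (size_polyMleq _ _) _.
  by rewrite size_polyXn size_X1n addSn addnS.
apply: leq_trans (size_scale_leq _ _) _; apply: leq_trans (size_polyD _ _) _.
by rewrite size_polyN geq_max h /= addnC h.
Qed.

Lemma size_pop j h n : (size h <= n)%N -> (0 < n)%N -> (size (pop j h) <= n + j)%N.
Proof.
move=> hn n0; rewrite (popE j hn); apply: leq_trans (size_sum _ _ _) _.
apply/bigmax_leqP => l _; apply: leq_trans (size_scale_leq _ _) _.
apply: leq_trans (size_pmono _ _) _; rewrite -addSn leq_add2r; exact: ltn_ord.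
Qed.

Lemma pmono_lead n : (pmono n 0)`_n = 2 ^- (n + 2) * (1 - (-1) ^+ n).
Proof.
rewrite /pmono /pcoef addn0 bin0 mul1r expr0 scale1r expr0 mulr1 mul1r coefZ coefB coefZ coefXn eqxx.
congr (_ * (_ - _)).
have := size_X1n n; have : (1 + 'X : {poly F}) ^+ n \is monic.
  by rewrite monic_exp // addrC -[1]opprK -polyC1 -polyCN monicXsubC.
by rewrite monicE lead_coefE => /eqP + sE; rewrite sE /= => ->; rewrite mulr1.
Qed.

(** [pop 0] does not raise the degree and multiplies the coefficient of [X ^ n] by [la], with
    [la < 1]. So [1 - pop 0] is triangular with nonzero diagonal, and is inverted from the top
    coefficient downwards. *)
Lemma pop0_solve n r : (size r <= n)%N ->
  exists2 h : {poly F}, (size h <= n)%N & h - pop 0 h = r.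
Proof.
elim: n r => [|n IH] r hr.
  exists 0; first by rewrite size_poly0.
  by move: hr; rewrite leqn0 size_poly_eq0 => /eqP ->; rewrite /pop size_poly0 big_ord0 subr0.
pose la : F := 2 ^- (n + 2) * (1 - (-1) ^+ n).
have la1 : 1 - la != 0.
  rewrite subr_eq0; apply/eqP => h1.
  have : la < 1.
    rewrite /la; have h2 : (1 - (-1) ^+ n : F) <= 2.
      by rewrite -signr_odd; case: (odd n); rewrite ?expr0 ?expr1 ?opprK ?subrr ?ler0n //; exact: lexx.
    apply: (@le_lt_trans _ _ (2 ^- (n + 2) * 2)).
      by rewrite ler_wpM2l // invr_ge0 exprn_ge0.
    rewrite addn2 exprS invfM mulrAC mulVf ?pnatr_eq0 // mul1r.
    by rewrite invf_lt1 ?exprn_gt0 // exprn_egt1 // ltr1n.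
  by rewrite -h1 ltxx.
pose h0 : {poly F} := (r`_n / (1 - la)) *: 'X^n.
pose r' := r - (h0 - pop 0 h0).
have sr' : (size r' <= n)%N.
  apply/leq_sizeP => k; rewrite leq_eqVlt => /orP[/eqP <-|nk].
    rewrite /r' coefB coefB popXn (coefZ _ (pmono n 0)) pmono_lead -/la coefZ coefXn eqxx mulr1.
    by field.
  have ss : (size r' <= n.+1)%N.
    rewrite /r'; apply: leq_trans (size_polyD _ _) _; rewrite geq_max hr size_polyN /=.
    apply: leq_trans (size_polyD _ _) _; rewrite geq_max size_polyN popXn.
    apply/andP; split; apply: leq_trans (size_scale_leq _ _) _; first by rewrite size_polyXn.
    by apply: leq_trans (size_pmono _ _) _; rewrite addn0.
  by rewrite nth_default // (leq_trans ss).
have [h' sh' h'E] := IH _ sr'; exists (h0 + h').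
  apply: leq_trans (size_polyD _ _) _; rewrite geq_max (leq_trans sh') // andbT.
  by apply: leq_trans (size_scale_leq _ _) _; rewrite size_polyXn.
by rewrite popD opprD addrACA h'E /r' addrC subrK.
Qed.

Lemma pmono_eval l j (v : F) : (pmono l j).[v] =
  pcoef l j * ((-1) ^+ j * (v ^+ l * (1 + v) ^+ j) - (-1) ^+ l * (v ^+ j * (1 + v) ^+ l)).
Proof. by rewrite /pmono hornerZ hornerD hornerN !hornerZ !hornerM !horner_exp !hornerD !hornerX !hornerC. Qed.

(** The reflection [v -> -1 - v] exchanges [v] and [1 + v] up to sign, and with them the two terms
    of [pmono]. For [v = 1 / (z - 1)] it is [z -> 1 / z]. *)
Lemma pmono_odd l j (v : F) : (pmono l j).[-1 - v] = - (pmono l j).[v].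
Proof.
rewrite !pmono_eval; have -> : 1 + (-1 - v) = - v by ring.
have -> : -1 - v = - (1 + v) by ring.
rewrite !(exprNn v) !(exprNn (1 + v)) -[RHS]mulrN; congr (_ * _).
have s k : (-1) ^+ k * (-1) ^+ k = 1 :> F by rewrite -expr2 sqrr_sign.
transitivity ((-1) ^+ j * (-1) ^+ j * ((-1) ^+ l * ((1 + v) ^+ l * v ^+ j)) -
   (-1) ^+ l * (-1) ^+ l * ((-1) ^+ j * ((1 + v) ^+ j * v ^+ l))); first by ring.
by rewrite !s; ring.
Qed.

Lemma pop_odd j h (v : F) : (pop j h).[-1 - v] = - (pop j h).[v].
Proof.
rewrite /pop !horner_sum -sumrN; apply: eq_bigr => l _.
by rewrite (hornerZ _ (pmono l j) (-1 - v)) (hornerZ _ (pmono l j) v) pmono_odd mulrN.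
Qed.

(* The contribution of [H_0], which is not of the form [v ^ 2 h(v)]; see [Tj_src]. *)
Definition psrc (n : nat) : {poly F} :=
  2 ^- n *: ((-1) ^+ n.-1 *: (1 + 'X) ^+ n.-1 - 'X^(n.-1)).

Lemma psrc_eval n (v : F) : (psrc n).[v] = 2 ^- n * ((-1) ^+ n.-1 * (1 + v) ^+ n.-1 - v ^+ n.-1).
Proof. by rewrite /psrc hornerZ hornerD hornerN hornerZ !horner_exp hornerD hornerX !hornerC. Qed.

Lemma psrc_odd n (v : F) : (psrc n).[-1 - v] = - (psrc n).[v].
Proof.
rewrite !psrc_eval; have -> : 1 + (-1 - v) = - v by ring.
have -> : -1 - v = - (1 + v) by ring.
rewrite !(exprNn v) !(exprNn (1 + v)); set k := n.-1.
have s : (-1) ^+ k * (-1) ^+ k = 1 :> F by rewrite -expr2 sqrr_sign.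
by rewrite mulrA s; ring.
Qed.

Lemma size_psrc n : (0 < n)%N -> (size (psrc n) <= n)%N.
Proof.
case: n => // n _; rewrite /psrc /=; apply: leq_trans (size_scale_leq _ _) _.
apply: leq_trans (size_polyD _ _) _; rewrite geq_max size_polyN size_polyXn leqnn andbT.
by apply: leq_trans (size_scale_leq _ _) _; rewrite size_X1n.
Qed.

(** Half of the left-hand side of the theorem's equation. The sums stop one index early because
    their last terms involve [H_0]; those two terms make up [psrc]. *)
Definition prhs (h : nat -> {poly F}) (n : nat) : {poly F} :=
  \sum_(1 <= j < n) pop j (h (n - j)%N)
  + 2^-1 *: (\sum_(0 <= j < n.-1) pop j (h (n - j - 1)%N))
  + 2^-1 *: psrc n.

(* The equations of the theorem for [H_n = v ^ 2 h_n(v)], [n >= 1]. *)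
Definition hsys (h : nat -> {poly F}) := forall n, (0 < n)%N ->
  (size (h n) <= n)%N /\ h n - pop 0 (h n) = prhs h n.

Lemma size_prhs (h : nat -> {poly F}) n : (0 < n)%N -> (forall m, (0 < m < n)%N -> (size (h m) <= m)%N) ->
  (size (prhs h n) <= n)%N.
Proof.
move=> n0 hs; rewrite /prhs; apply: leq_trans (size_polyD _ _) _; rewrite geq_max.
apply/andP; split; last by apply: leq_trans (size_scale_leq _ _) _; exact: size_psrc.
apply: leq_trans (size_polyD _ _) _; rewrite geq_max; apply/andP; split.
  rewrite big_nat; apply: (big_ind (fun p : {poly F} => size p <= n)%N) => [|x y hx hy|j /andP[j1 jn]].
  - by rewrite size_poly0.
  - by apply: leq_trans (size_polyD _ _) _; rewrite geq_max hx.
  have nj : (0 < n - j)%N by rewrite subn_gt0.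
  apply: leq_trans (@size_pop j _ (n - j)%N _ nj) _; last by rewrite subnK // ltnW.
  by apply: hs; rewrite nj /= -subn_gt0 subKn // ltnW.
apply: leq_trans (size_scale_leq _ _) _.
rewrite big_nat; apply: (big_ind (fun p : {poly F} => size p <= n)%N) => [|x y hx hy|j /andP[_ jn]].
- by rewrite size_poly0.
- by apply: leq_trans (size_polyD _ _) _; rewrite geq_max hx.
have nj : (0 < n - j - 1)%N by lia.
have le : (n - j - 1 + j <= n)%N by lia.
apply: leq_trans (@size_pop j _ (n - j - 1)%N _ nj) le.
by apply: hs; lia.
Qed.

Lemma prhs_ext (h1 h2 : nat -> {poly F}) n : (0 < n)%N -> (forall m, (0 < m < n)%N -> h1 m = h2 m) -> prhs h1 n = prhs h2 n.
Proof.
move=> n0 hh; rewrite /prhs; congr (_ + _ *: _ + _).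
  apply: eq_big_nat => j /andP[j1 jn]; rewrite hh // subn_gt0 jn /=.
  by rewrite -subn_gt0 subKn // ltnW.
by apply: eq_big_nat => j /andP[_ jn]; rewrite hh //; lia.
Qed.

Lemma hsys_exists : exists h : nat -> {poly F}, hsys h.
Proof.
(* The boolean implication holds for every table [s], so [xchoose] gives a total function of the
   earlier values; its premise is then discharged along the recursion by [size_prhs]. *)
have ex (s : nat -> {poly F}) n : exists p : {poly F},
   (0 < n)%N && (size (prhs s n) <= n)%N ==> (size p <= n)%N && (p - pop 0 p == prhs s n).
  have [/andP[n0 sz]|no] := boolP ((0 < n)%N && (size (prhs s n) <= n)%N).
    by have [p h1 /eqP h2] := pop0_solve sz; exists p; rewrite h1 h2 implybT.
  by exists 0.
pose nxt s n := xchoose (ex s n).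
pose build := fix build (n : nat) : nat -> {poly F} :=
  if n is m.+1 then fun k => if k == m.+1 then nxt (build m) m.+1 else build m k else fun=> 0.
pose h n := build n n.
have stable n k : (k <= n)%N -> build n k = h k.
  elim: n k => [|n IH] k; first by rewrite leqn0 => /eqP ->.
  rewrite leq_eqVlt => /orP[/eqP -> //|kn] /=.
  by rewrite ltn_eqF // IH.
exists h => n; elim/ltn_ind: n => -[//|n] IH _.
have hE : h n.+1 = nxt (build n) n.+1 by rewrite /h /= eqxx.
have := xchooseP (ex (build n) n.+1); rewrite -/(nxt _ _) -hE size_prhs //=; last first.
  by move=> m /andP[m0 mn]; rewrite stable //; have [] := IH m mn m0.
move=> /andP[h1 /eqP h2]; split=> //; rewrite h2; apply: prhs_ext => // m /andP[m0 mn].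
exact: stable.
Qed.

Lemma prhs_eval (h : nat -> {poly F}) n (v : F) : (prhs h n).[v] =
  \sum_(1 <= j < n) (pop j (h (n - j)%N)).[v]
  + 2^-1 * (\sum_(0 <= j < n.-1) (pop j (h (n - j - 1)%N)).[v]) + 2^-1 * (psrc n).[v].
Proof.
rewrite /prhs; pose p := psrc n; pose s1 := \sum_(1 <= j < n) pop j (h (n - j)%N).
pose s2 := \sum_(0 <= j < n.-1) pop j (h (n - j - 1)%N); rewrite -/p -/s1 -/s2.
by rewrite !hornerD (hornerZ _ p) (hornerZ _ s2) /s1 /s2 !horner_sum.
Qed.

(** Each term of [h n = pop 0 (h n) + prhs h n] on the right is odd. Both properties of [B_n] and
    the reflection to the second disc come from this. *)
Lemma hsys_odd (h : nat -> {poly F}) n (v : F) : hsys h -> (0 < n)%N -> (h n).[-1 - v] = - (h n).[v].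
Proof.
move=> hh n0; have [_ hE] := hh n n0.
have E u : (h n).[u] = (pop 0 (h n)).[u] + (prhs h n).[u] by rewrite -hornerD -hE addrC subrK.
rewrite !E pop_odd opprD; congr (_ + _); rewrite !prhs_eval psrc_odd.
rewrite !opprD -!mulrN -!sumrN.
by congr (_ + _ * _ + _); apply: eq_bigr => j _; rewrite pop_odd.
Qed.

End polyops.

(** * Transfer of the polynomial system along field morphisms *)

Section maps.
Variables (F1 F2 : numFieldType) (f : {rmorphism F1 -> F2}).
Local Notation mp := (map_poly f).

Lemma map_pmono l j : mp (pmono F1 l j) = pmono F2 l j.
Proof.
have fs k : f ((-1) ^+ k) = (-1) ^+ k by rewrite rmorphXn rmorphN rmorph1.
have fc : f (pcoef F1 l j) = pcoef F2 l j.
  by rewrite /pcoef rmorphM /= rmorph_nat fmorphV rmorphXn rmorph_nat.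
have f1 : mp (1 + 'X) = 1 + 'X by rewrite rmorphD rmorph1 /= map_polyX.
by rewrite /pmono map_polyZ fc rmorphB /= !map_polyZ !fs !(rmorphM (map_poly f)) !(rmorphXn (map_poly f)) /= f1 !map_polyX.
Qed.

Lemma map_pop j h : mp (pop j h) = pop j (mp h).
Proof.
rewrite /pop size_map_poly rmorph_sum /=; apply: eq_bigr => l _.
by rewrite map_polyZ map_pmono coef_map.
Qed.

Lemma map_psrc n : mp (psrc F1 n) = psrc F2 n.
Proof.
have fs k : f ((-1) ^+ k) = (-1) ^+ k by rewrite rmorphXn rmorphN rmorph1.
have f1 : mp (1 + 'X) = 1 + 'X by rewrite rmorphD rmorph1 /= map_polyX.
have f2 : f (2 ^- n) = 2 ^- n by rewrite fmorphV rmorphXn rmorph_nat.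
by rewrite /psrc map_polyZ rmorphB /= map_polyZ !(rmorphXn (map_poly f)) /= f1 map_polyX f2 fs.
Qed.

Lemma map_hsys h : hsys h -> hsys (fun n => mp (h n)).
Proof.
move=> hh n n0; have [h1 h2] := hh n n0; rewrite size_map_poly; split=> //.
rewrite -map_pop -rmorphB h2 /prhs.
pose s1 := \sum_(1 <= j < n) pop j (h (n - j)%N).
pose s2 := \sum_(0 <= j < n.-1) pop j (h (n - j - 1)%N); rewrite -/s1 -/s2 !rmorphD /=.
rewrite (map_polyZ f _ (psrc F1 n)) (map_polyZ f _ s2) map_psrc fmorphV rmorph_nat.
rewrite /s1 /s2 !rmorph_sum /=.
by congr (_ + _ *: _ + _); apply: eq_bigr => j _; rewrite map_pop.
Qed.
End maps.

(** * Complex limits and analyticity through the real modulus *)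

Section complex_limits.
Variable R : realType.
Local Notation C := (Cplx R).

Lemma pos_ofreal (e : C) : 0 < e -> exists2 r : R, 0 < r & e = of_real r.
Proof.
move=> e0; exists (re e).
  by move: e0; case: e => a b; rewrite /re /= ltcE /= => /andP[].
by move: e0; case: e => a b; rewrite /re /= ltcE /= => /andP[/eqP -> _].
Qed.

Lemma cvgC_nm (u : nat -> C) (l : C) :
  (forall eta : R, 0 < eta -> exists N, forall n, (N <= n)%N -> nm (l - u n) <= eta) ->
  u @ \oo --> l.
Proof.
move=> h; apply/cvgrPdist_le => e /pos_ofreal[r r0 ->].
by have [N hN] := h r r0; exists N => // n /= nN; rewrite ler_norm_nm hN.
Qed.

Lemma nm_cvgC (u : nat -> C) (l : C) : u @ \oo --> l ->
  forall eta : R, 0 < eta -> exists N, forall n, (N <= n)%N -> nm (l - u n) <= eta.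
Proof.
move=> /cvgrPdist_le h eta e0; have e0' : 0 < of_real eta by rewrite /of_real ltcR.
have [N _ hN] := h _ e0'; exists N => n nN; rewrite -ler_norm_nm; exact: hN.
Qed.

Lemma seriesE (u : nat -> C) n : series u n = \sum_(k < n) u k.
Proof. by rewrite /series /= big_mkord. Qed.

Lemma near_nm (z : C) (r : R) (P : C -> Prop) : 0 < r ->
  (forall y, nm (z - y) < r -> P y) -> \near z, P z.
Proof.
move=> r0 h; have r0' : 0 < of_real r by rewrite /of_real ltcR.
by apply/nbhs_ballP; exists (of_real r) => // y; rewrite -ball_normE /= ltr_norm_nm => /h.
Qed.

Lemma nm_near (z : C) (P : C -> Prop) : (\near z, P z) ->
  exists2 r : R, 0 < r & forall y, nm (z - y) < r -> P y.
Proof.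
move=> /nbhs_ballP[e /pos_ofreal[r r0 ->] h]; exists r => // y hy.
by apply: h; rewrite -ball_normE /= ltr_norm_nm.
Qed.

Lemma analytic_of_pser (f : C -> C) (z0 : C) (r : R) (c : nat -> C) : 0 < r ->
  pser r c (fun e => f (z0 + e)) -> analytic_at f z0.
Proof.
move=> r0 [B [th [B0 t0 t1 h1 h2]]]; exists c, r => // z; rewrite ltr_norm_nm => hz.
apply: cvgC_nm => eta e0.
have Bp : 0 < B + 1 by lra.
have [N hN] := expr_small (ltW t0) t1 (divr_gt0 e0 Bp).
exists N => n nN; rewrite seriesE.
have := h2 (z - z0) n (ltW hz); rewrite [z0 + _]addrC subrK => h; apply: (le_trans h).
have := ler_wpM2l B0 (hN n nN) => h3; apply: (le_trans h3).
rewrite mulrCA ler_piMr ?(ltW e0) // ler_pdivrMr //; lra.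
Qed.

Lemma le_of_eps (x y : R) : (forall eta, 0 < eta -> x <= y + eta) -> x <= y.
Proof. by move=> h; apply/ler_addgt0Pr. Qed.

(** The form of analyticity that uniqueness consumes. The terms of the series are bounded at
    distance [r / 2], so within [r / 4] they decay with ratio [1/2]. *)
Lemma analytic_lipschitz (f : C -> C) (z0 : C) : analytic_at f z0 ->
  exists B r : R, [/\ 0 <= B, 0 < r & forall z, nm (z - z0) < r -> nm (f z - f z0) <= B * nm (z - z0)].
Proof.
move=> [a [r r0 ha]].
have r2 : 0 < r / 2 by lra.
have h0 := ha (z0 + of_real (r / 2)).
rewrite addrAC subrr add0r ltr_norm_nm nm_of_real ger0_norm ?(ltW r2) // in h0.
have /h0 {}h0 : r / 2 < r by lra.
have [M hM] : exists M : R, forall n, nm (a n) * (r / 2) ^+ n <= M.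
  have [N hN] := nm_cvgC h0 ltr01.
  pose S n := \sum_(k < n) a k * of_real (r / 2) ^+ k.
  have tE n : nm (a n) * (r / 2) ^+ n = nm (S n.+1 - S n).
    by rewrite /S big_ord_recr /= addrAC subrr add0r nmM nmX nm_of_real ger0_norm // ltW.
  pose L := f (z0 + of_real (r / 2)).
  have hS n : (N <= n)%N -> nm (L - S n) <= 1.
    by move=> nN; have := hN n nN; rewrite seriesE.
  exists (2 + \sum_(k < N) nm (a k) * (r / 2) ^+ k) => n.
  have s0 : 0 <= \sum_(k < N) nm (a k) * (r / 2) ^+ k.
    by apply: sumr_ge0 => k _; rewrite mulr_ge0 ?nm_ge0 // exprn_ge0 // ltW.
  have [nN|Nn] := ltnP n N.
    rewrite (bigD1 (Ordinal nN)) //= [2 + _]addrCA lerDl addr_ge0 //.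
    by apply: sumr_ge0 => k _; rewrite mulr_ge0 ?nm_ge0 // exprn_ge0 // ltW.
  rewrite tE; apply: ler_wpDr => //.
  have -> : S n.+1 - S n = (L - S n) - (L - S n.+1) by ring.
  apply: le_trans (nm_le_sub _ _) _.
  by have := hS n Nn; have := hS n.+1 (leqW Nn); lra.
have M0 : 0 <= M by apply: le_trans (hM 0%N); rewrite mulr_ge0 ?nm_ge0 // expr0.
have fz0 : f z0 = a 0%N.
  have h := ha z0; rewrite subrr normr0 -of_real0 /of_real ltcR in h.
  have {}h := nm_cvgC (h r0); apply/eqP; rewrite -subr_eq0 -nm_eq0 eq_le nm_ge0 andbT.
  apply: le_of_eps => eta e0; rewrite add0r; have [N hN] := h eta e0.
  have := hN N.+1 (leqnSn N); rewrite seriesE big_ord_recl /= expr0 mulr1 big1 ?addr0 // => k _.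
  by rewrite exprS mul0r mulr0.
exists (4 * M / r), (r / 4); split=> [||z hz]; [by rewrite divr_ge0 ?mulr_ge0 // ltW|lra|].
have hz' : nm (z - z0) < r by lra.
have hf := ha z; rewrite ltr_norm_nm in hf.
apply: le_of_eps => eta e0.
have [N hN] := nm_cvgC (hf hz') e0; have := hN N.+1 (leqnSn N); rewrite seriesE.
rewrite big_ord_recl /= expr0 mulr1 -fz0; set T := \sum_(k < N) _ => h.
have hT : nm T <= 4 * M / r * nm (z - z0).
  apply: le_trans (nm_sum _ _ _) _.
  apply: (@le_trans _ _ (\sum_(k < N) (2 * M / r * nm (z - z0)) * (1 / 2) ^+ k)).
    apply: ler_sum => k _; rewrite nmM nmX /= exprS.
    have h1 : nm (z - z0) ^+ k <= (r / 2) ^+ k * (1 / 2) ^+ k.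
      rewrite -exprMn lerXn2r ?nnegrE ?nm_ge0 //; lra.
    have h2 := hM k.+1; rewrite exprS in h2.
    have h3 : nm (a k.+1) * (r / 2) ^+ k <= 2 * M / r.
      rewrite ler_pdivlMr //; lra.
    rewrite mulrCA; apply: (@le_trans _ _ (nm (z - z0) * (nm (a k.+1) * ((r / 2) ^+ k * (1 / 2) ^+ k)))).
      by rewrite ler_wpM2l ?nm_ge0 // ler_wpM2l ?nm_ge0.
    rewrite [nm (a _) * _]mulrA mulrA [nm (z - z0) * _]mulrC.
    by apply: ler_wpM2r; [rewrite exprn_ge0|apply: ler_wpM2r; rewrite ?nm_ge0].
  rewrite -mulr_sumr.
  have -> : 4 * M / r * nm (z - z0) = 2 * M / r * nm (z - z0) * 2 by ring.
  apply: ler_wpM2l; first by rewrite !mulr_ge0 ?nm_ge0 ?invr_ge0 // ltW.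
  have : \sum_(k < N) (1 / 2 : R) ^+ k = 2 - 2 * (1 / 2) ^+ N.
    elim: (N) => [|m IH]; first by rewrite big_ord0 expr0; lra.
    by rewrite big_ord_recr /= IH exprS; lra.
  by have : 0 <= (1 / 2 : R) ^+ N by [rewrite exprn_ge0 //; lra]; lra.
have -> : f z - f z0 = (f z - (f z0 + T)) + T by ring.
by apply: le_trans (nm_le_add _ _) _; rewrite addrC lerD.
Qed.

End complex_limits.

(** * Polynomials in [1 / (z - 2)] and their derivatives *)

Section rational_in_v.
Variable R : realType.
Local Notation C := (Cplx R).
Implicit Types g : {poly C}.

Definition ev g (z : C) : C := g.[(z - 2)^-1].

Lemma ev_analytic g (z : C) : z != 2 -> analytic_at (ev g) z.
Proof.
move=> z2; have rho0 : 0 < nm (2 - z) by rewrite nm_gt0 subr_eq0 eq_sym.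
pose r := nm (2 - z) / 2; have r0 : 0 < r by rewrite /r; lra.
have rr : r < nm (2 - z) by rewrite /r; lra.
suff [c hc] : exists c, pser r c (fun e => ev g (z + e)) by exact: analytic_of_pser hc.
elim/poly_ind: g => [|p a [c hc]].
  exists (fun n => (0 : {poly C})`_n); apply: pser_ext (pser_poly 0 (ltW r0)) => // e _.
  by rewrite /ev !horner0.
eexists; apply: pser_ext (pser_lin 1 1 (pser_div r0 rr hc) (pser_const a (ltW r0))) => // e _.
by rewrite /ev hornerMXaddC !mul1r opprB addrCA addrA.
Qed.

(** [d/dz] in the coordinate [v = 1 / (z - 2)], as [dv/dz = - v ^ 2]. *)
Definition dv g : {poly C} := - ('X^2 * g^`()).

Lemma ev_is_derive g (z : C) : z != 2 -> is_derive (z : C) (1 : C) (ev g) (ev (dv g) z).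
Proof.
move=> z2; have zn : z - 2 != 0 by rewrite subr_eq0.
have dvz : is_derive (z : C) (1 : C) (fun y : C => (y - 2)^-1) (- (z - 2) ^- 2).
  have h : is_derive (z : C) (1 : C) (fun y : C => y - 2) 1.
    have := @is_deriveB C C C id (cst 2) z 1 1 0 (is_derive_id _ _) (is_derive_cst _ _ _).
    by rewrite subr0.
  case: h => hd hv.
  by apply: DeriveDef; [exact: derivableV|rewrite deriveV // hv [LHS]mulr1].
elim/poly_ind: g => [|p a IH].
  have -> : ev 0 = cst 0 by apply/funext => y; rewrite /ev horner0.
  have -> : dv 0 = 0 by rewrite /dv deriv0 mulr0 oppr0.
  by rewrite /ev horner0; exact: is_derive_cst.
have -> : ev (p * 'X + a%:P) = (ev p * (fun y : C => (y - 2)^-1)) + cst a.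
  by apply/funext => y; rewrite /ev hornerMXaddC.
apply: is_derive_eq (is_deriveD (is_deriveM IH dvz) (is_derive_cst a z 1)) _.
rewrite addr0 /ev /dv derivD derivC addr0 derivM derivX mulr1.
rewrite !(hornerN, hornerD, hornerM, hornerX) -exprVn.
by rewrite /GRing.scale /=; ring.
Qed.

Lemma ev_derive1n g j (z : C) : z != 2 -> derive1n j (ev g) z = ev (iter j dv g) z.
Proof.
elim: j z => [//|j IH] z z2; rewrite derive1nS derive1E.
have -> : 'D_1 (derive1n j (ev g)) z = 'D_1 (ev (iter j dv g)) z.
  apply: near_eq_derive; have r0 : 0 < nm (z - 2) by rewrite nm_gt0 subr_eq0.
  apply: (near_nm r0) => y hy; apply: IH; apply/eqP => y2.
  by move: hy; rewrite y2 ltxx.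
by case: (ev_is_derive (iter j dv g) z2).
Qed.

Lemma dvD g1 g2 : dv (g1 + g2) = dv g1 + dv g2.
Proof. by rewrite /dv derivD mulrDr opprD. Qed.

Lemma dvZ (a : C) g : dv (a *: g) = a *: dv g.
Proof. by rewrite /dv derivZ -scalerAr scalerN. Qed.

Lemma iter_dvD j g1 g2 : iter j dv (g1 + g2) = iter j dv g1 + iter j dv g2.
Proof. by elim: j => //= j ->; rewrite dvD. Qed.

Lemma iter_dvZ j (a : C) g : iter j dv (a *: g) = a *: iter j dv g.
Proof. by elim: j => //= j ->; rewrite dvZ. Qed.

Lemma iter_dv_Xn j k : (0 < k)%N ->
  iter j dv ('X^k) = ((-1) ^+ j * j`!%:R * 'C(k + j - 1, j)%:R) *: 'X^(k + j).
Proof.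
move=> k0; elim: j => [|j IH].
  by rewrite /= expr0 fact0 bin0 !mul1r scale1r addn0.
rewrite iterS IH dvZ /dv derivXn.
have -> : 'X^2 * ('X^((k + j).-1) *+ (k + j)) = (k + j)%:R *: 'X^(k + j.+1) :> {poly C}.
  rewrite mulrnAr -exprD -scaler_nat; congr (_ *: 'X^_); lia.
rewrite scalerN -scaleNr scalerA; congr (_ *: _).
rewrite exprS factS natrM mulN1r !mulNr; congr (- _).
rewrite -!mulrA; congr (_ * _); rewrite mulrCA mulrA -!natrM; congr (_%:R).
have -> : (k + j.+1 - 1 = k + j)%N by lia.
have -> : (k + j - 1 = (k + j).-1)%N by lia.
by rewrite [RHS]mulnCA -mul_bin_diag; lia.
Qed.

End rational_in_v.

(** * The [H_n] built from the polynomial system solve the equations *)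

Section Hfun.
Variable R : realType.
Local Notation C := (Cplx R).
Variable h : nat -> {poly rat}.
Hypothesis hh : hsys h.

Definition hC (n : nat) : {poly C} := map_poly ratr (h n).
Definition gH (n : nat) : {poly C} := if n is 0%N then - 'X else 'X^2 * hC n.
Definition Hf (n : nat) : C -> C := ev (gH n).

Lemma hsysC : hsys hC.
Proof. exact: map_hsys. Qed.

Definition Dj (j m : nat) (y : C) : C := j`!%:R^-1 * derive1n j (Hf m) y.

Definition Tj (j m : nat) (z : C) : C :=
  Dj j m (2 * z) * z ^+ j - Dj j m (2 / z) * (1 / z ^+ (j + 2)).

Lemma natrC_neq0 n : (0 < n)%N -> n%:R != 0 :> C.
Proof. by move=> n0; rewrite pnatr_eq0 -lt0n. Qed.

Lemma Dj_mono (j k : nat) (y : C) : (0 < k)%N ->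
  j`!%:R^-1 * (iter j (@dv R) ('X^k)).[y] = (-1) ^+ j * 'C(k + j - 1, j)%:R * y ^+ (k + j).
Proof.
move=> k0; rewrite iter_dv_Xn // hornerZ hornerXn !mulrA; congr (_ * _ * _).
by rewrite mulrAC mulVf ?mul1r // natrC_neq0 // fact_gt0.
Qed.

Lemma Dj_pos (j m : nat) (y : C) : (0 < m)%N -> y != 2 ->
  Dj j m y = \sum_(l < size (hC m)) (hC m)`_l *
     ((-1) ^+ j * 'C(l + j + 1, j)%:R * (y - 2)^-1 ^+ (l + 2 + j)).
Proof.
move=> m0 y2; rewrite /Dj /Hf ev_derive1n // /gH; case: m m0 => // m _.
have -> : 'X^2 * hC m.+1 = \sum_(l < size (hC m.+1)) (hC m.+1)`_l *: 'X^(l + 2).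
  rewrite -[X in 'X^2 * X]coefK poly_def mulr_sumr; apply: eq_bigr => l _.
  by rewrite -scalerAr -exprD addnC.
have itsum (I : Type) (s : seq I) (F : I -> {poly C}) :
    iter j (@dv R) (\sum_(i <- s) F i) = \sum_(i <- s) iter j (@dv R) (F i).
  elim: s => [|i s IH]; last by rewrite !big_cons iter_dvD IH.
  rewrite !big_nil; elim: (j) => //= k ->; by rewrite /dv deriv0 mulr0 oppr0.
rewrite itsum /ev horner_sum mulr_sumr; apply: eq_bigr => l _.
rewrite iter_dvZ hornerZ mulrCA Dj_mono ?addn2 //; congr (_ * (_ * _%:R * _ ^+ _)).
by congr 'C(_, _); lia.
Qed.

Lemma Dj_zero (j : nat) (y : C) : y != 2 -> Dj j 0 y = - ((-1) ^+ j * (y - 2)^-1 ^+ (1 + j)).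
Proof.
move=> y2; rewrite /Dj /Hf ev_derive1n // /gH /ev.
have -> : - 'X = (-1) *: 'X^1 :> {poly C} by rewrite scaleN1r expr1.
rewrite iter_dvZ hornerZ mulrCA Dj_mono // mulN1r; congr (- _).
by rewrite addKn binn mulr1.
Qed.

Section atz.
Variables z v : C.
Hypotheses (z0 : z != 0) (z1 : z != 1) (hv : v = (z - 1)^-1).

(** The three arguments [z + 1], [2 z], [2 / z] of the equation have the coordinates [v], [v / 2]
    and [-(1 + v) / 2], so the equation becomes polynomial in [v]. *)
Lemma atz_facts : [/\ 2 * z != 2, 2 / z != 2, (2 * z - 2)^-1 = v / 2,
  (2 / z - 2)^-1 = - ((1 + v) / 2) & z * v = 1 + v].
Proof.
have z1' : z - 1 != 0 by rewrite subr_eq0.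
have two : 2 != 0 :> C by rewrite pnatr_eq0.
split.
- by rewrite -subr_eq0 -[X in _ - X]mulr1 -mulrBr mulf_neq0.
- rewrite -subr_eq0; have -> : 2 / z - 2 = - (2 * (z - 1) / z) by field.
  by rewrite oppr_eq0 !mulf_neq0 // invr_eq0.
- by rewrite hv -invfM; congr (_^-1); ring.
- rewrite hv; have -> : 2 / z - 2 = - (2 * (z - 1) / z) by field.
  by rewrite invrN; congr (- _); field; rewrite z0 z1'.
- by rewrite hv; field.
Qed.

Lemma Tj_pos j m : (0 < m)%N -> Tj j m z = v ^+ 2 * (pop j (hC m)).[v].
Proof.
move=> m0; have [e1 e2 e3 e4 e5] := atz_facts.
have e6 : (1 + v) / z = v by rewrite -e5; field.
rewrite /Tj !Dj_pos // e3 e4 /pop horner_sum !mulr_suml mulr_sumr -sumrB.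
apply: eq_bigr => l _; rewrite (hornerZ _ (pmono C l j)) pmono_eval /pcoef.
set a := (hC m)`_l; set c := 'C(_, _)%:R.
have E1 : (v / 2) ^+ (l + 2 + j) * z ^+ j = 2 ^- (l + j + 2) * (v ^+ 2 * (v ^+ l * (1 + v) ^+ j)).
  rewrite exprMn exprVn -e5 exprMn [RHS]mulrC.
  have -> : (l + 2 + j = l + j + 2)%N by lia.
  by rewrite !exprD; ring.
have E2 : (- ((1 + v) / 2)) ^+ (l + 2 + j) * (1 / z ^+ (j + 2)) =
    (-1) ^+ (l + j) * (2 ^- (l + j + 2) * (v ^+ 2 * (v ^+ j * (1 + v) ^+ l))).
  rewrite (exprNn ((1 + v) / 2)) (exprMn _ (1 + v)) exprVn mul1r.
  have -> : (l + 2 + j = l + (j + 2))%N by lia.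
  have -> : (l + j + 2 = l + (j + 2))%N by lia.
  rewrite (exprD (1 + v) l (j + 2)).
  have -> : (-1) ^+ (l + (j + 2)) = (-1) ^+ (l + j) :> C.
    by rewrite addnA exprD sqrrN expr1n mulr1.
  have -> : v ^+ 2 * (v ^+ j * (1 + v) ^+ l) = (1 + v) ^+ l * ((1 + v) / z) ^+ (j + 2).
    by rewrite e6 exprD; ring.
  by rewrite (exprMn _ (1 + v)) exprVn; ring.
transitivity (a * ((-1) ^+ j * c * ((v / 2) ^+ (l + 2 + j) * z ^+ j))
    - a * ((-1) ^+ j * c * ((- ((1 + v) / 2)) ^+ (l + 2 + j) * (1 / z ^+ (j + 2))))).
  by ring.
rewrite E1 E2 (exprD (-1) l j).
have s : (-1) ^+ j * (-1) ^+ j = 1 :> C by rewrite -expr2 sqrr_sign.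
transitivity (a * ((-1) ^+ j * c * (2 ^- (l + j + 2) * (v ^+ 2 * (v ^+ l * (1 + v) ^+ j))))
   - a * ((-1) ^+ j * (-1) ^+ j) * ((-1) ^+ l * c * (2 ^- (l + j + 2) * (v ^+ 2 * (v ^+ j * (1 + v) ^+ l))))).
  by ring.
by rewrite s mulr1; ring.
Qed.

Lemma Tj_zero j : Tj j 0 z = - (2^-1 * 2 ^- j) * ((-1) ^+ j * (v * (1 + v) ^+ j) + v ^+ j.+1 / z).
Proof.
have [e1 e2 e3 e4 e5] := atz_facts.
have e6 : (1 + v) / z = v by rewrite -e5; field.
rewrite /Tj !Dj_zero // e3 e4.
have E1 : (v / 2) ^+ (1 + j) * z ^+ j = 2^-1 * 2 ^- j * (v * (1 + v) ^+ j).
  by rewrite exprMn exprVn -e5 exprMn add1n !exprS invfM; ring.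
have E2 : (- ((1 + v) / 2)) ^+ (1 + j) * (1 / z ^+ (j + 2)) =
    - ((-1) ^+ j * (2^-1 * 2 ^- j * (v ^+ j.+1 / z))).
  rewrite (exprNn ((1 + v) / 2)) (exprMn _ (1 + v)) exprVn mul1r add1n [(-1) ^+ _]exprS addn2.
  have -> : v ^+ j.+1 = ((1 + v) / z) ^+ j.+1 by rewrite e6.
  by rewrite (exprMn _ (1 + v)) exprVn (exprSr z j.+1) invfM (exprS 2 j) invfM; ring.
transitivity (- ((-1) ^+ j * ((v / 2) ^+ (1 + j) * z ^+ j)) + (-1) ^+ j * ((- ((1 + v) / 2)) ^+ (1 + j) * (1 / z ^+ (j + 2)))).
  by ring.
rewrite E1 E2.
have s : (-1) ^+ j * (-1) ^+ j = 1 :> C by rewrite -expr2 sqrr_sign.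
transitivity (- ((-1) ^+ j * (2^-1 * 2 ^- j * (v * (1 + v) ^+ j))) - (-1) ^+ j * (-1) ^+ j * (2^-1 * 2 ^- j * (v ^+ j.+1 / z))).
  by ring.
by rewrite s; ring.
Qed.

(** Each term alone contains a power of [v] divided by [z]. In this combination the two add up to a
    multiple of [(1 + v) / z], which is [v]. *)
Lemma Tj_src n : 2 * Tj n.+1 0 z + Tj n 0 z = v ^+ 2 * (psrc C n.+1).[v].
Proof.
have [e1 e2 e3 e4 e5] := atz_facts; have two : 2 != 0 :> C by rewrite pnatr_eq0.
have e6 : v / z = v - 1 / z by rewrite -[v in RHS](mulfK z0) -[v * z]mulrC e5; field.
rewrite !Tj_zero psrc_eval /=.
transitivity (- (2 * 2^-1) * (2 ^- n.+1) * ((-1) ^+ n.+1 * (v * (1 + v) ^+ n.+1)) - (2 * 2^-1) * (2 ^- n.+1) * (v ^+ n.+1 * (v / z)) -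
  (2^-1 * 2 ^- n) * ((-1) ^+ n * (v * (1 + v) ^+ n) + v ^+ n.+1 / z)).
  by rewrite [v ^+ n.+2]exprSr; ring.
rewrite e6 divff // (exprS 2 n) invfM (exprS (-1) n) (exprS (1 + v) n) (exprS v n).
by ring.
Qed.

Lemma Hf_lhs n : (0 < n)%N -> H_lhs Hf n z = 2 * (v ^+ 2 * (prhs hC n).[v]).
Proof.
move=> n0; have -> : H_lhs Hf n z = 2 * \sum_(1 <= j < n.+1) Tj j (n - j) z
    + \sum_(0 <= j < n) Tj j (n - j - 1) z.
  rewrite /H_lhs /Tj /Dj !sumrB mulrBr !mulr_sumr [RHS]addrACA.
  rewrite [RHS]addrA; congr (_ + _ - _ - _); apply: eq_bigr => j _; ring.
case: n n0 => // n _.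
rewrite (big_nat_recr n.+1 1) //= (big_nat_recr n 0) //= subnn subSnn subnn mulrDr addrACA Tj_src.
rewrite prhs_eval /=.
have -> : \sum_(1 <= j < n.+1) Tj j (n.+1 - j) z = v ^+ 2 * \sum_(1 <= j < n.+1) (pop j (hC (n.+1 - j))).[v].
  rewrite mulr_sumr; apply: eq_big_nat => j /andP[j1 jn]; apply: Tj_pos; lia.
have -> : \sum_(0 <= j < n) Tj j (n.+1 - j - 1) z = v ^+ 2 * \sum_(0 <= j < n) (pop j (hC (n.+1 - j - 1))).[v].
  rewrite mulr_sumr; apply: eq_big_nat => j /andP[j1 jn]; apply: Tj_pos; lia.
by move: (\sum_(_ <= _ < _) _) (\sum_(_ <= _ < _) _) (psrc _ _).[v] => s1 s2 s3; field.
Qed.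

Lemma Hf_rhs n : (0 < n)%N -> H_rhs (Hf n) z = 2 * (v ^+ 2 * (hC n - pop 0 (hC n)).[v]).
Proof.
move=> n0; rewrite hornerD hornerN mulrBr -(Tj_pos 0 n0) /Tj /Dj fact0 !expr0 invr1 !mul1r mulr1.
rewrite /= /H_rhs.
have -> : Hf n (z + 1) = v ^+ 2 * (hC n).[v].
  rewrite /Hf /ev; have -> : z + 1 - 2 = z - 1 by ring.
  by rewrite -hv; case: n n0 => // n _; rewrite /gH hornerM hornerXn.
by rewrite addn2; field.
Qed.

End atz.

Lemma Hf_eq n z : (0 < n)%N -> z != 0 -> z != 1 -> H_lhs Hf n z = H_rhs (Hf n) z.
Proof.
move=> n0 z0 z1; rewrite (Hf_lhs z0 z1 erefl) // (Hf_rhs z0 z1 erefl) //; have [_ ->] := hsysC n0.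
by [].
Qed.

Lemma vanishes_ev (g : {poly C}) : g.[0] = 0 -> vanishes_at_infinity (ev g).
Proof.
move=> g0; have [B hB] : exists B : R, forall v : C, nm v <= 1 -> nm g.[v] <= B * nm v.
  have [p ->] : exists p, g = p * 'X.
    have /factor_theorem[p ->] : root g 0 by apply/eqP.
    by exists p; rewrite polyC0 subr0.
  have [B hB] : exists B : R, forall v : C, nm v <= 1 -> nm p.[v] <= B.
    elim/poly_ind: p {g0} => [|p a [B IH]]; first by exists 0 => v _; rewrite horner0 nm0.
    exists (B + nm a) => v hv; rewrite hornerMXaddC; apply: le_trans (nm_le_add _ _) _.
    by rewrite lerD2r nmM; apply: le_trans (IH v hv); rewrite ler_piMr ?nm_ge0.
  by exists B => v hv; rewrite hornerM hornerX nmM ler_wpM2r ?nm_ge0 ?hB.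
move=> e e0; pose B' := `|B| + 1; have B'0 : 0 < B' by rewrite /B' ltr_pwDr.
exists (3 + B' / e) => z; rewrite ltr_norm_nm normE /of_real ltcR => hz; have q0 : 0 < B' / e by rewrite divr_gt0.
have hz2 : 1 + B' / e < nm (z - 2).
  by have := nm_ge_sub z (- 2); rewrite nmN nm_nat; lra.
have nz : 0 < nm (z - 2) by lra.
have v1 : nm (z - 2)^-1 <= 1 by rewrite nmV invf_le1 //; lra.
apply: le_lt_trans (hB _ v1) _; rewrite nmV ltr_pdivrMr //.
have : B < B' by rewrite /B'; apply: le_lt_trans (ler_norm B) _; lra.
have : e * (B' / e) < e * nm (z - 2) by rewrite ltr_pM2l //; lra.
by rewrite mulrCA divff ?gt_eqF // mulr1; lra.
Qed.

Lemma gH_0 n : (gH n).[0] = 0.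
Proof.
case: n => [|n] /=; first by rewrite hornerN hornerX oppr0.
by rewrite hornerM hornerXn expr0n /= mul0r.
Qed.

Lemma Hf_solves n : (0 < n)%N -> solves_H Hf n (Hf n).
Proof.
move=> n0; split=> [z z2| |z z0 z1]; [exact: ev_analytic| |exact: Hf_eq].
exact: vanishes_ev (gH_0 n).
Qed.

End Hfun.

(** * Uniqueness of the solution of each equation *)

Section uniqueness.
Variable R : realType.
Local Notation C := (Cplx R).

(* A difference [D] of two solutions is [hh(v) v ^ 2].  By [hh_step] the size of
   [hh] at [v] is at most half of its size at two points that are closer to the
   segment [-1, 0], near which [hh] is bounded; so [hh = 0] off the real axis. *)
Section zero.
Variable D : C -> C.
Hypothesis Dan : forall z0 : C, z0 != 2 ->
  exists B r : R, [/\ 0 <= B, 0 < r & forall z, nm (z - z0) < r -> nm (D z - D z0) <= B * nm (z - z0)].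
Hypothesis Deq : forall z : C, z != 0 -> z != 1 -> H_rhs D z = 0.

Let hh (v : C) : C := D (2 + v^-1) / v ^+ 2.

Lemma hh_eq (v : C) : v != 0 -> v != -1 ->
  2 * hh v = 2^-1 * hh (v / 2) - 2^-1 * hh (- ((1 + v) / 2)).
Proof.
move=> v0 v1; have v1' : 1 + v != 0 by rewrite addrC -[1]opprK subr_eq0.
pose z := 1 + v^-1.
have z0 : z != 0.
  have -> : z = (1 + v) / v by rewrite /z; field.
  by rewrite mulf_neq0 // invr_eq0.
have z1 : z != 1 by rewrite /z -subr_eq0 addrAC subrr add0r invr_eq0.
have := Deq z0 z1; rewrite /H_rhs /hh.
have -> : z + 1 = 2 + v^-1 by rewrite /z; ring.
have -> : 2 * z = 2 + (v / 2)^-1 by rewrite /z; field.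
have zE : z = (1 + v) / v by rewrite /z; field.
have -> : 2 / z = 2 + (- ((1 + v) / 2))^-1 by rewrite zE invrN; field; rewrite v1' v0.
move: (D _) (D _) (D _) => d3 d2 d1 h.
have : (2 * d1 - 2 * d2 + 2 / z ^+ 2 * d3) / v ^+ 2 = 0 by rewrite h mul0r.
move=> h2; apply/eqP; rewrite -subr_eq0 -h2 zE; apply/eqP.
by field; rewrite v0 v1'.
Qed.

Lemma hh_odd (v : C) : v != 0 -> v != -1 -> hh (-1 - v) = - hh v.
Proof.
move=> v0 v1; have v1' : 1 + v != 0 by rewrite addrC -[1]opprK subr_eq0.
have u0 : -1 - v != 0 by rewrite -opprD oppr_eq0.
have u1 : -1 - v != -1 by rewrite -subr_eq0; have -> : -1 - v - -1 = - v by [ring]; rewrite oppr_eq0.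
have h1 := hh_eq v0 v1; have h2 := hh_eq u0 u1.
have e1 : (-1 - v) / 2 = - ((1 + v) / 2) by field.
have e2 : - ((1 + (-1 - v)) / 2) = v / 2 by field.
rewrite e1 e2 in h2.
have two : 2 != 0 :> C by rewrite pnatr_eq0.
apply: (mulfI two); rewrite h2 mulrN h1; ring.
Qed.

Lemma hh_step (v : C) : im v != 0 -> hh v = 4^-1 * (hh (v / 2) + hh ((v - 1) / 2)).
Proof.
move=> iv.
have v0 : v != 0 by apply: contra_neq iv => ->.
have v1 : v != -1 by apply: contra_neq iv => ->; rewrite imN im1 oppr0.
have ihalf (u : C) : im (u / 2) = im u / 2.
  have -> : (2 : C)^-1 = of_real 2^-1 by rewrite of_realV of_real_nat.
  by rewrite imM im_of_real re_of_real mulr0 add0r.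
have i2 : im (- ((1 + v) / 2)) != 0.
  by rewrite imN oppr_eq0 ihalf imD im1 add0r mulf_neq0 // invr_eq0.
have w0 : - ((1 + v) / 2) != 0 by apply: contra_neq i2 => ->.
have w1 : - ((1 + v) / 2) != -1.
  by apply: contra_neq i2 => ->; rewrite imN im1 oppr0.
have h1 := hh_odd w0 w1.
have e1 : -1 - - ((1 + v) / 2) = (v - 1) / 2 by field.
rewrite e1 in h1; rewrite h1.
have two : 2 != 0 :> C by rewrite pnatr_eq0.
by apply: (mulfI two); rewrite hh_eq //; field.
Qed.

(** For [s > 0] the point [-s] is [z = 2 - 1/s], where [D] is bounded and [v] stays away from 0. At
    [s = 0], that is at infinity, the division by [v ^ 2] is the difficulty; [hh_odd] moves this
    point to [v = -1], that is [z = 1]. *)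
Lemma hh_local (s : R) : 0 <= s -> s <= 1 ->
  exists B r : R, 0 < r /\ forall v : C, im v != 0 -> nm (v + of_real s) < r -> nm (hh v) <= B.
Proof.
have pos (s' : R) : 0 < s' -> exists B r : R, 0 < r /\
    forall v : C, nm (v + of_real s') < r -> nm (hh v) <= B.
  move=> sp; pose z0 : C := 2 - (of_real s')^-1.
  have sC : of_real s' != 0 by rewrite -nm_gt0 nm_of_real gtr0_norm.
  have z02 : z0 != 2 by rewrite -subr_eq0 /z0 addrAC subrr add0r oppr_eq0 invr_eq0.
  have [B [r [B0 r0 hB]]] := Dan z02.
  exists ((B * r + nm (D z0)) / (s' / 2) ^+ 2), (Num.min (s' / 2) (r * (s' * (s' / 2)))).
  split; first by rewrite lt_min !mulr_gt0 //; lra.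
  move=> v; rewrite lt_min => /andP[hv1 hv2].
  have nv : s' / 2 < nm v.
    have := nm_ge_sub (of_real s') (- (v + of_real s')); rewrite nmN nm_of_real gtr0_norm //.
    have -> : of_real s' - (v + of_real s') = - v by ring.
    by rewrite nmN; lra.
  have vp : 0 < nm v by lra.
  have v0 : v != 0 by rewrite -nm_gt0.
  have dz : nm (2 + v^-1 - z0) < r.
    have -> : 2 + v^-1 - z0 = (v + of_real s') / (v * of_real s').
      by rewrite /z0; field; rewrite v0 sC.
    rewrite nmM nmV nmM nm_of_real gtr0_norm // ltr_pdivrMr ?mulr_gt0 //.
    apply: (lt_le_trans hv2); rewrite ler_pM2l // mulrC ler_pM2r //; exact: ltW.
  have nD : nm (D (2 + v^-1)) <= B * r + nm (D z0).
    have := nm_le_add (D (2 + v^-1) - D z0) (D z0); rewrite subrK => h; apply: (le_trans h).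
    rewrite lerD2r; apply: (le_trans (hB _ dz)); rewrite ler_wpM2l //; exact: ltW.
  rewrite /hh nmM nmV nmX; apply: ler_pM; rewrite ?nm_ge0 ?invr_ge0 ?exprn_ge0 ?nm_ge0 //.
  rewrite lef_pV2 ?posrE ?exprn_gt0 //; last by lra.
  by rewrite lerXn2r ?nnegrE ?nm_ge0 //; [lra|exact: ltW].
move=> s0 s1; have [sp|sn] := ltP 0 s.
  by have [B [r [r0 hB]]] := pos s sp; exists B, r; split=> // v _; exact: hB.
have -> : s = 0 by lra.
have [B [r [r0 hB]]] := pos 1 ltr01; exists B, r; split=> // v iv; rewrite of_real0 addr0 => hv.
have v0 : v != 0 by apply: contra_neq iv => ->.
have v1 : v != -1 by apply: contra_neq iv => ->; rewrite imN im1 oppr0.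
rewrite -nmN -hh_odd //; apply: hB.
by have -> : -1 - v + of_real 1 = - v :> C by [rewrite of_real1; ring]; rewrite nmN.
Qed.

Lemma hh_uniform : exists2 B : R, 0 < B & forall (s : R) (v : C), 0 <= s -> s <= 1 -> im v != 0 ->
  nm (v + of_real s) < B^-1 -> nm (hh v) <= B.
Proof.
(* One number serves both as bound and, inverted, as radius, so that compactness of [[0, 1]] yields
   a common value for all large [B]. *)
pose P (B s : R) := forall v : C, im v != 0 -> nm (v + of_real s) < B^-1 -> nm (hh v) <= B.
have hc : compact [set` `[0:R, 1]] by exact: segment_compact.
have cov := (compact_near_coveringP [set` `[0:R, 1]]).1 hc R (pinfty_nbhs R) P _.
have : \forall B \near +oo, [set` `[0:R, 1]] `<=` P B.
  apply: cov => s; rewrite /= in_itv /= => /andP[s0 s1].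
  have [B [r [r0 hB]]] := hh_local s0 s1.
  exists ([set s' | `|s - s'| < r / 2], [set B' : R | Num.max B (2 / r) < B']).
    split=> /=.
      by apply/nbhs_ballP; exists (r / 2); [rewrite /= divr_gt0|move=> y; rewrite -ball_normE].
    by exists (Num.max B (2 / r)); split=> //; exact: num_real.
  case=> s' B' /= [hs' hB'] v iv hv.
  move: hB'; rewrite gt_max => /andP[b1 b2].
  have B'0 : 0 < B' by apply: lt_trans b2; rewrite divr_gt0.
  apply: le_trans (ltW b1); apply: hB => //.
  have -> : v + of_real s = (v + of_real s') + of_real (s - s').
    by rewrite of_realD of_realN; ring.
  apply: le_lt_trans (nm_le_add _ _) _; rewrite nm_of_real.
  have : B'^-1 < r / 2.
    by rewrite -[r / 2]invrK ltf_pV2 ?posrE ?invr_gt0 ?divr_gt0 // invf_div.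
  by lra.
move=> [M [_ hM]]; pose B := Num.max M 0 + 1.
have B0 : 0 < B by rewrite /B ltr_wpDl // le_max lexx orbT.
have MB : M < B by rewrite /B; apply: (@le_lt_trans _ _ (Num.max M 0)); rewrite ?le_max ?lexx // ltrDl.
exists B => // s v s0 s1 iv hv; apply: (hM B MB s) => //.
by rewrite /= in_itv /= s0.
Qed.

Lemma hh_zero (v : C) : im v != 0 -> hh v = 0.
Proof.
have [B B0 hB] := hh_uniform; move=> iv.
have ihalf (u : C) : im (u / 2) = im u / 2.
  have -> : (2 : C)^-1 = of_real 2^-1 by rewrite of_realV of_real_nat.
  by rewrite imM im_of_real re_of_real mulr0 add0r.
(* The maps of [hh_step] send [u] and [-s] to [u / 2], [-s / 2] and to [(u - 1) / 2],
   [-(s + 1) / 2]: distances are halved and the new parameters remain in [[0, 1]], while the bound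
   is halved too. *)
have main N (u : C) (s : R) : im u != 0 -> 0 <= s -> s <= 1 ->
   nm (u + of_real s) < 2 ^+ N * B^-1 -> nm (hh u) <= 2 ^- N * B.
  elim: N u s => [|N IH] u s iu s0 s1 hu.
    by rewrite expr0 invr1 mul1r; apply: (hB s) => //; move: hu; rewrite expr0 mul1r.
  rewrite hh_step // nmM nmV nm_nat.
  have n2 (y : C) : nm (y / 2) = nm y / 2 by rewrite nmM nmV nm_nat.
  have e1 : u / 2 + of_real (s / 2) = (u + of_real s) / 2.
    by rewrite of_realM of_realV of_real_nat mulrDl.
  have e2 : (u - 1) / 2 + of_real ((s + 1) / 2) = (u + of_real s) / 2.
    by rewrite of_realM of_realV of_real_nat of_realD of_real1 -mulrDl; congr (_ / _); ring.
  have hu' : nm ((u + of_real s) / 2) < 2 ^+ N * B^-1.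
    by rewrite n2 ltr_pdivrMr // mulrAC -exprSr.
  have k1 : nm (hh (u / 2)) <= 2 ^- N * B.
    apply: (IH _ (s / 2)); rewrite ?e1 ?ihalf ?mulf_neq0 ?invr_eq0 ?pnatr_eq0 //; lra.
  have k2 : nm (hh ((u - 1) / 2)) <= 2 ^- N * B.
    apply: (IH _ ((s + 1) / 2)); rewrite ?e2 //; [|lra|lra].
    by rewrite ihalf imD imN im1 oppr0 addr0 mulf_neq0 // invr_eq0 pnatr_eq0.
  have := nm_le_add (hh (u / 2)) (hh ((u - 1) / 2)).
  rewrite exprS invfM -mulrA; lra.
apply/eqP; rewrite -nm_eq0 eq_le nm_ge0 andbT.
apply: le_of_eps => eta e0; rewrite add0r.
have h12 : (2^-1 : R) < 1 by lra.
have h02 : 0 <= (2^-1 : R) by lra.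
pose L := nm v * B + 1.
have L0 : 0 < L by rewrite /L ltr_wpDl // mulr_ge0 ?nm_ge0 // ltW.
have Li : 0 < L^-1 by rewrite invr_gt0.
have [N1 hN1] := expr_small h02 h12 Li.
have [N2 hN2] := expr_small h02 h12 (divr_gt0 e0 B0).
have q1 := hN1 (maxn N1 N2) (leq_maxl _ _).
have q2 := hN2 (maxn N1 N2) (leq_maxr _ _).
set N := maxn N1 N2 in q1 q2; rewrite exprVn in q1; rewrite exprVn in q2.
apply: le_trans (main N v 0 iv (lexx _) ler01 _) _; last by rewrite -ler_pdivlMr.
rewrite of_real0 addr0 ltr_pdivlMr //.
have : L <= 2 ^+ N by rewrite -[L]invrK -[2 ^+ N]invrK lef_pV2 ?posrE ?invr_gt0 ?exprn_gt0.
rewrite /L; lra.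
Qed.

Lemma D_zero (z : C) : z != 2 -> D z = 0.
Proof.
move=> z2.
have nonreal (y : C) : im y != 0 -> D y = 0.
  move=> iy; have y2 : y - 2 != 0 by apply: contra_neq iy => /eqP; rewrite subr_eq0 => /eqP ->; exact: im_nat.
  have iv : im (y - 2)^-1 != 0.
    apply/eqP => h; have := mulfV y2 => /(congr1 (@im R)); rewrite imM h im1 mulr0 add0r => /eqP.
    rewrite mulf_eq0 imD imN im_nat oppr0 addr0 (negbTE iy) /= => /eqP h3.
    have : (y - 2)^-1 = 0 by apply: reim_eq; rewrite ?h3 ?h.
    by move/eqP; rewrite invr_eq0 (negbTE y2).
  have := hh_zero iv; rewrite /hh invrK addrC subrK => /eqP.
  by rewrite mulf_eq0 invr_eq0 expf_eq0 /= invr_eq0 (negbTE y2) orbF => /eqP.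
have [/nonreal //|iz] := boolP (im z != 0).
have [B [r [B0 r0 hB]]] := Dan z2.
apply/eqP; rewrite -nm_eq0 eq_le nm_ge0 andbT.
apply: le_of_eps => eta e0; rewrite add0r.
pose d := Num.min (r / 2) (eta / (B + 1)).
have Bp : 0 < B + 1 by lra.
have d0 : 0 < d by rewrite /d lt_min !divr_gt0.
pose y := z + (0 +i* d)%C.
have iy : im y != 0 by move: iz; rewrite negbK /y imD => /eqP ->; rewrite add0r /im /= gt_eqF.
have ny : nm (y - z) = d.
  rewrite /y addrAC subrr add0r /nm /= expr0n add0r sqrtr_sqr gtr0_norm //.
have dr : d < r by rewrite /d gt_min; apply/orP; left; lra.
have := hB y; rewrite ny nonreal // sub0r nmN => /(_ dr) h; apply: (le_trans h).
apply: (@le_trans _ _ ((B + 1) * (eta / (B + 1)))); last by rewrite mulrCA divff ?mulr1 ?gt_eqF.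
apply: ler_pM => //; [exact: ltW|lra|by rewrite /d ge_min lexx orbT].
Qed.

End zero.

Lemma solves_unique (H : nat -> C -> C) n (K1 K2 : C -> C) :
  solves_H H n K1 -> solves_H H n K2 -> forall z, z != 2 -> K1 z = K2 z.
Proof.
move=> [a1 _ e1] [a2 _ e2] z z2.
suff : (fun y => K1 y - K2 y) z = 0 by move/eqP; rewrite subr_eq0 => /eqP.
apply: (@D_zero (fun y => K1 y - K2 y) _ _ z z2) => [z0 z02|y y0 y1].
  have [B1 [r1 [b1 p1 h1]]] := analytic_lipschitz (a1 z0 z02).
  have [B2 [r2 [b2 p2 h2]]] := analytic_lipschitz (a2 z0 z02).
  exists (B1 + B2), (Num.min r1 r2); split; [exact: addr_ge0|by rewrite lt_min p1|].
  move=> y; rewrite lt_min => /andP[y1 y2].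
  have -> : K1 y - K2 y - (K1 z0 - K2 z0) = (K1 y - K1 z0) - (K2 y - K2 z0) by ring.
  by apply: le_trans (nm_le_sub _ _) _; rewrite mulrDl lerD ?h1 ?h2.
transitivity (H_rhs K1 y - H_rhs K2 y); first by rewrite /H_rhs; ring.
by rewrite -e1 // -e2 // subrr.
Qed.

End uniqueness.

(** * The numerators [B_n] and their symmetries *)

Lemma poly_eq0_horner (F : numFieldType) (q : {poly F}) : (forall v, q.[v] = 0) -> q = 0.
Proof.
move=> hq; apply/eqP/negPn/negP => q0.
have u : uniq [seq (i%:R : F) | i <- iota 0 (size q)].
  by rewrite map_inj_uniq ?iota_uniq //; exact: mulrIn (oner_neq0 _).
have a : all (root q) [seq (i%:R : F) | i <- iota 0 (size q)].
  by apply/allP => x _; apply/eqP.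
by have := max_poly_roots q0 a u; rewrite size_map size_iota ltnn.
Qed.

(** The symmetry of [B_n] at [z = 1], where [v = 1 / (z - 1)] is infinite: evaluation is replaced by
    comparison of the coefficients of degree [n]. *)
Lemma odd_lead (F : numFieldType) (q : {poly F}) n : (size q <= n.+1)%N ->
  (forall v, q.[-1 - v] = - q.[v]) -> q`_n = (-1) ^+ n.+1 * q`_n.
Proof.
move=> sq hq; have E : q \Po (- (1 + 'X)) = - q.
  apply/eqP; rewrite -subr_eq0; apply/eqP/poly_eq0_horner => v.
  rewrite hornerD hornerN horner_comp !hornerN hornerD hornerC hornerX opprK.
  by rewrite opprD hq addNr.
have := congr1 (fun p : {poly F} => p`_n) E; rewrite coefN /=.
rewrite {1}comp_polyE coef_sum.
have neg (l : nat) : ((- (1 + 'X : {poly F})) ^+ l)`_n = (-1) ^+ l * ((1 + 'X : {poly F}) ^+ l)`_n.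
  rewrite (exprNn (1 + 'X)); have -> : (-1 : {poly F}) ^+ l = ((-1) ^+ l)%:P by rewrite polyC_exp polyCN polyC1.
  by rewrite coefCM.
have pw (l : nat) : ((- (1 + 'X : {poly F})) ^+ l)`_n = if n == l then (-1) ^+ l else if (l < n)%N then 0 else ((- (1 + 'X : {poly F})) ^+ l)`_n.
  have [<-|nl] := eqVneq n l; last first.
    case: ltnP => // ln; rewrite neg.
    by rewrite nth_default ?mulr0 // size_X1n.
  rewrite neg.
  have : (1 + 'X : {poly F}) ^+ n \is monic.
    by rewrite monic_exp // addrC -[1]opprK -polyC1 -polyCN monicXsubC.
  by rewrite monicE lead_coefE size_X1n /= => /eqP ->; rewrite mulr1.
have -> : \sum_(i < size q) (q`_i *: (- (1 + 'X : {poly F})) ^+ i)`_n = q`_n * (-1) ^+ n.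
  have [sn|sn] := ltnP n (size q).
    rewrite (bigD1 (Ordinal sn)) //= coefZ pw eqxx big1 ?addr0 // => i ni.
    rewrite coefZ pw; have -> : (n == i) = false by apply/eqP => e; move/eqP: ni; apply; exact: val_inj.
    have -> : (i < n)%N; last by rewrite mulr0.
    rewrite ltn_neqAle -ltnS (leq_trans (ltn_ord i) sq) andbT.
    by apply: contra ni => /eqP e; apply/eqP/val_inj.
  rewrite big1 => [|i _]; first by rewrite nth_default // mul0r.
  have lt := leq_trans (ltn_ord i) sn.
  by rewrite coefZ pw gtn_eqF // lt mulr0.
by rewrite exprS mulN1r mulNr mulrC => ->; rewrite opprK.
Qed.

Lemma expr_subV (F : fieldType) (y : F) l m : (l <= m)%N -> y != 0 ->
  y ^+ (m - l) = y ^+ m * y^-1 ^+ l.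
Proof. by move=> lm y0; rewrite -{2}(subnK lm) exprD exprVn mulfK // expf_neq0. Qed.

Section Bpoly.
Variable R : realType.
Local Notation C := (Cplx R).
Variable h : nat -> {poly rat}.
Hypothesis hh : hsys h.

(** [(z - 2) ^ (n - 1) h_n(1 / (z - 2))], the reversed polynomial of [h_n] around 2. *)
Definition Bp (n : nat) : {poly rat} :=
  if n is m.+1 then \sum_(l < m.+1) (h m.+1)`_l *: ('X - 2%:P) ^+ (m - l) else -1.

Lemma eval_Bp m (z : C) : eval_rat (Bp m.+1) z = \sum_(l < m.+1) (hC R h m.+1)`_l * (z - 2) ^+ (m - l).
Proof.
rewrite /eval_rat /Bp rmorph_sum horner_sum; apply: eq_bigr => l _ /=.
rewrite map_polyZ hornerZ rmorphXn /= rmorphB /= map_polyX map_polyC /= rmorph_nat.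
by rewrite horner_exp hornerXsubC coef_map.
Qed.

Lemma size_hC n : (0 < n)%N -> (size (hC R h n) <= n)%N.
Proof. by move=> n0; have [] := hsysC R hh n0. Qed.

Lemma horner_hC m (v : C) : (hC R h m.+1).[v] = \sum_(l < m.+1) (hC R h m.+1)`_l * v ^+ l.
Proof. by rewrite (horner_coef_wide _ (size_hC (ltn0Sn m))). Qed.

Lemma eval_Bp_v m (z : C) : z != 2 -> eval_rat (Bp m.+1) z = (z - 2) ^+ m * (hC R h m.+1).[(z - 2)^-1].
Proof.
move=> z2; have y0 : z - 2 != 0 by rewrite subr_eq0.
rewrite eval_Bp horner_hC mulr_sumr; apply: eq_bigr => l _.
have lm : (l <= m)%N by rewrite -ltnS.
by rewrite mulrCA; congr (_ * _); exact: expr_subV.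
Qed.

Lemma Hf_Bp n (z : C) : z != 2 -> Hf h n z = eval_rat (Bp n) z / (z - 2) ^+ n.+1.
Proof.
move=> z2; have y0 : z - 2 != 0 by rewrite subr_eq0.
case: n => [|m].
  rewrite /Hf /ev /= hornerN hornerX expr1 /eval_rat /Bp rmorphN rmorph1.
  by rewrite hornerN hornerC mulN1r.
rewrite eval_Bp_v // /Hf /ev /= hornerM hornerXn !exprS; move: (hC R h m.+1).[_] => a.
by field; rewrite y0 expf_neq0.
Qed.

Lemma size_Bp n : (0 < n)%N -> (size (Bp n) <= n)%N.
Proof.
case: n => // m _; apply: leq_trans (size_sum _ _ _) _; apply/bigmax_leqP => l _.
apply: leq_trans (size_scale_leq _ _) _; rewrite size_exp_XsubC ltnS leq_subr //.
Qed.

(** [z = 0] is [v = -1/2], the fixed point of [v -> -1 - v], where an odd function vanishes. *)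
Lemma Bp_0 n : (0 < n)%N -> (Bp n).[0] = 0.
Proof.
case: n => // m _.
have h0 : (h m.+1).[- 2^-1] = 0.
  have := @hsys_odd _ h m.+1 (- 2^-1) hh isT.
  have -> : -1 - - 2^-1 = - 2^-1 :> rat by lra.
  by lra.
have -> : (Bp m.+1).[0] = (-2) ^+ m * (h m.+1).[- 2^-1].
  have [sh _] := hh (ltn0Sn m).
  rewrite /Bp horner_sum (horner_coef_wide _ sh) mulr_sumr; apply: eq_bigr => l _.
  rewrite hornerZ horner_exp hornerXsubC sub0r mulrCA; congr (_ * _).
  have lm : (l <= m)%N by rewrite -ltnS.
  have -> : - 2^-1 = (-2)^-1 :> rat by rewrite invrN.
  by rewrite expr_subV.
by rewrite h0 mulr0.
Qed.

Lemma hC_odd n (v : C) : (0 < n)%N -> (hC R h n).[-1 - v] = - (hC R h n).[v].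
Proof. exact: (hsys_odd _ (hsysC R hh)). Qed.

Lemma Bp_sym n (z : C) : (0 < n)%N -> z != 0 ->
  eval_rat (Bp n) (z + 1) = (-1) ^+ n * z ^+ n.-1 * eval_rat (Bp n) (1 / z + 1).
Proof.
case: n => // m _ z0 /=; have [->|z1] := eqVneq z 1.
  rewrite divr1 expr1n mulr1 !eval_Bp.
  have -> : \sum_(l < m.+1) (hC R h m.+1)`_l * (1 + 1 - 2) ^+ (m - l) = (hC R h m.+1)`_m :> C.
    rewrite (bigD1 ord_max) //= subnn expr0 mulr1 big1 ?addr0 // => l lm.
    have -> : 1 + 1 - 2 = 0 :> C by ring.
    rewrite expr0n; have -> : (m - l == 0)%N = false; last by rewrite mulr0.
    apply/negbTE; rewrite subn_eq0 -ltnNge ltn_neqAle -ltnS ltn_ord andbT.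
    by apply: contra lm => /eqP e; apply/eqP/val_inj.
  by apply: odd_lead; [exact: size_hC|move=> v; exact: hC_odd].
have z1' : z - 1 != 0 by rewrite subr_eq0.
have e1 : z + 1 - 2 = z - 1 by ring.
have e2 : 1 / z + 1 - 2 = - ((z - 1) / z) by field.
rewrite !eval_Bp_v; last 2 first.
- by rewrite -subr_eq0 e2 oppr_eq0 mulf_neq0 // invr_eq0.
- by rewrite -subr_eq0 e1.
rewrite e1 e2.
have -> : (- ((z - 1) / z))^-1 = -1 - (z - 1)^-1 by rewrite invrN; field; rewrite ?z0 ?z1'.
rewrite hC_odd // (exprNn ((z - 1) / z)) (exprMn _ (z - 1)) exprVn exprS.
have s : (-1) ^+ m * (-1) ^+ m = 1 :> C by rewrite -expr2 sqrr_sign.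
have zz : z ^+ m * z ^- m = 1 by rewrite mulfV // expf_neq0.
move: (hC R h m.+1).[_] => a.
transitivity (((-1) ^+ m * (-1) ^+ m) * (z ^+ m * z ^- m) * ((z - 1) ^+ m * a)); last by ring.
by rewrite s zz !mul1r.
Qed.

Lemma Hf0 (z : C) : Hf h 0 z = 1 / (2 - z).
Proof. by rewrite /Hf /ev /= hornerN hornerX mul1r -invrN opprB. Qed.

(* The substitution z -> z/(z-1) sends v = 1/(z-2) to -1-v. *)
Lemma Hf_reflect n (z : C) : (0 < n)%N -> z != 1 -> z != 2 ->
  Hf h n z = - (z - 1) ^- 2 * Hf h n (z / (z - 1)).
Proof.
case: n => // m _ z1 z2; have z1' : z - 1 != 0 by rewrite subr_eq0.
have z2' : z - 2 != 0 by rewrite subr_eq0.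
rewrite /Hf /ev /= !(hornerM 'X^2) !hornerXn.
have -> : (z / (z - 1) - 2)^-1 = -1 - (z - 2)^-1.
  have -> : z / (z - 1) - 2 = - ((z - 2) / (z - 1)) by field.
  by rewrite invrN; field; rewrite z1' z2'.
rewrite hC_odd //; move: (hC R h m.+1).[_] => a.
by field; rewrite z1' z2'.
Qed.

End Bpoly.

(** * The tree of deformed continued fractions *)

Section tree.
Variable R : realType.
Local Notation C := (Cplx R).
Local Notation frac := ({poly C} * {poly C})%type.
Implicit Types (a : frac).

(* A point of the tree is the pair of its numerator and its denominator, as
   polynomials in [e]; [step1] and [step2] are [T1] and [T2]. *)
Definition step1 a : frac := (a.1 + a.2, ('X + 2%:P) * a.2).
Definition step2 a : frac := (('X + 2%:P) * a.1, a.1 + a.2).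

Fixpoint tree (N : nat) : seq frac :=
  if N is N'.+1 then map step1 (tree N') ++ map step2 (tree N') else [:: (1, 1)].

Lemma sum_treeS (V : nmodType) (F : frac -> V) N :
  \sum_(a <- tree N.+1) F a = \sum_(a <- tree N) (F (step1 a) + F (step2 a)).
Proof. by rewrite /= big_cat !big_map big_split. Qed.

Definition val a (e : C) : C := a.1.[e] / a.2.[e].

Lemma hornerX2 (p : {poly C}) (e : C) : (('X + 2%:P) * p).[e] = (2 + e) * p.[e].
Proof. by rewrite hornerM hornerD hornerX hornerC addrC. Qed.

Definition regular (e : C) a := [/\ a.1.[e] != 0, a.2.[e] != 0 & good e (val a e)].

Lemma val_step1 e a : a.2.[e] != 0 -> val (step1 a) e = (val a e + 1) / (2 + e).
Proof.
move=> q0; rewrite /val /step1 /= hornerX2 hornerD invfM mulrA [_ / _ / _]mulrAC.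
by rewrite mulrDl divff.
Qed.

Lemma val_step2 e a : a.2.[e] != 0 ->
  val (step2 a) e = (2 + e) * val a e / (val a e + 1).
Proof.
move=> q0; rewrite /val /step2 /= hornerX2 hornerD.
have -> : a.1.[e] + a.2.[e] = (a.1.[e] / a.2.[e] + 1) * a.2.[e] by rewrite mulrDl mul1r divfK.
by rewrite invfM; ring.
Qed.

Lemma sum_eq_val e a : a.2.[e] != 0 -> a.1.[e] + a.2.[e] = (val a e + 1) * a.2.[e].
Proof. by move=> q0; rewrite mulrDl mul1r divfK. Qed.

Lemma regular_tree e N a : nm e < 1 -> a \in tree N -> regular e a.
Proof.
move=> e1; have e2 := eps_neqN2 e1; elim: N a => [|N IH] a.
  rewrite inE => /eqP ->; split; rewrite /= ?hornerC ?oner_neq0 //.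
  by rewrite /val /= !hornerC divr1; exact: good1.
rewrite /= mem_cat => /orP[] /mapP[b /IH[p0 q0 gb] ->].
  have s0 : b.1.[e] + b.2.[e] != 0 by rewrite sum_eq_val // mulf_neq0 // (good_neqN1 gb).
  split; rewrite /= ?hornerX2 ?hornerD ?mulf_neq0 //.
  by rewrite val_step1 //; exact: good_step1.
have s0 : b.1.[e] + b.2.[e] != 0 by rewrite sum_eq_val // mulf_neq0 // (good_neqN1 gb).
split; rewrite /= ?hornerX2 ?hornerD ?mulf_neq0 //.
by rewrite val_step2 //; exact: good_step2.
Qed.

(* The logarithmic derivative of [val a] in [e]. *)
Definition ldv a (e : C) : C := a.1^`().[e] / a.1.[e] - a.2^`().[e] / a.2.[e].

Lemma derivX2 (p : {poly C}) e : (('X + 2%:P) * p)^`().[e] = p.[e] + (2 + e) * p^`().[e].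
Proof. by rewrite derivM derivD derivX derivC addr0 mul1r hornerD hornerX2. Qed.

(** Logarithmic differentiation of [T1] and [T2] multiplies [ldv] by [x / (x + 1)] and [1 / (x + 1)]
    and adds a term of modulus at most 1; the moduli of the factors sum to at most [48/25] by
    [outside_bounds]. *)
Lemma ldv_steps e a : nm e < 1 -> regular e a ->
  nm (ldv (step1 a) e) + nm (ldv (step2 a) e) <= 2 * (24/25) * nm (ldv a e) + 2.
Proof.
move=> e1 [p0 q0 ga]; have e2 := eps_neqN2 e1.
have x1 := good_neqN1 ga; have [_ h _] := outside_bounds (good_outside ga).
have s0 : a.1.[e] + a.2.[e] != 0 by rewrite sum_eq_val // mulf_neq0.
set x := val a e in x1 h ga.
have E1 : ldv (step1 a) e = ldv a e * x / (x + 1) - (2 + e)^-1.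
  rewrite /ldv /= derivX2 hornerX2 derivD !hornerD.
  have xE : x / (x + 1) = a.1.[e] / (a.1.[e] + a.2.[e]).
    by rewrite sum_eq_val // -/x /x /val; field; rewrite q0 s0.
  rewrite -[_ * x / _]mulrA xE; field.
  by rewrite p0 q0 e2 s0.
have E2 : ldv (step2 a) e = ldv a e / (x + 1) + (2 + e)^-1.
  rewrite /ldv /= derivX2 hornerX2 derivD !hornerD.
  have xE : (x + 1)^-1 = a.2.[e] / (a.1.[e] + a.2.[e]).
    by rewrite sum_eq_val // -/x; field; rewrite q0.
  rewrite xE; field.
  by rewrite p0 q0 e2 s0.
clearbody x.
have p1 : nm (2 + e)^-1 <= 1.
  by rewrite nmV invf_le1; have := nm_2eps e1 => h'; [exact: ltW|lra].
have h1 : nm (ldv (step1 a) e) <= nm (ldv a e) * (nm x / nm (x + 1)) + 1.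
  by rewrite E1; apply: le_trans (nm_le_sub _ _) _; apply: lerD => //; rewrite !nmM nmV -mulrA.
have h2 : nm (ldv (step2 a) e) <= nm (ldv a e) * (1 / nm (x + 1)) + 1.
  by rewrite E2; apply: le_trans (nm_le_add _ _) _; apply: lerD => //; rewrite !nmM nmV mul1r.
apply: le_trans (lerD h1 h2) _.
rewrite addrACA -mulrDr -mulrDl [X in _ <= X + _]mulrC.
have n1 : 0 < nm (x + 1) by rewrite nm_gt0.
have : (nm x + 1) / nm (x + 1) <= 2 * (24/25) by rewrite ler_pdivrMr // addrC.
by move=> /(ler_wpM2l (nm_ge0 (ldv a e))); lra.
Qed.

(** The constant 25 is reproduced by the recursion: [2 * (24/25) * 25 + 2 = 2 * 25]. *)
Lemma sum_ldv e N : nm e < 1 -> \sum_(a <- tree N) nm (ldv a e) <= 25 * 2 ^+ N.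
Proof.
move=> e1; elim: N => [|N IH].
  by rewrite big_seq1 /ldv /= !derivC !hornerC !mul0r subr0 nm0 expr0.
rewrite sum_treeS.
apply: (@le_trans _ _ (\sum_(a <- tree N) (2 * (24/25) * nm (ldv a e) + 2))).
  rewrite big_seq [leRHS]big_seq; apply: ler_sum => a aN.
  by apply: ldv_steps => //; exact: regular_tree aN.
rewrite big_split /= -mulr_sumr.
have -> : \sum_(a <- tree N) (2 : R) = 2 * 2 ^+ N.
  rewrite big_const_seq count_predT iter_addr_0.
  have -> : size (tree N) = (2 ^ N)%N.
    by elim: (N) => // n IHn; rewrite /= size_cat !size_map IHn expnS mul2n addnn.
  by rewrite -[LHS]mulr_natr natrX.
rewrite exprS; lra.
Qed.

Definition den (z : C) a := a.1 + (1 - z) *: a.2.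

Lemma den_val z e a : a.2.[e] != 0 -> (den z a).[e] = (val a e + 1 - z) * a.2.[e].
Proof.
move=> q0; rewrite /den hornerD hornerZ -addrA [RHS]mulrDl divfK //.
Qed.

(** The constant 88 is what [22/29] allows: [(22/29) (1 - 1/88) = 3/4]. *)
Lemma val_sub_ge z e a : nm e < 1 -> nm z <= 3/4 -> regular e a ->
  nm (val a e + 1) / 88 <= nm (val a e + 1 - z).
Proof.
move=> e1 hz [_ _ ga]; have [h _ _] := outside_bounds (good_outside ga).
have := nm_ge_sub (val a e + 1) (- z); rewrite nmN; lra.
Qed.

Lemma den_neq0 z e a : nm e < 1 -> nm z <= 3/4 -> regular e a -> (den z a).[e] != 0.
Proof.
move=> e1 hz ra; have := val_sub_ge e1 hz ra; have [p0 q0 ga] := ra.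
have [h _ _] := outside_bounds (good_outside ga).
by move=> h2; rewrite den_val // mulf_neq0 // -nm_gt0; lra.
Qed.

(** [f1] is [e] times the derivative of the sum. The constant is [7744 = 88 ^ 2]: by [val_sub_ge]
    and the last bound of [outside_bounds], [|x| / |x + 1 - z| ^ 2 <= 88 ^ 2]. *)
Lemma frac_pser z r (s : seq frac) : 0 < r -> r < 1 -> nm z <= 3/4 ->
  (forall a, a \in s -> forall e, nm e < 1 -> regular e a) ->
  exists c f1, [/\ pser r c (fun e => \sum_(a <- s) (val a e + 1 - z)^-1),
    pser r (fun n => n%:R * c n) f1 &
    forall e, nm e <= r -> nm (f1 e) <= 7744 * \sum_(a <- s) nm (ldv a e)].
Proof.
move=> r0 r1 hz; elim: s => [_|a s IH hs].
  exists (fun=> 0), (fun=> 0); split.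
  - apply: pser_ext (pser_const 0 (ltW r0)); first by case.
    by move=> e _; rewrite big_nil.
  - apply: pser_ext (pser_const 0 (ltW r0)); first by case=> [|n]; rewrite mulr0.
    by [].
  - by move=> e _; rewrite big_nil nm0 mulr0.
have [|c [f1 [h1 h2 h3]]] := IH; first by move=> b bs; apply: hs; rewrite inE bs orbT.
have ha := hs a (mem_head _ _).
have er e : nm e <= r -> nm e < 1 by move=> h; exact: le_lt_trans r1.
have [|d [g [g1 [k1 k2 k3]]]] := @pser_frac R a.2 (den z a) r r0.
  by move=> e /er e1; apply: den_neq0 => //; exact: ha.
exists (fun n => 1 * d n + 1 * c n), (fun e => 1 * g1 e + 1 * f1 e); split.
- apply: pser_ext (pser_lin 1 1 k1 h1) => // e he; rewrite big_cons !mul1r; congr (_ + _).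
  have [k4 _] := k3 e he; have [p0 q0 ga] := ha e (er e he).
  have D0 := den_neq0 (er e he) hz (ha e (er e he)).
  apply: (mulfI D0); rewrite k4 den_val //.
  rewrite mulrAC divff ?mul1r //.
  by move: D0; rewrite den_val // mulf_eq0 negb_or => /andP[].
- by apply: pser_ext (pser_lin 1 1 k2 h2) => // n; ring.
move=> e he; rewrite !mul1r big_cons mulrDr.
apply: le_trans (nm_le_add _ _) _; apply: lerD; last exact: h3.
have [k4 k5] := k3 e he; have ra := ha e (er e he); have [p0 q0 ga] := ra.
have D0 := den_neq0 (er e he) hz ra.
have vs := val_sub_ge (er e he) hz ra.
have [b1 _ b3] := outside_bounds (good_outside ga).
have y0 : val a e + 1 - z != 0.
  by move: D0; rewrite den_val // mulf_eq0 negb_or => /andP[].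
set y := val a e + 1 - z in vs y0.
(* [e] times the derivative of [1 / (x + 1 - z)], with [x'] written as [x] times [ldv]. *)
have g1E : g1 e = - e * ldv a e * val a e * y^-1 ^+ 2.
  have gE : g e = y^-1.
    by apply: (mulfI D0); rewrite k4 den_val // -/y mulrAC divff // mul1r.
  apply: (mulfI D0); move/eqP: k5; rewrite -subr_eq0 => /eqP k5.
  apply/eqP; rewrite -subr_eq0; apply/eqP; rewrite -[RHS]k5 gE.
  rewrite den_val // -/y /den derivD derivZ hornerD hornerZ /ldv /val.
  have -> : 1 - z = y - a.1.[e] / a.2.[e] by rewrite /y /val; ring.
  by field; rewrite p0 q0 y0.
have yp : 0 < nm y by rewrite nm_gt0.
rewrite g1E; have nmE (u v t y2 : C) : nm (- u * v * t * y2^-1 ^+ 2) = nm u * nm v * nm t * (nm y2)^-1 ^+ 2.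
  by rewrite nmM nmX nmV !nmM nmN.
rewrite nmE.
have x1p : 0 <= nm (val a e + 1) := nm_ge0 _.
have xy : nm (val a e) * (nm y)^-1 ^+ 2 <= 7744.
  rewrite exprVn ler_pdivrMr ?exprn_gt0 //; apply: le_trans b3 _.
  have -> : 7744 * nm y ^+ 2 = (88 * nm y) ^+ 2 :> R by rewrite exprMn; congr (_ * _); rewrite expr2; lra.
  by rewrite ler_sqr ?nnegrE ?mulr_ge0 ?(ltW yp) //; lra.
rewrite -mulrA; apply: (@le_trans _ _ (nm (ldv a e) * 7744)); last by rewrite mulrC.
apply: ler_pM; rewrite ?mulr_ge0 ?nm_ge0 ?exprn_ge0 ?invr_ge0 ?nm_ge0 //.
rewrite ler_piMl ?nm_ge0 //; exact: ltW (er e he).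
Qed.

Definition favg (N : nat) (z e : C) : C := 2 ^- N * \sum_(a <- tree N) (val a e + 1 - z)^-1.

Lemma favg_pser N z r : 0 < r -> r < 1 -> nm z <= 3/4 ->
  exists c, pser r c (favg N z) /\ forall K, \sum_(n < K) (n%:R * nm (c n) * r ^+ n) ^+ 2 <= (25 * 7744) ^+ 2.
Proof.
move=> r0 r1 hz; have [a aN e e1|c [f1 [h1 h2 h3]]] := @frac_pser z r (tree N) r0 r1 hz.
  exact: regular_tree aN.
have two0 : (2 : C) ^- N != 0 by rewrite invr_eq0 expf_neq0 // pnatr_eq0.
have n2 : nm (2 ^- N) = 2 ^- N :> R by rewrite nmV nmX nm_nat.
exists (fun n => 2 ^- N * c n + 0 * c n); split.
  by apply: pser_ext (pser_lin (2 ^- N) 0 h1 h1) => // e _; rewrite mul0r addr0.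
move=> K; have h4 := pser_lin (2 ^- N) 0 h2 h2.
have := pser_parseval (ltW r0) h4 (_ : forall e, nm e = r -> nm _ <= 25 * 7744).
move=> h; apply: le_trans (h _ K).
  apply: ler_sum => n _; rewrite le_eqVlt; apply/orP; left; apply/eqP; congr (_ ^+ 2).
  by rewrite !mul0r !addr0 !nmM nm_nat; ring.
move=> e er; rewrite mul0r addr0 nmM n2.
have e1 : nm e < 1 by rewrite er.
have := h3 e; rewrite er lexx => /(_ isT) h5.
have h6 := sum_ldv N e1.
have p2 : 0 < 2 ^+ N :> R by rewrite exprn_gt0.
rewrite mulrC ler_pdivrMr //; lra.
Qed.

End tree.

(** * Convergence of the Taylor coefficients to H_n *)

Section approx.
Variable R : realType.
Local Notation C := (Cplx R).
Implicit Types (F : C -> C -> C) (c : nat -> {poly C}).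

(** Chosen so that [v -> v / be] and [v -> (-1 - v) / be'] preserve [|v| <= 2] and [feedback]
    contracts; it contains the coordinate [1 / (z - 2)] of every [|z| <= 3/4]. *)
Definition small (e v : C) := nm e <= 1/32 /\ nm v <= 2.

Definition apx (J : nat) F c := exists2 B : R, 0 <= B & forall e v, small e v ->
  nm (F e v - \sum_(m < J) e ^+ m * (c m).[v]) <= B * nm e ^+ J.

Lemma poly_bounded (p : {poly C}) : exists2 B : R, 0 <= B & forall v, nm v <= 2 -> nm p.[v] <= B.
Proof.
elim/poly_ind: p => [|p a [B B0 IH]]; first by exists 0 => // v _; rewrite horner0 nm0.
exists (B * 2 + nm a); first by rewrite addr_ge0 ?nm_ge0 // mulr_ge0.
move=> v hv; rewrite hornerMXaddC; apply: le_trans (nm_le_add _ _) _.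
by rewrite lerD2r nmM ler_pM ?nm_ge0 ?IH.
Qed.

Lemma apx_add J F1 F2 c1 c2 : apx J F1 c1 -> apx J F2 c2 ->
  apx J (fun e v => F1 e v + F2 e v) (fun m => c1 m + c2 m).
Proof.
move=> [B1 b1 h1] [B2 b2 h2]; exists (B1 + B2); first exact: addr_ge0.
move=> e v s; have -> : F1 e v + F2 e v - \sum_(m < J) e ^+ m * (c1 m + c2 m).[v] =
   (F1 e v - \sum_(m < J) e ^+ m * (c1 m).[v]) + (F2 e v - \sum_(m < J) e ^+ m * (c2 m).[v]).
  by under eq_bigr do rewrite hornerD mulrDr; rewrite big_split /=; ring.
by apply: le_trans (nm_le_add _ _) _; rewrite mulrDl lerD ?h1 ?h2.
Qed.

Lemma apx_scale J F c (a : C) : apx J F c -> apx J (fun e v => a * F e v) (fun m => a *: c m).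
Proof.
move=> [B b h]; exists (nm a * B); first by rewrite mulr_ge0 ?nm_ge0.
move=> e v s; have -> : a * F e v - \sum_(m < J) e ^+ m * (a *: c m).[v] =
   a * (F e v - \sum_(m < J) e ^+ m * (c m).[v]).
  by rewrite mulrBr mulr_sumr; congr (_ - _); apply: eq_bigr => m _; rewrite hornerZ mulrCA.
by rewrite nmM -mulrA ler_wpM2l ?nm_ge0 ?h.
Qed.

Lemma apx_ext J F1 F2 c1 c2 : (forall e v, small e v -> F1 e v = F2 e v) ->
  (forall m, (m < J)%N -> c1 m = c2 m) -> apx J F1 c1 -> apx J F2 c2.
Proof.
move=> hF hc [B b h]; exists B => // e v s; rewrite -hF //.
by under eq_bigr do rewrite -hc //; exact: h.
Qed.

Definition shiftp c (m : nat) : {poly C} := if m is m'.+1 then c m' else 0.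

Lemma apx_shift J F c : apx J F c -> apx J (fun e v => e * F e v) (shiftp c).
Proof.
move=> [B b h]; case: J h => [|J] h.
  exists B => // e v s; have := h e v s; rewrite !big_ord0 !subr0 expr0 mulr1 => h1.
  have [s1 _] := s; rewrite nmM; apply: le_trans h1; rewrite ler_piMl ?nm_ge0 //; lra.
have [M M0 hM] := poly_bounded (c J).
exists (B + M); first exact: addr_ge0.
move=> e v s; have [s1 s2] := s.
have -> : e * F e v - \sum_(m < J.+1) e ^+ m * (shiftp c m).[v] =
   e * (F e v - \sum_(m < J.+1) e ^+ m * (c m).[v]) + e ^+ J.+1 * (c J).[v].
  rewrite big_ord_recl /= horner0 mulr0 add0r [X in e * (_ - X)]big_ord_recr /= mulrBr mulrDr.
  have -> : e * (e ^+ J * (c J).[v]) = e ^+ J.+1 * (c J).[v] by rewrite exprS mulrA.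
  rewrite mulr_sumr.
  have -> : \sum_(i < J) e ^+ (bump 0 i) * (c i).[v] = \sum_(i < J) e * (e ^+ i * (c i).[v]).
    by apply: eq_bigr => i _; rewrite /bump /= add1n exprS mulrA.
  by ring.
apply: le_trans (nm_le_add _ _) _; rewrite mulrDl !nmM nmX; apply: lerD.
  apply: le_trans (_ : 1 * (B * nm e ^+ J.+1) <= _); last by rewrite mul1r.
  by apply: ler_pM; rewrite ?nm_ge0 ?h //; lra.
by rewrite mulrC ler_wpM2r ?exprn_ge0 ?nm_ge0 // hM.
Qed.

Lemma apx_shiftn n J F c : apx J F c ->
  apx J (fun e v => e ^+ n * F e v) (fun m => if (n <= m)%N then c (m - n)%N else 0).
Proof.
move=> h; elim: n => [|n IH].
  by apply: apx_ext h => [e v _|m _]; rewrite ?expr0 ?mul1r ?subn0.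
apply: apx_ext (apx_shift IH) => [e v _|m _]; first by rewrite exprS mulrA.
by case: m => [|m] //=; rewrite ltnS subSS.
Qed.

Lemma apx_sum (I : Type) (s : seq I) J (F : I -> C -> C -> C) (c : I -> nat -> {poly C}) :
  (forall i, apx J (F i) (c i)) ->
  apx J (fun e v => \sum_(i <- s) F i e v) (fun m => \sum_(i <- s) c i m).
Proof.
move=> h; elim: s => [|i s IH].
  exists 0 => // e v _; rewrite big_nil big1 => [|m _]; first by rewrite subr0 nm0 mul0r.
  by rewrite big_nil horner0 mulr0.
by apply: apx_ext (apx_add (h i) IH) => [e v _|m _]; rewrite big_cons.
Qed.

Definition bcoef (m j : nat) : C := 'C(m + j - 1, j)%:R * 2 ^- (m + j).

(** Induction on [m]: by Pascal's rule, multiplying the partial sum for [m + 1] by [2 + X] gives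
    that for [m] and one boundary term of order [X ^ J]. *)
Lemma binom_series m J : exists2 B : R, 0 <= B & forall X : C, nm X <= 1 ->
  nm ((2 + X) ^- m - \sum_(j < J) bcoef m j * (- X) ^+ j) <= B * nm X ^+ J.
Proof.
elim: m => [|m [B B0 IH]].
  exists 1 => // X hX; rewrite expr0 invr1; case: J => [|J].
    by rewrite big_ord0 subr0 nm1 expr0 mulr1.
  rewrite big_ord_recl /= /bcoef /= expr0 bin0 invr1 !mulr1 big1 => [|i _].
    by rewrite addr0 subrr nm0 mulr_ge0 // exprn_ge0 // nm_ge0.
  by rewrite /bump /= add0n add1n subn1 /= bin_small // !mul0r.
exists (B + nm (bcoef m.+1 J.-1)); first by rewrite addr_ge0 ?nm_ge0.
move=> X hX; have x2 : 1 <= nm (2 + X).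
  by have := nm_ge_sub 2 X; rewrite nm_nat; lra.
have x0 : 2 + X != 0 by rewrite -nm_gt0; lra.
have E : (2 + X) * \sum_(j < J) bcoef m.+1 j * (- X) ^+ j =
    \sum_(j < J) bcoef m j * (- X) ^+ j + (if J is J'.+1 then - bcoef m.+1 J' * (- X) ^+ J'.+1 else 0).
  elim: (J) => [|J' IHJ]; first by rewrite !big_ord0 mulr0 addr0.
  rewrite !big_ord_recr /= mulrDr IHJ.
  have P : 2 * bcoef m.+1 J' - (if J' is j.+1 then bcoef m.+1 j else 0) = bcoef m J'.
    rewrite /bcoef; case: J' {IHJ} => [|j].
      by rewrite subr0 !addn0 !bin0 !mul1r exprS invfM mulrA divff ?mul1r // pnatr_eq0.
    have -> : (m.+1 + j.+1 - 1 = (m + j).+1)%N by lia.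
    have -> : (m.+1 + j - 1 = m + j)%N by lia.
    have -> : (m + j.+1 - 1 = m + j)%N by lia.
    rewrite binS natrD addSn exprS invfM mulrCA mulrA -!addSnnS.
    have -> : (m.+1 + j = (m + j).+1)%N by lia.
    by field; rewrite expf_neq0 // pnatr_eq0.
  have -> : (if J' is j.+1 then - bcoef m.+1 j * (- X) ^+ j.+1 else 0) =
      - (if J' is j.+1 then bcoef m.+1 j else 0) * (- X) ^+ J'.
    by case: (J') => [|j]; rewrite ?oppr0 ?mul0r.
  rewrite -P [(- X) ^+ J'.+1]exprS; move: (\sum_(_ < _) _) (if _ is _.+1 then _ else _) (bcoef _ _) ((- X) ^+ J').
  by move=> a b d y; ring.
have -> : (2 + X) ^- m.+1 - \sum_(j < J) bcoef m.+1 j * (- X) ^+ j =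
    (2 + X)^-1 * (((2 + X) ^- m - \sum_(j < J) bcoef m j * (- X) ^+ j) -
       (if J is J'.+1 then - bcoef m.+1 J' * (- X) ^+ J'.+1 else 0)).
  apply: (mulfI x0); rewrite mulrBr E mulrA divff // mul1r exprS invfM mulrA divff // mul1r.
  by rewrite opprD addrA.
rewrite nmM nmV; apply: (le_trans (ler_piMl (nm_ge0 _) _)); first by rewrite invf_le1 //; lra.
rewrite mulrDl; apply: le_trans (nm_le_sub _ _) _; apply: lerD; first exact: IH.
case: (J) => [|J']; first by rewrite nm0 mulr_ge0 ?nm_ge0 // exprn_ge0 // nm_ge0.
by rewrite /= nmM nmN nmX nmN.
Qed.

Lemma apx_binom m J (p : {poly C}) (X : C -> C) (q : {poly C}) :
  (forall v, X v = q.[v]) -> (forall v, nm v <= 2 -> nm (q.[v]) <= 3) ->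
  apx J (fun e v => p.[v] * (2 + e * X v) ^- m) (fun j => bcoef m j *: (p * (- q) ^+ j)).
Proof.
move=> hX hq; have [B B0 hB] := binom_series m J; have [M M0 hM] := poly_bounded p.
exists (M * (B * 3 ^+ J)); first by rewrite !mulr_ge0 // exprn_ge0.
move=> e v [s1 s2]; have eX : nm (e * X v) <= nm e * 3.
  by rewrite nmM ler_wpM2l ?nm_ge0 // hX hq.
have -> : p.[v] * (2 + e * X v) ^- m - \sum_(j < J) e ^+ j * (bcoef m j *: (p * (- q) ^+ j)).[v]
  = p.[v] * ((2 + e * X v) ^- m - \sum_(j < J) bcoef m j * (- (e * X v)) ^+ j).
  rewrite mulrBr mulr_sumr; congr (_ - _); apply: eq_bigr => j _.
  by rewrite hornerZ hornerM horner_exp hornerN -hX -mulrN exprMn; ring.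
rewrite nmM -mulrA; apply: ler_pM; rewrite ?nm_ge0 ?hM //.
have e1 : nm (e * X v) <= 1 by lra.
apply: le_trans (hB _ e1) _; rewrite -mulrA ler_wpM2l // mulrC -exprMn.
by rewrite [X v * e]mulrC [3 * _]mulrC lerXn2r ?nnegrE ?mulr_ge0 ?nm_ge0.
Qed.

Definition be (e v : C) : C := 2 + e * (1 + v).
Definition be' (e v : C) : C := 2 + e * - v.

(* The generating function of the operators: [Lhat h e v = \sum_j e ^ j (pop j h)(v)]. *)
Definition Lhat (h : C -> C) (e v : C) : C :=
  be e v ^- 2 * h (v / be e v) - be' e v ^- 2 * h ((-1 - v) / be' e v).

Lemma nm1v (v : C) : nm v <= 2 -> nm (1 + v) <= 3.
Proof. by move=> h; have := nm_le_add 1 v; rewrite nm1; lra. Qed.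

Lemma pcoefE l j : pcoef C l j = bcoef l.+2 j.
Proof.
rewrite /pcoef /bcoef; congr ('C(_, _)%:R * 2 ^- _); lia.
Qed.

Lemma apx_Lhat_mono J l : apx J (Lhat (fun v => v ^+ l)) (pmono C l).
Proof.
have h1 : apx J (fun e v => ('X^l).[v] * (2 + e * (1 + v)) ^- l.+2)
   (fun j => bcoef l.+2 j *: ('X^l * (- (1 + 'X)) ^+ j)).
  apply: apx_binom => [v|v hv]; first by rewrite hornerD hornerC hornerX.
  by rewrite hornerD hornerC hornerX; exact: nm1v.
have h2 : apx J (fun e v => ((- (1 + 'X)) ^+ l).[v] * (2 + e * - v) ^- l.+2)
   (fun j => bcoef l.+2 j *: ((- (1 + 'X)) ^+ l * (- - 'X) ^+ j)).
  apply: apx_binom => [v|v hv]; first by rewrite hornerN hornerX.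
  by rewrite hornerN hornerX nmN; lra.
apply: apx_ext (apx_add h1 (apx_scale (-1) h2)) => [e v _|j _].
  rewrite /Lhat /be /be' hornerXn horner_exp hornerN hornerD hornerC hornerX mulN1r.
  have -> : -1 - v = - (1 + v) by ring.
  rewrite (exprMn l v _^-1) (exprMn l (- (1 + v)) _^-1) !exprVn.
  have E (b x : C) : x * b ^- l.+2 = b ^- 2 * (x * b ^- l).
    by rewrite -(addn2 l) exprD invfM; ring.
  by rewrite !E.
rewrite /pmono pcoefE opprK scaleN1r -scalerN -scalerDr; congr (_ *: (_ - _)).
  by rewrite (exprNn (1 + 'X)) mulrCA -mul_polyC rmorphXn /= rmorphN rmorph1.
by rewrite (exprNn (1 + 'X)) -mulrA [_ * 'X^j]mulrC -mul_polyC rmorphXn /= rmorphN rmorph1.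
Qed.

Lemma apx_Lhat J (p : {poly C}) : apx J (Lhat (fun v => p.[v])) (fun j => pop j p).
Proof.
have h (l : 'I_(size p)) : apx J (fun e v => p`_l * Lhat (fun v => v ^+ l) e v) (fun j => p`_l *: pmono C l j).
  exact: apx_scale (apx_Lhat_mono J l).
apply: apx_ext (apx_sum (index_enum _) h) => [e v _|//].
rewrite /Lhat !horner_coef !mulr_sumr -sumrB; apply: eq_bigr => l _; ring.
Qed.

Definition srcf (e v : C) : C := e * ((be e v)^-1 - (be' e v)^-1).

Lemma apx_src J : apx J srcf (shiftp (fun j => psrc C j.+1)).
Proof.
apply: apx_shift.
have h1 : apx J (fun e v => (1 : {poly C}).[v] * (2 + e * (1 + v)) ^- 1)
   (fun j => bcoef 1 j *: (1 * (- (1 + 'X)) ^+ j)).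
  apply: apx_binom => [v|v hv]; first by rewrite hornerD hornerC hornerX.
  by rewrite hornerD hornerC hornerX; exact: nm1v.
have h2 : apx J (fun e v => (1 : {poly C}).[v] * (2 + e * - v) ^- 1)
   (fun j => bcoef 1 j *: (1 * (- - 'X) ^+ j)).
  apply: apx_binom => [v|v hv]; first by rewrite hornerN hornerX.
  by rewrite hornerN hornerX nmN; lra.
apply: apx_ext (apx_add h1 (apx_scale (-1) h2)) => [e v _|j _].
  by rewrite /be /be' hornerC !mul1r mulN1r !expr1.
have -> : bcoef 1 j = 2 ^- j.+1 by rewrite /bcoef addKn binn mul1r add1n.
rewrite /psrc /= opprK !mul1r scaleN1r -scalerN -scalerDr; congr (_ *: (_ - _)).
by rewrite (exprNn (1 + 'X)) -mul_polyC rmorphXn /= rmorphN rmorph1.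
Qed.

End approx.

(** * The truncated series in [e] is an approximate fixed point *)

Section residual.
Variable R : realType.
Local Notation C := (Cplx R).
Variable h : nat -> {poly C}.
Hypothesis hh : hsys h.

Definition trunc K (e v : C) : C := \sum_(n < K) e ^+ n.+1 * (h n.+1).[v].

Lemma trunc_bounded K : exists2 B : R, 0 <= B & forall e v, small e v -> nm (trunc K e v) <= B.
Proof.
elim: K => [|K [B B0 IH]]; first by exists 0 => // e v _; rewrite /trunc big_ord0 nm0.
have [M M0 hM] := poly_bounded (h K.+1).
exists (B + M); first exact: addr_ge0.
move=> e v s; rewrite /trunc big_ord_recr; apply: le_trans (nm_le_add _ _) _.
apply: lerD; first exact: IH.
have [s1 s2] := s; rewrite nmM nmX; apply: le_trans (_ : 1 * M <= _); last by rewrite mul1r.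
apply: ler_pM; rewrite ?exprn_ge0 ?nm_ge0 ?hM // exprn_ile1 ?nm_ge0 //; lra.
Qed.

Lemma apx_trunc K : apx K.+1 (trunc K) (fun m => if m is 0%N then 0 else h m).
Proof.
exists 0 => // e v _; rewrite big_ord_recl horner0 mulr0 add0r.
have -> : \sum_(i < K) e ^+ lift ord0 i * (h (lift ord0 i)).[v] = trunc K e v by [].
by rewrite subrr nm0 mul0r.
Qed.

Lemma Lhat_trunc K e v : Lhat (trunc K e) e v = \sum_(n < K) e ^+ n.+1 * Lhat (fun v => (h n.+1).[v]) e v.
Proof.
rewrite /Lhat /trunc !mulr_sumr -sumrB; apply: eq_bigr => n _.
by rewrite mulrBr !(mulrCA (e ^+ n.+1)).
Qed.

Definition Lcoef K m : {poly C} :=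
  \sum_(n < K) if (n.+1 <= m)%N then pop (m - n.+1) (h n.+1) else 0.

Lemma apx_Lhat_trunc K J : apx J (fun e v => Lhat (trunc K e) e v) (Lcoef K).
Proof.
have H (n : 'I_K) := apx_shiftn n.+1 (apx_Lhat J (h n.+1)).
by apply: apx_ext (apx_sum (index_enum _) H) => // e v _; rewrite Lhat_trunc.
Qed.

Lemma LcoefE K m : (m <= K)%N -> Lcoef K m = \sum_(0 <= j < m) pop j (h (m - j)%N).
Proof.
move=> mK; rewrite /Lcoef -big_mkcond /= -(big_ord_widen K (fun n => pop (m - n.+1) (h n.+1))) //.
rewrite big_nat_rev big_mkord; apply: eq_bigr => i _; rewrite add0n.
by congr (pop _ (h _)); have := ltn_ord i; lia.
Qed.

Definition feedback (g : C -> C) (e v : C) : C := (1 + e / 2) * Lhat g e v.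

(** For [1 <= m <= K] the coefficient of [e ^ m] vanishes by the [m]-th equation of [hsys]: the
    factor 1 in [1 + e / 2] produces its first sum together with [pop 0], and [e / 2] its second
    sum. *)
Lemma residual K : exists2 B : R, 0 <= B & forall e v, small e v ->
  nm (trunc K e v - (srcf e v / 2 + feedback (trunc K e) e v)) <= B * nm e ^+ K.+1.
Proof.
have a1 := apx_add (apx_trunc K) (apx_scale (- 2^-1) (apx_src R K.+1)).
have a2 := apx_Lhat_trunc K K.+1.
have a3 := apx_add (apx_add a1 (apx_scale (-1) a2)) (apx_scale (- 2^-1) (apx_shift a2)).
have [|B B0 hB] := @apx_ext _ K.+1 _ _ _ (fun=> 0) (fun e v s => erefl) _ a3.
  case=> [|m] hm /=.
    rewrite !scaler0 !addr0 add0r /Lcoef big1 ?scaler0 // => i _.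
  rewrite !LcoefE //; last exact: ltnW.
  have [_ /eqP] := hh (ltn0Sn m); rewrite subr_eq => /eqP ->.
  rewrite /prhs (big_ltn (ltn0Sn m)) subn0 /=.
  have -> : \sum_(0 <= j < m) pop j (h (m.+1 - j - 1)%N) = \sum_(0 <= j < m) pop j (h (m - j)%N).
    by apply: eq_bigr => j _; congr (pop _ (h _)); lia.
  rewrite !scaleNr scale1r; ring.
exists B => // e v s; have := hB e v s.
under eq_bigr do rewrite horner0 mulr0.
rewrite big1 // subr0; congr (nm _ <= _); rewrite /feedback.
by field.
Qed.

Lemma nm_2add_ge (x : C) (b : R) : nm x <= b -> 2 - b <= nm (2 + x).
Proof. by move=> hx; have := nm_ge_sub 2 x; rewrite nm_nat; lra. Qed.

Lemma nm_N1sub (v : C) : nm v <= 2 -> nm (-1 - v) <= 3.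
Proof. by move=> hv; rewrite -nmN opprB opprK addrC; exact: nm1v. Qed.

Lemma small_be (e v : C) : small e v -> 61/32 <= nm (be e v) /\ 31/16 <= nm (be' e v).
Proof.
move=> [s1 s2]; have n0 := nm_ge0 e; have m0 := nm_ge0 v.
have h1 : nm (e * (1 + v)) <= 3/32.
  rewrite nmM; apply: le_trans (_ : (1/32) * 3 <= _); last lra.
  by apply: ler_pM; rewrite ?nm_ge0 ?nm1v.
have h2 : nm (e * - v) <= 1/16.
  rewrite nmM nmN; apply: le_trans (_ : (1/32) * 2 <= _); last lra.
  by apply: ler_pM; rewrite ?nm_ge0.
by split; [have := nm_2add_ge h1|have := nm_2add_ge h2]; rewrite /be /be'; lra.
Qed.

Lemma nm_div_le (x y : C) (a b c : R) : nm x <= a -> 0 < b -> b <= nm y -> a <= c * b -> 0 <= c ->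
  nm (x / y) <= c.
Proof.
move=> hx b0 hy hc c0; rewrite nmM nmV ler_pdivrMr; last exact: lt_le_trans hy.
by apply: le_trans hx _; apply: le_trans hc _; rewrite ler_wpM2l.
Qed.

Lemma small_args (e v : C) : small e v -> nm (v / be e v) <= 2 /\ nm ((-1 - v) / be' e v) <= 2.
Proof.
move=> s; have [h1 h2] := small_be s; have [_ s2] := s.
split; first by apply: (nm_div_le s2 _ h1); lra.
by apply: (nm_div_le (nm_N1sub s2) _ h2); lra.
Qed.

(** At [e = 0] the factor is [1/4 + 1/4]; for [|e| <= 1/32] it remains below
    [(65/64) (2/7 + 2/7) < 3/5]. *)
Lemma feedback_contracts (g : C -> C) (M : R) e v : small e v -> (forall w, nm w <= 2 -> nm (g w) <= M) ->
  nm (feedback g e v) <= 3/5 * M.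
Proof.
move=> s hg; have [h1 h2] := small_be s; have [a1 a2] := small_args s.
have M0 : 0 <= M by apply: le_trans (hg 0 _); rewrite ?nm_ge0 // nm0.
have sq (y x : C) (b c : R) : 0 < b -> b <= nm y -> nm x <= M -> 1 <= c * b ^+ 2 ->
    0 <= c -> nm (y ^- 2 * x) <= c * M.
  move=> b0 hy hx hc c0; rewrite nmM nmV nmX; apply: ler_pM; rewrite ?nm_ge0 //.
    by rewrite invr_ge0 exprn_ge0 // nm_ge0.
  have y0 : 0 < nm y by exact: lt_le_trans hy.
  rewrite -[X in X <= _]mul1r ler_pdivrMr ?exprn_gt0 //.
  apply: le_trans hc _; rewrite ler_wpM2l // lerXn2r ?nnegrE //; exact: ltW.
have f1 := sq _ _ (61/32) (2/7) _ h1 (hg _ a1) _ _.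
have f2 := sq _ _ (31/16) (2/7) _ h2 (hg _ a2) _ _.
have L : nm (Lhat g e v) <= (2/7 + 2/7) * M.
  rewrite mulrDl; apply: le_trans (nm_le_sub _ _) _; apply: lerD.
    by apply: f1; rewrite ?expr2; lra.
  by apply: f2; rewrite ?expr2; lra.
have E : nm (1 + e / 2) <= 65/64.
  have := nm_le_add 1 (e / 2); rewrite nm1 nmM nmV nm_nat; have [s1 _] := s; lra.
rewrite /feedback nmM; apply: (@le_trans _ _ (65/64 * ((2/7 + 2/7) * M))).
  by apply: ler_pM; rewrite ?nm_ge0.
by rewrite mulrA ler_wpM2r //; lra.
Qed.

Lemma Lhat_sub (g1 g2 : C -> C) e v : Lhat (fun w => g1 w - g2 w) e v = Lhat g1 e v - Lhat g2 e v.
Proof. rewrite /Lhat; ring. Qed.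

End residual.

(** * The averages near [e = 0] *)

Section limit.
Variable R : realType.
Local Notation C := (Cplx R).
Local Notation frac := ({poly C} * {poly C})%type.
Implicit Types (e v z : C).

Definition swap (a : frac) : frac := (a.2, a.1).

Lemma swap_step1 a : swap (step1 a) = step2 (swap a).
Proof. by rewrite /swap /step1 /step2 /= [a.1 + _]addrC. Qed.

Lemma swap_step2 a : swap (step2 a) = step1 (swap a).
Proof. by rewrite /swap /step1 /step2 /= [a.1 + _]addrC. Qed.

(** Inversion exchanges the two branches, so the set of points at each level is invariant under
    [x -> 1/x]. *)
Lemma sum_tree_swap (V : nmodType) (F : frac -> V) N :
  \sum_(a <- tree R N) F (swap a) = \sum_(a <- tree R N) F a.
Proof.
elim: N F => [|N IH] F; first by rewrite !big_seq1.
rewrite !sum_treeS -(IH (fun a => F (step1 a) + F (step2 a))).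
by apply: eq_bigr => a _; rewrite swap_step1 swap_step2 addrC.
Qed.

Lemma swapK : involutive swap.
Proof. by case. Qed.

Lemma mem_swap a N : (swap a \in tree R N) = (a \in tree R N).
Proof.
have H b : b \in tree R N -> swap b \in tree R N; last first.
  by apply/idP/idP => [/H|]; [rewrite swapK|exact: H].
elim: N b => [|N IH] b; first by rewrite !inE => /eqP ->.
rewrite /= !mem_cat => /orP[] /mapP[c cN ->].
  by rewrite swap_step1 [X in _ || X]map_f ?orbT // IH.
by rewrite swap_step2 map_f // IH.
Qed.

Lemma val_swap a e : val (swap a) e = (val a e)^-1.
Proof. by rewrite /val /= invfM invrK mulrC. Qed.

Lemma size_tree N : size (tree R N) = (2 ^ N)%N.
Proof. by elim: N => // N IH; rewrite /= size_cat !size_map IH expnS mul2n addnn. Qed.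

Lemma sum_tree_const (c : C) N : \sum_(a <- tree R N) c = 2 ^+ N * c.
Proof. by rewrite big_const_seq count_predT iter_addr_0 size_tree -[LHS]mulr_natl natrX. Qed.

Lemma near1_ge (x : C) : nm (x - 1) <= 1/8 -> 15/8 <= nm (x + 1) /\ nm x <= 9/8 /\ x != 0.
Proof.
move=> hx; have -> : x + 1 = 2 + (x - 1) by ring.
have h1 := nm_ge_sub 2 (x - 1); rewrite nm_nat in h1.
have h2 := nm_le_add 1 (x - 1); have h3 := nm_ge_sub 1 (x - 1).
rewrite nm1 [1 + _]addrC subrK in h2 h3.
split; first lra; split; first lra.
by rewrite -nm_gt0; lra.
Qed.

(** Both maps move 1 by [O(e)] and contract near it; the bound [4 |e|] is preserved, as
    [5 / (63/32)] and [(41/8) / (15/8)] are below 4. *)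
Lemma tree_near1 e N a : nm e <= 1/32 -> a \in tree R N -> nm (val a e - 1) <= 4 * nm e.
Proof.
move=> he; have e1 : nm e < 1 by lra.
have e0 := nm_ge0 e; elim: N a => [|N IH] a.
  by rewrite inE => /eqP ->; rewrite /val /= !hornerC divr1 subrr nm0; lra.
have p0 := eps_neqN2 e1; have p1 : 63/32 <= nm (2 + e) by have := nm_ge_sub 2 e; rewrite nm_nat; lra.
rewrite /= mem_cat => /orP[] /mapP[b bN ->]; have [_ q0 _] := regular_tree e1 bN.
  rewrite val_step1 //; have -> : (val b e + 1) / (2 + e) - 1 = (val b e - 1 - e) / (2 + e) by field.
  have hb := IH b bN; have h := nm_le_sub (val b e - 1) e.
  by apply: (@nm_div_le _ _ _ (5 * nm e) (63/32)) => //; lra.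
rewrite val_step2 //; have hb := IH b bN.
have [x1 [x2 x0]] : 15/8 <= nm (val b e + 1) /\ nm (val b e) <= 9/8 /\ val b e != 0.
  by apply: near1_ge; lra.
have s0 : val b e + 1 != 0 by rewrite -nm_gt0; lra.
have -> : (2 + e) * val b e / (val b e + 1) - 1 = (val b e - 1 + e * val b e) / (val b e + 1) by field.
have h := nm_le_add (val b e - 1) (e * val b e); rewrite nmM in h.
have h2 : nm e * nm (val b e) <= nm e * (9/8) by rewrite ler_wpM2l.
by apply: (@nm_div_le _ _ _ (41/8 * nm e) (15/8)) => //; lra.
Qed.

(* [1 / (x + 1 - z) = - v + v ^ 2 phi v x] for [v = 1 / (z - 2)]. *)
Definition phi v (x : C) : C := - (x - 1) / (1 - v * (x - 1)).

Lemma phi_den v (x : C) : nm v <= 3 -> nm (x - 1) <= 1/8 -> 1 - v * (x - 1) != 0.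
Proof.
move=> hv hx; have h : nm (v * (x - 1)) <= 3 * (1/8) by rewrite nmM ler_pM ?nm_ge0.
by rewrite -nm_gt0; have := nm_ge_sub 1 (- (v * (x - 1))); rewrite nm1 nmN; lra.
Qed.

Lemma phi_inv v (x : C) : nm v <= 2 -> nm (x - 1) <= 1/8 -> phi v x^-1 = - phi (-1 - v) x.
Proof.
move=> hv hx; have [_ [_ x0]] := near1_ge hx.
have d := phi_den (nm_N1sub hv) hx.
rewrite /phi; have E : 1 - v * (x^-1 - 1) = (1 - (-1 - v) * (x - 1)) / x by field.
rewrite E; move: (1 - _) d => d d0; field.
by rewrite x0 d0.
Qed.

(** As [T1] is affine, it acts on [1 / (x + 1 - z)] by replacing [z] with [(2 + e) (z - 1)], that is
    [v] with [v / be], up to a factor. *)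
Lemma phi_step v e (x : C) : 2 + e != 0 -> 2 + e * (1 + v) != 0 ->
  1 - v / (2 + e * (1 + v)) * (x - 1) != 0 ->
  phi v ((x + 1) / (2 + e)) = e / (2 + e * (1 + v)) +
    (2 + e) * ((2 + e * (1 + v)) ^- 2 * phi (v / (2 + e * (1 + v))) x).
Proof.
rewrite /phi; set b := 2 + e * (1 + v) => p0 b0 d0.
have pE : 2 + e = b - e * v by rewrite /b; ring.
have E3 : (x + 1) / (2 + e) - 1 = (x - 1 - e) / (2 + e) by field.
move: p0; rewrite E3 {E3} pE; clearbody b => p0.
have E1 : 1 - v * ((x - 1 - e) / (b - e * v)) = (b - v * (x - 1)) / (b - e * v) by field.
have E2 : 1 - v / b * (x - 1) = (b - v * (x - 1)) / b by field.
have d1 : b - v * (x - 1) != 0.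
  by move: d0; rewrite E2 mulf_eq0 negb_or => /andP[].
by rewrite E1 E2; field; rewrite p0 b0 d1.
Qed.

Definition havg N e v : C := 2 ^- N * \sum_(a <- tree R N) phi v (val a e).

Lemma favgE N z e : nm e <= 1/32 -> nm z <= 3/4 ->
  favg N z e = - (z - 2)^-1 + (z - 2)^-1 ^+ 2 * havg N e (z - 2)^-1.
Proof.
move=> he hz; have e1 : nm e < 1 by lra.
have y0 : z - 2 != 0.
  by rewrite -nm_gt0 -nmN opprB; have := nm_ge_sub 2 (- z); rewrite nm_nat nmN; lra.
have t0 : (2 : C) ^+ N != 0 by rewrite expf_neq0 // pnatr_eq0.
rewrite /favg /havg mulrCA -[- (z - 2)^-1](mulKf t0).
rewrite -mulrDr; congr (_ * _); rewrite -sum_tree_const mulr_sumr -big_split /=.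
rewrite big_seq [RHS]big_seq; apply: eq_bigr => a aN.
have [p0 q0 ga] := regular_tree e1 aN.
have D0 := den_neq0 e1 hz (regular_tree e1 aN).
have d0 : val a e + 1 - z != 0 by move: D0; rewrite den_val // mulf_eq0 negb_or => /andP[].
rewrite /phi; have -> : 1 - (z - 2)^-1 * (val a e - 1) = - (val a e + 1 - z) / (z - 2) by field.
by field; rewrite y0.
Qed.

(** The [T1] half comes from [phi_step]. By the symmetry of the tree and [phi_inv], the [T2] half is
    minus the [T1] half at [-1 - v], which accounts for the antisymmetric shape of [Lhat]. *)
Lemma havgS N e v : small e v ->
  havg N.+1 e v = srcf e v / 2 + feedback (havg N e) e v.
Proof.
move=> s; have [he hv] := s; have e1 : nm e < 1 by lra.
have p0 := eps_neqN2 e1; have [b1 b2] := small_be s; have [w1 w2] := small_args s.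
have b0 : be e v != 0 by rewrite -nm_gt0; lra.
have b0' : be' e v != 0 by rewrite -nm_gt0; lra.
have sz := size_tree N.
pose A := \sum_(a <- tree R N) phi (v / be e v) (val a e).
pose B := \sum_(a <- tree R N) phi ((-1 - v) / be' e v) (val a e).
have H : \sum_(a <- tree R N.+1) phi v (val a e) =
    2 ^+ N * (e / be e v - e / be' e v) + (2 + e) * (be e v ^- 2 * A - be' e v ^- 2 * B).
  rewrite sum_treeS big_split /=.
  have -> : \sum_(a <- tree R N) phi v (val (step2 a) e) =
      - \sum_(a <- tree R N) phi (-1 - v) (val (step1 (swap a)) e).
    rewrite -sumrN big_seq [RHS]big_seq; apply: eq_bigr => a aN.
    have aS : step1 (swap a) \in tree R N.+1 by rewrite /= mem_cat map_f // mem_swap.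
    rewrite -[a in LHS]swapK -swap_step1 val_swap phi_inv //.
    by have := tree_near1 he aS; lra.
  rewrite (sum_tree_swap (fun a => phi (-1 - v) (val (step1 a) e))).
  rewrite mulrBr -!sum_tree_const !mulrBr !mulr_sumr addrACA -!sumrN -!big_split /=.
  rewrite big_seq [RHS]big_seq; apply: eq_bigr => a aN.
  have [_ q0 _] := regular_tree e1 aN; rewrite val_step1 //.
  have x1 : nm (val a e - 1) <= 1/8 by have := tree_near1 he aN; lra.
  have bE : 2 + e * (1 + (-1 - v)) = be' e v by rewrite /be'; congr (_ + _ * _); ring.
  rewrite (@phi_step v e (val a e) p0 b0); last by apply: phi_den x1; lra.
  rewrite (@phi_step (-1 - v) e (val a e) p0) bE //; last by apply: phi_den x1; lra.
  by rewrite /be; ring.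
rewrite /havg H /feedback /Lhat -/A -/B /srcf.
have t0 : (2 : C) ^+ N != 0 by rewrite expf_neq0 // pnatr_eq0.
rewrite exprS invfM mulrDr -!mulrA [2 ^- N * (2 ^+ N * _)]mulKf //.
move: (be e v ^- 2) (be' e v ^- 2) (be e v)^-1 (be' e v)^-1 => a b c d.
move: (2 ^- N) => t.
by field.
Qed.

Lemma havg0 e v : havg 0 e v = 0.
Proof. by rewrite /havg big_seq1 /phi /val /= !hornerC divr1 subrr oppr0 mul0r mulr0. Qed.

End limit.

(** * Convergence of the iteration and of the Taylor coefficients *)

Section coefficients.
Variable R : realType.
Local Notation C := (Cplx R).
Variable h : nat -> {poly C}.
Hypothesis hh : hsys h.

(** The error at level [N + 1] is [feedback] of the error at level [N] minus the residual; [5/2] is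
    the geometric sum [1 / (1 - 3/5)]. *)
Lemma havg_trunc K : exists B0 B : R, [/\ 0 <= B0, 0 <= B &
  forall N (e v : C), small e v ->
    nm (havg N e v - trunc h K e v) <= (3/5) ^+ N * B0 + 5/2 * (B * nm e ^+ K.+1)].
Proof.
have [B0 b0 hB0] := trunc_bounded h K; have [B b hB] := residual hh K.
exists B0, B; split=> // N; elim: N => [|N IH] e v s.
  rewrite havg0 sub0r nmN expr0 mul1r; have := hB0 e v s.
  have : 0 <= B * nm e ^+ K.+1 by rewrite mulr_ge0 // exprn_ge0 // nm_ge0.
  lra.
have E : havg N.+1 e v - trunc h K e v = feedback (fun w => havg N e w - trunc h K e w) e v
    - (trunc h K e v - (srcf e v / 2 + feedback (trunc h K e) e v)).
  by rewrite havgS // /feedback Lhat_sub; ring.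
rewrite E; apply: le_trans (nm_le_sub _ _) _.
have [s1 _] := s.
have := feedback_contracts s (fun w hw => IH e w (conj s1 hw)).
have := hB e v s; move: (B * _) => X; rewrite (exprS (3/5)) -(mulrA (3/5) _ B0).
move: ((3/5) ^+ N * B0) => Y; lra.
Qed.

End coefficients.

Section coefficients_of_H.
Variable R : realType.
Local Notation C := (Cplx R).
Variable h : nat -> {poly rat}.
Hypothesis hh : hsys h.

Definition Hpoly K (z : C) : {poly C} := \poly_(n < K.+1) Hf h n z.

Lemma Hpoly_eval K (z e : C) :
  (Hpoly K z).[e] = - (z - 2)^-1 + (z - 2)^-1 ^+ 2 * trunc (hC R h) K e (z - 2)^-1.
Proof.
rewrite horner_poly big_ord_recl expr0 mulr1 {1}/Hf /ev /= hornerN hornerX; congr (_ + _).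
rewrite /trunc mulr_sumr; apply: eq_bigr => i _.
by rewrite /Hf /ev /= (hornerM 'X^2) hornerXn mulrCA mulrC.
Qed.

(** Cauchy's estimate on a small circle, for the difference between [favg] and the Taylor polynomial
    with coefficients [H_0, ..., H_n]. *)
Lemma coef_limit (z : C) n (eta : R) : nm z <= 3/4 -> 0 < eta ->
  exists N0, forall N r (c : nat -> C), (N0 <= N)%N -> 1/32 <= r -> pser r c (favg N z) ->
    nm (c n - Hf h n z) <= eta.
Proof.
move=> hz eta0; have hw : nm (z - 2)^-1 <= 4/5.
  rewrite nmV; have : 5/4 <= nm (z - 2).
    by rewrite -nmN opprB; have := nm_ge_sub 2 (- z); rewrite nm_nat nmN; lra.
  move=> h1; have h2 : 0 < nm (z - 2) by lra.
  by rewrite -[_^-1]mul1r ler_pdivrMr //; lra.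
have [B0 [B [b0 b hB]]] := havg_trunc (hsysC R hh) n.
(* On [|e| = s] the residual is of order [s ^ (n + 1)]; this [s] makes its contribution at most half
   of [eta * s ^ n]. The other half is spent on the power of [3/5]. *)
pose s : R := Num.min (1/32) (eta / (5 * (B + 1))).
have s0 : 0 < s by rewrite /s lt_min; apply/andP; split; [lra|rewrite divr_gt0 //; lra].
have s1 : s <= 1/32 by rewrite /s ge_min lexx.
have s2 : B * s <= eta / 5.
  apply: le_trans (_ : (B + 1) * s <= _); first by rewrite ler_wpM2r //; lra.
  rewrite mulrC -ler_pdivlMr; last lra.
  have -> : eta / 5 / (B + 1) = eta / (5 * (B + 1)) by rewrite invfM mulrA.
  by rewrite /s ge_min lexx orbT.
have sn : 0 < s ^+ n by rewrite exprn_gt0.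
have [N0 hN0] : exists N0, forall N, (N0 <= N)%N -> (3/5) ^+ N * B0 <= eta / 2 * s ^+ n.
  have ct : (fun N => (3/5) ^+ N * B0 : R) @ \oo --> (0 : R).
    rewrite -[X in _ --> X](mul0r B0); apply: cvgMl; apply: cvg_expr.
    by rewrite ger0_norm //; lra.
  have p : 0 < eta / 2 * s ^+ n by rewrite mulr_gt0 //; lra.
  move/cvgrPdist_le : ct => /(_ _ p)[N0 _ hN]; exists N0 => N /hN.
  by rewrite /= sub0r normrN; apply: le_trans; exact: ler_norm.
exists N0 => N r c NN hr hc; have r0 : 0 <= r by lra.
have pl := pser_lin 1 (-1) hc (pser_poly (Hpoly n z) r0).
have sr : s <= r by lra.
have bnd e : nm e = s -> nm (1 * favg N z e + -1 * (Hpoly n z).[e]) <= eta * s ^+ n.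
  move=> es; have e32 : nm e <= 1/32 by rewrite es.
  rewrite mul1r mulN1r favgE // Hpoly_eval.
  have -> (x y t u : C) : - x + y * t - (- x + y * u) = y * (t - u) by ring.
  have sm : small e (z - 2)^-1 by split => //; lra.
  have := hB N e _ sm; rewrite nmM nmX; set X := nm (_ - _) => hX.
  have X0 : 0 <= X := nm_ge0 _.
  have w1 : nm (z - 2)^-1 ^+ 2 <= 1 by rewrite exprn_ile1 ?nm_ge0 //; lra.
  apply: le_trans (_ : X <= _); first by rewrite ler_piMl.
  apply: le_trans hX _; rewrite es exprS.
  have := hN0 N NN.
  have : B * (s * s ^+ n) <= eta / 5 * s ^+ n by rewrite mulrA ler_pM2r.
  lra.
have := pser_coef_bound n (ltW s0) sr pl bnd.
by rewrite ler_pM2r // mul1r mulN1r coef_poly ltnSn.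
Qed.

End coefficients_of_H.

(** * The limit e -> -1 *)

Section tails.
Variable R : realType.
Local Notation C := (Cplx R).

(* AM-GM, against the weights [1 / n ^ 2]. *)
Lemma weighted_tail (a : nat -> R) (M lam : R) m K : 0 < lam -> (0 < m)%N ->
  (forall n, 0 <= a n) -> \sum_(n < K) (n%:R * a n) ^+ 2 <= M ->
  \sum_(m <= n < K) a n <= lam * M + lam^-1 / m%:R.
Proof.
move=> l0 m0 a0 hM.
have H k : (m <= k)%N -> (k <= K)%N ->
    \sum_(m <= n < k) a n <= lam * \sum_(n < k) (n%:R * a n) ^+ 2 + lam^-1 * (m%:R^-1 - k%:R^-1).
  move=> mk; elim: k mk => [|k IH] mk kK; first by lia.
  move: mk; rewrite leq_eqVlt => /orP[/eqP <-|mk].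
    rewrite big_geq // subrr mulr0 addr0 mulr_ge0 ?(ltW l0) //.
    by apply: sumr_ge0 => i _; exact: sqr_ge0.
  rewrite big_nat_recr //= big_ord_recr /=.
  have := IH mk (ltnW kK); set S := \sum_(_ <= _ < _) _; set T := \sum_(_ < _) _ => IH'.
  have k0 : (1 <= k)%N by exact: leq_trans m0 mk.
  have k1 : 1 <= k%:R :> R by rewrite ler1n.
  have lV : lam * lam^-1 = 1 by rewrite divff // gt_eqF.
  have lV0 : 0 < lam^-1 by rewrite invr_gt0.
  set x := k%:R in k1 *; have x1 : k.+1%:R = x + 1 :> R by rewrite -natr1.
  have E : x^-1 - (x + 1)^-1 = (x * (x + 1))^-1 by field; apply/andP; split; lra.
  have G : a k <= lam * (x * a k) ^+ 2 + lam^-1 * (x^-1 - k.+1%:R^-1).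
    rewrite x1 E; have x0 : x != 0 by rewrite gt_eqF //; lra.
    have d0 : 0 <= (x * (x + 1))^-1 - (2 * x)^-1 ^+ 2.
      rewrite subr_ge0 exprVn lef_pV2 ?posrE ?exprn_gt0 ?mulr_gt0 //; [|lra..].
      by rewrite exprMn; nra.
    rewrite -subr_ge0.
    have -> : lam * (x * a k) ^+ 2 + lam^-1 * (x * (x + 1))^-1 - a k =
        lam^-1 * ((lam * (x * a k) - (2 * x)^-1) ^+ 2 + ((x * (x + 1))^-1 - (2 * x)^-1 ^+ 2)).
      have lN : lam != 0 by rewrite gt_eqF.
      move: (x * (x + 1))^-1 => y; field; exact/andP.
    by rewrite mulr_ge0 ?(ltW lV0) // addr_ge0 // sqr_ge0.
  have -> : m%:R^-1 - k.+1%:R^-1 = (m%:R^-1 - x^-1) + (x^-1 - k.+1%:R^-1) by rewrite addrA subrK.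
  by rewrite !(mulrDr lam) (mulrDr lam^-1 (_ - x^-1)) addrACA; exact: lerD.
have [mK|Km] := leqP m K; last first.
  rewrite big_geq ?(ltnW Km) // addr_ge0 ?divr_ge0 ?invr_ge0 ?(ltW l0) // mulr_ge0 ?(ltW l0) //.
  by apply: le_trans hM; apply: sumr_ge0 => i _; exact: sqr_ge0.
apply: le_trans (H K mK (leqnn K)) _; apply: lerD; first by rewrite ler_wpM2l ?(ltW l0).
by rewrite ler_wpM2l ?invr_ge0 ?(ltW l0) // gerBl invr_ge0.
Qed.

Lemma uniform_tail (M eta : R) : 0 <= M -> 0 < eta -> exists m, forall (a : nat -> R) K,
  (forall n, 0 <= a n) -> \sum_(n < K) (n%:R * a n) ^+ 2 <= M ->
  \sum_(m <= n < K) a n <= eta.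
Proof.
move=> M0 eta0; pose lam := eta / (2 * (M + 1)).
have l0 : 0 < lam by rewrite divr_gt0 //; lra.
pose m := (Num.bound (lam^-1 * 2 / eta)).+1.
have hm : lam^-1 / m%:R <= eta / 2.
  have : lam^-1 * 2 / eta < (Num.bound (lam^-1 * 2 / eta))%:R.
    by apply: archi_boundP; rewrite !mulr_ge0 ?invr_ge0 ?(ltW l0) ?(ltW eta0).
  rewrite ltr_pdivrMr // => h1; rewrite ler_pdivrMr // /m -(natr1 (Num.bound _)); lra.
exists m => a K a0 hM; apply: le_trans (weighted_tail l0 (ltn0Sn _) a0 hM) _.
have : lam * M <= eta / 2.
  apply: le_trans (_ : lam * (M + 1) <= _); first by rewrite ler_wpM2l ?(ltW l0) //; lra.
  by rewrite /lam invfM mulrA divfK //; lra.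
by rewrite -/m; lra.
Qed.

End tails.

(** * The tree at [e = -1]: positive points and continuity of the averages *)

Section at_minus_one.
Variable R : realType.
Local Notation C := (Cplx R).

Lemma two_subr1 : 2 + -1 = 1 :> C.
Proof. by ring. Qed.

Lemma positive_tree N a : a \in tree R N ->
  exists p q : R, [/\ 0 < p, 0 < q, a.1.[-1] = of_real p & a.2.[-1] = of_real q].
Proof.
elim: N a => [|N IH] a.
  by rewrite inE => /eqP ->; exists 1, 1; split=> //=; rewrite hornerC of_real1.
have X2 (p : {poly C}) : (('X + 2%:P) * p).[-1] = p.[-1].
  by rewrite hornerX2 two_subr1 mul1r.
rewrite /= mem_cat => /orP[] /mapP[b /IH[p [q [p0 q0 E1 E2]]] ->] /=.
  exists (p + q), q; split=> //; first exact: addr_gt0.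
    by rewrite hornerD E1 E2 of_realD.
  by rewrite X2.
exists p, (p + q); split=> //; first exact: addr_gt0; first by rewrite X2.
by rewrite hornerD E1 E2 of_realD.
Qed.

Definition pt (a : {poly C} * {poly C}) : R := re (val a (-1)).

Lemma pt_tree N a : a \in tree R N -> [/\ 0 < pt a, val a (-1) = of_real (pt a) & a.2.[-1] != 0].
Proof.
move=> /positive_tree[p [q [p0 q0 E1 E2]]].
have E : val a (-1) = of_real (p / q) by rewrite /val E1 E2 of_realM of_realV.
rewrite /pt E re_of_real; split=> //; first by rewrite divr_gt0.
by rewrite E2 -nm_gt0 nm_of_real normr_gt0 gt_eqF.
Qed.

Lemma pt_step1 N a : a \in tree R N -> pt (step1 a) = pt a + 1.
Proof.
move=> /pt_tree[p0 pE q0]; rewrite {1}/pt val_step1 //.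
by rewrite two_subr1 divr1 reD re1.
Qed.

Lemma pt_step2 N a : a \in tree R N -> pt (step2 a) = pt a / (pt a + 1).
Proof.
move=> /pt_tree[p0 pE q0]; rewrite {1}/pt val_step2 //.
by rewrite two_subr1 mul1r pE -of_real1 -of_realD -of_realV -of_realM.
Qed.

Lemma den_neq0_at_N1 N a z : nm z <= 3/4 -> a \in tree R N -> (den z a).[-1] != 0.
Proof.
move=> hz /pt_tree[p0 pE q0]; rewrite den_val // mulf_neq0 // pE -nm_gt0.
rewrite -of_real1 -of_realD.
have := nm_ge_sub (of_real (pt a + 1)) (- z); rewrite nm_of_real ger0_norm ?nmN; lra.
Qed.

Lemma horner_cvgC (p : {poly C}) (T : Type) (F : set_system T) (FF : Filter F) (f : T -> C) (e : C) :
  f @ F --> e -> p.[f x] @[x --> F] --> p.[e].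
Proof.
move=> fe; elim/poly_ind: p => [|p a IH].
  have -> : (fun x => (0 : {poly C}).[f x]) = cst 0 by apply/funext => x; rewrite horner0.
  by rewrite horner0; exact: cvg_cst.
have -> : (fun x => (p * 'X + a%:P).[f x]) = (fun x => p.[f x] * f x + a).
  by apply/funext => x; rewrite hornerMXaddC.
rewrite hornerMXaddC.
apply: cvgD; last exact: cvg_cst.
exact: cvgM.
Qed.

Lemma sum_frac_cvgC (I : eqType) (s : seq I) (k : C) (P Q : I -> {poly C})
    (T : Type) (F : set_system T) (FF : Filter F) (f : T -> C) (e : C) :
  f @ F --> e -> (forall i, i \in s -> (Q i).[e] != 0) ->
  k * (\sum_(i <- s) (P i).[f x] / (Q i).[f x]) @[x --> F] --> k * \sum_(i <- s) (P i).[e] / (Q i).[e].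
Proof.
move=> fe hQ; apply: cvgM; first exact: cvg_cst.
elim: s hQ => [|i s IH] hQ.
  have -> : (fun x => \sum_(i <- [::]) (P i).[f x] / (Q i).[f x]) = cst 0 by apply/funext => x; rewrite big_nil.
  by rewrite big_nil; exact: cvg_cst.
have -> : (fun x => \sum_(i <- i :: s) (P i).[f x] / (Q i).[f x]) =
   (fun x => (P i).[f x] / (Q i).[f x] + \sum_(i <- s) (P i).[f x] / (Q i).[f x]).
  by apply/funext => x; rewrite big_cons.
rewrite big_cons; apply: cvgD; last by apply: IH => j js; apply: hQ; rewrite inE js orbT.
apply: cvgM; first exact: horner_cvgC.
by apply: cvgV; [exact: hQ (mem_head _ _)|exact: horner_cvgC].
Qed.

Lemma favg_cvg_N1 N z (eta : R) : nm z <= 3/4 -> 0 < eta ->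
  exists2 r0 : R, r0 < 1 & forall r, r0 <= r -> r < 1 -> 0 <= r ->
    nm (favg N z (of_real (- r)) - favg N z (-1)) <= eta.
Proof.
move=> hz eta0.
pose g (e : C) := 2 ^- N * \sum_(a <- tree R N) (a.2.[e] / (den z a).[e]).
have gE (e : C) : (nm e < 1 \/ e = -1) -> favg N z e = g e.
  move=> he; rewrite /favg /g; congr (_ * _); rewrite big_seq [RHS]big_seq; apply: eq_bigr => a aN.
  have [q0 d0] : a.2.[e] != 0 /\ (den z a).[e] != 0.
    case: he => [e1|->].
      by split; [have [] := regular_tree e1 aN|exact: den_neq0 (regular_tree e1 aN)].
    by split; [have [] := pt_tree aN|exact: den_neq0_at_N1 aN].
  by move: d0; rewrite den_val // mulf_eq0 negb_or => /andP[d0 _]; field; rewrite q0 d0.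
have gc : g e @[e --> (-1 : C)] --> g (-1).
  have H := @sum_frac_cvgC _ (tree R N) (2 ^- N) (fun a => a.2) (den z) C _ (nbhs_filter (-1 : C)) id (-1) cvg_id.
  by apply: H => a aN; exact: den_neq0_at_N1 aN.
have eta0' : 0 < of_real eta by rewrite /of_real ltcR.
move/cvgrPdist_le : gc => /(_ _ eta0') /nm_near[s s0 hs].
exists (1 - s / 2); first lra.
move=> r r1 r2 r3; rewrite !gE; [|by right|by left; rewrite nm_of_real normrN ger0_norm].
rewrite -ler_norm_nm distrC; apply: hs; rewrite -of_real1 -!of_realN -of_realD nm_of_real ler0_norm; lra.
Qed.

End at_minus_one.

(** * Interchange of the limits in [N], in [e] and in the series *)

Section at_minus_one_limit.
Variable R : realType.
Local Notation C := (Cplx R).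
Variable h : nat -> {poly rat}.
Hypothesis hh : hsys h.
Variable z : C.
Hypothesis hz : nm z <= 3/4.
Local Notation H := (fun n => Hf h n z).

Lemma coef_limit_seq K (delta : R) : 0 < delta -> exists N0, forall N r (c : nat -> C),
  (N0 <= N)%N -> 1/32 <= r -> pser r c (favg N z) -> forall n, (n < K)%N -> nm (c n - H n) <= delta.
Proof.
move=> d0; elim: K => [|K [N1 h1]]; first by exists 0%N.
have [N2 h2] := coef_limit hh K hz d0; exists (maxn N1 N2) => N r c.
rewrite geq_max => /andP[n1 n2] hr hc n; rewrite ltnS leq_eqVlt => /orP[/eqP ->|nK].
  exact: h2 n2 hr hc.
exact: h1 n1 hr hc n nK.
Qed.

Lemma le_of_radius (x y A : R) : 0 <= A ->
  (forall eta, 0 < eta -> exists2 r0, r0 < 1 & forall r, r0 <= r -> 31/32 <= r -> r < 1 ->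
     x <= y + A * (1 - r) + eta) -> x <= y.
Proof.
move=> A0 hr; apply: le_of_eps => eta e0.
have e2 : 0 < eta / 2 by lra.
have [r0 r01 hr0] := hr _ e2.
pose t : R := Num.min (1 - r0) (Num.min (1/32) (eta / 2 / (A + 1))).
have t0 : 0 < t.
  by rewrite /t !lt_min; apply/andP; split; [lra|apply/andP; split; [lra|rewrite divr_gt0 //; lra]].
have t1 : t <= 1 - r0 by rewrite /t ge_min lexx.
have t2 : t <= 1/32 by rewrite /t !ge_min lexx orbT.
have t3 : t * (A + 1) <= eta / 2 by rewrite -ler_pdivlMr; [rewrite /t !ge_min lexx !orbT|lra].
have := hr0 (1 - t); rewrite subKr => h1; apply: le_trans (h1 _ _ _) _; nra.
Qed.

Lemma bernoulli (r : R) n : 0 <= r -> r <= 1 -> 1 - r ^+ n <= n%:R * (1 - r).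
Proof.
move=> r0 r1; elim: n => [|n IH]; first by rewrite expr0 subrr mul0r.
have p0 : 0 <= r ^+ n by rewrite exprn_ge0.
have p1 : r ^+ n <= 1 by rewrite exprn_ile1.
rewrite exprS -natr1; move: (r ^+ n) (n%:R) IH p0 p1 => x y; nra.
Qed.

(* The tails of [\sum_n |c n| r ^ n] are small uniformly in [N] and [r], by
   the bound on [f'] in mean square. *)
Lemma H_tail (eta : R) : 0 < eta -> exists m, forall K, (m <= K)%N ->
  (\sum_(m <= n < K) nm (H n) <= eta) /\
  exists N0, forall N, (N0 <= N)%N ->
    nm (favg N z (-1) - \sum_(n < K) (-1) ^+ n * H n) <= eta.
Proof.
move=> eta0; have e2 : 0 < eta / 2 by lra.
have [M [M0 FP]] : exists M : R, 0 <= M /\ forall N r, 0 < r -> r < 1 -> exists c, pser r c (favg N z) /\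
    forall K, \sum_(n < K) (n%:R * nm (c n) * r ^+ n) ^+ 2 <= M.
  by exists ((25 * 7744) ^+ 2); split=> [|N r r0 r1]; [exact: sqr_ge0|exact: favg_pser].
(* The order of choices matters: [m] depends on [eta] only, [delta] and [N0] then depend on [K], and
   [r] tends to 1 last. *)
have [m hm] := uniform_tail M0 e2.
exists m => K mK.
pose S := \sum_(n < K) nm (H n).
have S0 : 0 <= S by apply: sumr_ge0 => n _; exact: nm_ge0.
have tail r (c : nat -> C) J : 0 <= r ->
    (forall K, \sum_(n < K) (n%:R * nm (c n) * r ^+ n) ^+ 2 <= M) ->
    \sum_(m <= n < J) nm (c n) * r ^+ n <= eta / 2.
  move=> r0 hc; apply: (hm (fun n => nm (c n) * r ^+ n)).
    by move=> n; rewrite mulr_ge0 ?nm_ge0 ?exprn_ge0.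
  by under eq_bigr do rewrite mulrA; exact: hc.
have mS : \sum_(m <= n < K) nm (H n) <= S.
  rewrite /S -(big_mkord xpredT (fun n => nm (H n))) (big_cat_nat (leq0n m) mK) /=.
  by rewrite lerDr; apply: sumr_ge0 => n _; exact: nm_ge0.
have K0 : 0 <= K%:R :> R by exact: ler0n.
pose delta := eta / 2 / (K%:R + 1).
have d0 : 0 < delta by rewrite divr_gt0 //; lra.
have dK : K%:R * delta <= eta / 2.
  apply: le_trans (_ : (K%:R + 1) * delta <= _); first by rewrite ler_wpM2r ?(ltW d0) //; lra.
  by rewrite mulrC /delta divfK // gt_eqF //; lra.
have A0 : 0 <= S * K%:R by rewrite mulr_ge0.
have [N0 hN0] := coef_limit_seq K d0.
have SE : \sum_(n < K) nm (H n) = S by [].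
clearbody delta S.
have rad (r : R) n : 31/32 <= r -> r < 1 -> (n < K)%N -> 0 <= 1 - r ^+ n <= K%:R * (1 - r).
  move=> r1 r2 nK; have r0 : 0 <= r by lra.
  rewrite subr_ge0 exprn_ile1 ?(ltW r2) //=.
  apply: le_trans (bernoulli n r0 (ltW r2)) _; rewrite ler_wpM2r ?subr_ge0 ?(ltW r2) //.
  by rewrite ler_nat ltnW.
split.
  apply: (le_of_radius A0) => eta' e'; exists 0 => // r _ r1 r2.
  have r0 : 0 < r by lra.
  have [c [hc sc]] := FP N0 r r0 r2.
  have := tail r c K (ltW r0) sc.
  have r32 : 1/32 <= r by lra.
  have hd := hN0 N0 r c (leqnn _) r32 hc.
  (* Termwise [|H_n| <= |c_n| r ^ n + |c_n - H_n| r ^ n + |H_n| (1 - r ^ n)]. *)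
  have : \sum_(m <= n < K) nm (H n) <= \sum_(m <= n < K) (nm (c n) * r ^+ n + delta + nm (H n) * (K%:R * (1 - r))).
    rewrite big_nat [leRHS]big_nat; apply: ler_sum => n /andP[_ nK].
    have /andP[q1 q2] := rad r n r1 r2 nK.
    have p0 : 0 <= r ^+ n by rewrite exprn_ge0 ?(ltW r0).
    have := hd n nK; have := nm_le_sub (c n) (c n - H n); rewrite subKr => g1 g2.
    have g3 : nm (H n) <= nm (c n) + delta by lra.
    have := ler_wpM2r p0 g3; have := ler_wpM2l (nm_ge0 (H n)) q2.
    have g4 : delta * r ^+ n <= delta by rewrite ler_piMr ?(ltW d0) //; lra.
    rewrite mulrDl mulrBr mulr1; lra.
  rewrite !big_split /= -mulr_suml sumr_const_nat.
  have : delta *+ (K - m) <= K%:R * delta.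
    by rewrite -mulr_natl ler_wpM2r ?(ltW d0) // ler_nat leq_subr.
  have kr : 0 <= K%:R * (1 - r) by rewrite mulr_ge0 //; lra.
  move=> g1; have g2 := ler_wpM2r kr mS; rewrite -(mulrA S); lra.
exists N0 => N NN; apply: (le_of_radius A0) => eta' e'.
have [r0 r01 hr0] := favg_cvg_N1 N hz e'.
exists r0 => // r r0r r1 r2.
have rp : 0 < r by lra.
have [c [hc sc]] := FP N r rp r2.
have r32 : 1/32 <= r by lra.
have hd := hN0 N r c NN r32 hc.
have h1 := hr0 r r0r r2 (ltW rp).
pose e : C := of_real (- r).
have er : nm e = r by rewrite nm_of_real normrN gtr0_norm.
(* The remainder [B * th ^ J] depends on [N] and [r] and only serves to reach some large [J]; the
   part between [K] and [J] is covered by the uniform tail. *)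
have h2 : nm (favg N z e - psum c K e) <= eta / 2.
  have [B [th [B0 th0 th1 _ hB]]] := hc.
  apply: le_of_eps => eta2 e2'.
  have [J [KJ hJ]] : exists J, (K <= J)%N /\ B * th ^+ J <= eta2.
    have ct : (fun J => B * th ^+ J) @ \oo --> (0 : R).
      by rewrite -[X in _ --> X](mulr0 B); apply: cvgMr; apply: cvg_expr; rewrite ger0_norm ?(ltW th0).
    move/cvgrPdist_le : ct => /(_ _ e2')[J _ hJ]; exists (maxn K J); split; first exact: leq_maxl.
    have := hJ (maxn K J) (leq_maxr _ _); rewrite /= sub0r normrN; apply: le_trans; exact: ler_norm.
  have := hB e J; rewrite er lexx => /(_ isT) hBJ.
  have := tail r c J (ltW rp) sc; rewrite (big_cat_nat mK KJ) /= => tJ.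
  have t1 : 0 <= \sum_(m <= n < K) nm (c n) * r ^+ n.
    by apply: sumr_ge0 => n _; rewrite mulr_ge0 ?nm_ge0 // exprn_ge0 ?(ltW rp).
  have t2 : nm (psum c J e - psum c K e) <= \sum_(K <= n < J) nm (c n) * r ^+ n.
    rewrite /psum -!(big_mkord xpredT (fun n => c n * e ^+ n)) (big_cat_nat (leq0n K) KJ) /=.
    rewrite addrAC subrr add0r; apply: le_trans (nm_sum _ _ _) _.
    by apply: ler_sum => n _; rewrite nmM nmX er.
  have := nm_le_add (favg N z e - psum c J e) (psum c J e - psum c K e).
  rewrite addrA subrK; lra.
have h3 : nm (psum c K e - \sum_(n < K) (-1) ^+ n * H n) <= K%:R * delta + S * K%:R * (1 - r).
  rewrite /psum -sumrB; apply: le_trans (nm_sum _ _ _) _.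
  have -> : K%:R * delta + S * K%:R * (1 - r) = \sum_(n < K) (delta + nm (H n) * (K%:R * (1 - r))).
    by rewrite big_split /= -mulr_suml SE sumr_const card_ord -[delta *+ K]mulr_natl -(mulrA S).
  apply: ler_sum => n _.
  have /andP[q1 q2] := rad r n r1 r2 (ltn_ord n).
  have p0 : 0 <= r ^+ n by rewrite exprn_ge0 ?(ltW rp).
  have -> : c n * e ^+ n - (-1) ^+ n * H n = (-1) ^+ n * ((c n - H n) * of_real (r ^+ n) - H n * of_real (1 - r ^+ n)).
    rewrite /e of_realN (exprNn (of_real r)) -of_realX of_realD of_real1 of_realN; ring.
  rewrite nmM nmX nmN nm1 expr1n mul1r; apply: le_trans (nm_le_sub _ _) _; apply: lerD.
    rewrite nmM nm_of_real ger0_norm //; apply: le_trans (_ : delta * 1 <= _); last by rewrite mulr1.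
    by apply: ler_pM; rewrite ?nm_ge0 ?hd //; lra.
  by rewrite nmM nm_of_real ger0_norm // ler_wpM2l ?nm_ge0.
(* From [favg] at [-1] to its value at [-r], to the partial sum there, to the sum with the [H_n]. *)
have := nm_le_add (favg N z (-1) - favg N z e) (favg N z e - psum c K e).
have := nm_le_add (favg N z (-1) - psum c K e) (psum c K e - \sum_(n < K) (-1) ^+ n * H n).
rewrite !addrA !subrK.
have : nm (favg N z (-1) - favg N z e) <= eta' by rewrite -nmN opprB.
lra.
Qed.

End at_minus_one_limit.

(** * The question mark measure *)

Section stieltjes.
Variable R : realType.
Implicit Types (x y : R).

Lemma qq_addr1 x : 0 <= x -> qq (x + 1) = qq x / 2.
Proof.
move=> x0; have [->|[v v1 ->]] := cf_cases x0.
  by rewrite natr1 !qq_nat halfS.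
by rewrite addrAC natr1 !qqS // halfS mulrAC.
Qed.

Lemma qq_inv x : 0 < x -> qq x^-1 = 1 - qq x.
Proof.
have H (v : R) : 1 < v -> qq v^-1 = 1 - qq v.
  by move=> v1; have := qqS 0 v1; rewrite add0r expr0 invr1 mul1r.
move=> x0; have [x1|x1|->] := ltgtP x 1; [|exact: H|].
  have := H x^-1; rewrite invf_gt1 // invrK => /(_ x1) ->; ring.
by rewrite invr1 (qq_nat R 1) expr1; lra.
Qed.

Lemma qq_divr x : 0 <= x -> qq (x / (x + 1)) = (1 + qq x) / 2.
Proof.
rewrite le_eqVlt => /orP[/eqP <-|x0].
  by rewrite mul0r (qq_nat R 0) expr0 invr1; lra.
have E : x / (x + 1) = (x^-1 + 1)^-1 by field; rewrite !gt_eqF //=; lra.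
have x0' : 0 < x^-1 by rewrite invr_gt0.
by rewrite E qq_inv ?qq_addr1 ?qq_inv //; lra.
Qed.

Lemma qq_addn x n : 0 <= x -> qq (x + n%:R) = 2 ^- n * qq x.
Proof.
move=> x0; elim: n => [|n IH]; first by rewrite addr0 expr0 invr1 mul1r.
rewrite -natr1 addrA qq_addr1 ?IH; last by rewrite addr_ge0.
by rewrite halfS mulrAC.
Qed.

Local Notation mu := (@dqmark R).

Lemma dqmark_oc (a b : R) : a <= b -> mu `]a, b]%classic = (qmark b - qmark a)%:E.
Proof.
move=> ab; rewrite /dqmark /= /lebesgue_stieltjes_measure /measure_extension measurable_mu_extE /=; last exact: is_ocitv.
by rewrite wlength_itv_bnd.
Qed.

Lemma dqmark_oy (a : R) : 0 <= a -> mu `]a, +oo[%classic = (qq a)%:E.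
Proof.
move=> a0; pose I n : set R := `]a, a + n%:R]%classic.
have E : `]a, +oo[%classic = \bigcup_n I n.
  apply/seteqP; split=> x /=; rewrite /I /= ?in_itv /= ?andbT.
    move=> ax; exists (Num.bound (x - a)) => //=; rewrite in_itv /= ax /=.
    have : 0 <= x - a by lra.
    by move=> /archi_boundP; lra.
  by move=> [n _] /=; rewrite in_itv /= => /andP[].
have c1 : (mu \o I) n @[n --> \oo] --> (qq a)%:E.
  have -> : mu \o I = (fun n => (qq a - 2 ^- n * qq a)%:E).
    apply/funext => n /=; rewrite /I dqmark_oc ?lerDl //.
    by rewrite !qmarkE ?addr_ge0 // qq_addn //; congr (_%:E); ring.
  apply: cvg_EFin; first by near=> F.
  rewrite -[X in _ --> X]subr0; apply: cvgB; first exact: cvg_cst.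
  rewrite -[X in _ --> X](mul0r (qq a)); apply: cvgMl.
  under eq_fun do rewrite -exprVn; apply: cvg_expr.
  by rewrite ger0_norm ?invr_ge0 //; lra.
rewrite E; have : (mu \o I) n @[n --> \oo] --> mu (\bigcup_n I n).
  apply: nondecreasing_cvg_mu; rewrite /I //; first exact: bigcup_measurable.
  by move=> n m nm; apply/subsetPset/subset_itv; rewrite leBSide //= lerD2l ler_nat.
by move=> c2; apply: (cvg_unique _ c2 c1).
Unshelve. all: end_near. Qed.

(* [1 - qmark] in the coordinate [y = 1 / (x + 1)], which maps [0, +oo] to [0, 1];
   [s1] and [s2] are [T1] and [T2] at [e = -1] in this coordinate. *)
Definition PHI y : R := if y == 0 then 0 else qq (y^-1 - 1).

Lemma PHI0 : PHI 0 = 0. Proof. by rewrite /PHI eqxx. Qed.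
Lemma PHI1 : PHI 1 = 1.
Proof. by rewrite /PHI oner_eq0 invr1 subrr (qq_nat R 0) expr0 invr1. Qed.

Definition s1 y : R := y / (1 + y).
Definition s2 y : R := (2 - y)^-1.

Lemma PHI_s1 y : 0 <= y -> y <= 1 -> PHI (s1 y) = PHI y / 2.
Proof.
rewrite le_eqVlt => /orP[/eqP <-|y0] y1; first by rewrite /s1 mul0r PHI0 mul0r.
have yN : y != 0 by rewrite gt_eqF.
have y1N : 1 + y != 0 by rewrite gt_eqF //; lra.
rewrite /PHI /s1 mulf_eq0 invr_eq0 (negPf yN) (negPf y1N) /= -qq_addr1.
  by congr qq; field; rewrite yN y1N.
by rewrite subr_ge0 invf_ge1.
Qed.

Lemma PHI_s2 y : 0 <= y -> y <= 1 -> PHI (s2 y) = (1 + PHI y) / 2.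
Proof.
move=> y0 y1; have y2 : 2 - y != 0 by rewrite gt_eqF //; lra.
rewrite {1}/PHI /s2 invr_eq0 (negPf y2) invrK.
have [->|yN] := eqVneq y 0.
  have -> : 2 - 0 - 1 = 1%:R :> R by lra.
  by rewrite PHI0 addr0 qq_nat expr1 mul1r.
rewrite /PHI (negPf yN) -qq_divr.
  by congr qq; rewrite subrK; field.
by rewrite subr_ge0 invf_ge1 // lt_neqAle eq_sym yN.
Qed.

(** Half-open in [y = 1 / (x + 1)], so that cutting leaves disjoint pieces; [slab 0 1] is []0,
    +oo[], and the missing point 0 has mass 0. *)
Definition slab (y0 y1 : R) : set (measurableTypeR R) := [set x : R | 0 <= x /\ y0 <= (x + 1)^-1 < y1].

Lemma slabE y0 y1 : 0 < y0 -> y0 < y1 -> y1 <= 1 -> slab y0 y1 = `]y1^-1 - 1, y0^-1 - 1]%classic.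
Proof.
move=> y00 y01 y11; have y1p : 0 < y1 by lra.
have h1 : 1 <= y1^-1 by rewrite invf_ge1.
apply/seteqP; split=> x /=; rewrite in_itv /=.
  move=> [x0 /andP[h2 h3]]; have x1 : 0 < x + 1 by lra.
  rewrite ltrBlDr lerBrDr -(invrK (x + 1)); apply/andP; split.
    by rewrite ltf_pV2 // ?posrE ?invr_gt0.
  by rewrite lef_pV2 // ?posrE ?invr_gt0.
rewrite ltrBlDr lerBrDr => /andP[h2 h3]; have x1 : 0 < x + 1 by lra.
split; first lra.
rewrite -(invrK y0) -(invrK y1) lef_pV2 ?ltf_pV2 ?posrE ?invr_gt0 //; exact/andP.
Qed.

Lemma slab0E y1 : 0 < y1 -> y1 <= 1 -> slab 0 y1 = `]y1^-1 - 1, +oo[%classic.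
Proof.
move=> y1p y11; have h1 : 1 <= y1^-1 by rewrite invf_ge1.
apply/seteqP; split=> x /=; rewrite in_itv /= andbT.
  move=> [x0 /andP[h2 h3]]; have x1 : 0 < x + 1 by lra.
  by rewrite ltrBlDr -(invrK (x + 1)) ltf_pV2 // ?posrE ?invr_gt0.
rewrite ltrBlDr => h2; have x1 : 0 < x + 1 by lra.
split; first lra.
by rewrite invr_ge0 (ltW x1) -(invrK y1) ltf_pV2 ?posrE ?invr_gt0.
Qed.

Lemma measurable_slab y0 y1 : 0 <= y0 -> y0 < y1 -> y1 <= 1 -> measurable (slab y0 y1).
Proof.
rewrite le_eqVlt => /orP[/eqP <-|y00] y01 y11.
  by rewrite slab0E //; exact: measurable_itv.
by rewrite slabE //; exact: measurable_itv.
Qed.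

Lemma dqmark_slab y0 y1 : 0 <= y0 -> y0 < y1 -> y1 <= 1 ->
  mu (slab y0 y1) = (PHI y1 - PHI y0)%:E.
Proof.
move=> h0 y01 y11; have y1p : 0 < y1 by lra.
have h1 : 1 <= y1^-1 by rewrite invf_ge1.
have y1N : (y1 == 0) = false by rewrite gt_eqF.
move: h0 y01; rewrite le_eqVlt => /orP[/eqP <-|y00] y01.
  rewrite slab0E // dqmark_oy ?PHI0 ?subr0 /PHI ?y1N //; lra.
have h2 : y1^-1 < y0^-1 by rewrite ltf_pV2.
rewrite slabE // dqmark_oc; last lra.
rewrite /PHI y1N gt_eqF // !qmarkE; [|lra..].
by congr (_%:E); ring.
Qed.

End stieltjes.

(** * Integrals against the question mark measure as limits of tree averages *)

Section quadrature.
Variable R : realType.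
Local Notation mu := (@dqmark R).
Variables (g psi : R -> R) (L : R).
Hypothesis gE : forall x : R, 0 <= x -> g x = psi (x + 1)^-1.
Hypothesis psiL : forall y y' : R, 0 <= y -> y <= 1 -> 0 <= y' -> y' <= 1 ->
  `|psi y - psi y'| <= L * `|y - y'|.
Hypothesis mg : measurable_fun (`[0, +oo[%classic : set (measurableTypeR R)) g.

Lemma dqmark_set0 : mu [set 0] = 0.
Proof.
apply/eqP; rewrite eq_le measure_ge0 andbT.
have <- : mu `]-1, 0]%classic = 0.
  rewrite dqmark_oc; last lra.
  rewrite qmarkE // (qq_nat R 0) expr0 invr1 subrr sub0r /qmark.
  by rewrite ifT ?oppr0 //; lra.
apply: le_measure; rewrite ?inE; [exact: measurable_set1|exact: measurable_itv|].
by move=> x /= ->; rewrite in_itv /= lexx andbT; lra.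
Qed.

Lemma itv_0y : `[0, +oo[%classic = [set 0] `|` `]0, +oo[%classic :> set (measurableTypeR R).
Proof. by rewrite (@setU1itv _ _ _ 0 false) // bnd_simp. Qed.

Lemma dqmark_0y : mu `[0, +oo[%classic = 1%:E.
Proof.
rewrite itv_0y; transitivity (mu [set 0%R] + mu (`]0%R, +oo[%classic : set (measurableTypeR R)))%E.
  apply: measureU; [exact: measurable_set1|exact: measurable_itv|].
  by apply/seteqP; split=> x //= [->]; rewrite in_itv /= ltxx.
by rewrite dqmark_set0 add0e dqmark_oy // (qq_nat R 0) expr0 invr1.
Qed.

Lemma g_integrable : mu.-integrable `[0, +oo[ (EFin \o g).
Proof.
apply: measurable_bounded_integrable => //.
  by move: dqmark_0y => ->; rewrite ltry.
exists (`|psi 0| + L); split; first exact: num_real.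
move=> M hM x /=; rewrite in_itv /= andbT => x0; rewrite gE //.
have x1 : 0 < x + 1 by lra.
have y0 : 0 <= (x + 1)^-1 by rewrite invr_ge0 ltW.
have y1 : (x + 1)^-1 <= 1 by rewrite invf_le1; lra.
have L0 : 0 <= L.
  by have := psiL (lexx 0) ler01 ler01 (lexx 1); rewrite sub0r normrN normr1 mulr1; apply: le_trans.
have := psiL y0 y1 (lexx 0) ler01; rewrite subr0 (ger0_norm y0) => h.
have := ler_normD (psi (x + 1)^-1 - psi 0) (psi 0); rewrite subrK.
have : L * (x + 1)^-1 <= L by rewrite ler_piMr.
lra.
Qed.

Definition increasing01 (tau : R -> R) := [/\ 0 <= tau 0, tau 1 <= 1 &
  forall y y', 0 <= y -> y < y' -> y' <= 1 -> tau y < tau y'].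

Lemma slab_integrable y0 y1 (f : R -> R) : 0 <= y0 -> y0 < y1 -> y1 <= 1 ->
  mu.-integrable `[0, +oo[ (EFin \o f) -> mu.-integrable (slab y0 y1) (EFin \o f).
Proof.
move=> h0 h1 h2; apply: integrableS; [exact: measurable_itv|exact: measurable_slab|].
by move=> x [x0 _]; rewrite /= in_itv /= x0.
Qed.

Lemma cst_integrable (c : R) : mu.-integrable `[0, +oo[ (EFin \o cst c).
Proof.
apply: measurable_bounded_integrable => //.
  by move: dqmark_0y => ->; rewrite ltry.
by exists `|c|; split; [exact: num_real|move=> M hM x _ /=; lra].
Qed.

(** The affine relation for [PHI] at 0 and 1 shows that the slab has mass [m]; across it [psi]
    varies by at most [L] times the length. *)
Lemma slab_quadrature tau u m : increasing01 tau -> 0 <= m ->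
  (forall y, 0 <= y -> y <= 1 -> PHI (tau y) = u + m * PHI y) ->
  `|\int[mu]_(x in slab (tau 0) (tau 1)) g x - m * psi (tau (1/2))| <= m * (L * (tau 1 - tau 0)).
Proof.
move=> [t0 t1 ti] m0 hP.
have t01 : tau 0 < tau 1 by apply: ti.
have th0 : tau 0 < tau (1/2) by apply: ti; lra.
have th1 : tau (1/2) < tau 1 by apply: ti; lra.
have mI := measurable_slab t0 t01 t1.
have muI : fine (mu (slab (tau 0) (tau 1))) = m.
  by rewrite dqmark_slab //= !hP // PHI0 PHI1; ring.
have gi := slab_integrable t0 t01 t1 g_integrable.
have ci c := slab_integrable t0 t01 t1 (cst_integrable c).
have -> : m * psi (tau (1/2)) = \int[mu]_(x in slab (tau 0) (tau 1)) (cst (psi (tau (1/2))) x).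
  by rewrite Rintegral_cst // muI mulrC.
rewrite -RintegralB //; apply: le_trans (le_normr_Rintegral _ _) _ => //.
  exact: (integrableB mI gi (ci _)).
have -> : m * (L * (tau 1 - tau 0)) = \int[mu]_(x in slab (tau 0) (tau 1)) (cst (L * (tau 1 - tau 0)) x).
  by rewrite Rintegral_cst // muI mulrC.
apply: le_Rintegral => //; first exact: (integrable_norm (integrableB mI gi (ci _))).
move=> x [x0 /andP[h1 h2]] /=; rewrite gE //.
have L0 : 0 <= L.
  by have := psiL (lexx 0) ler01 ler01 (lexx 1); rewrite sub0r normrN normr1 mulr1; apply: le_trans.
apply: le_trans (psiL _ _ _ _) _; [lra..|].
by rewrite ler_wpM2l // ler_norml; apply/andP; split; lra.
Qed.

Lemma increasing01_s1 tau : increasing01 tau -> increasing01 (tau \o @s1 R).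
Proof.
move=> [t0 t1 ti]; have E1 : s1 1 = 1/2 :> R by rewrite /s1; field.
have E0 : s1 0 = 0 :> R by rewrite /s1 mul0r.
split=> /=; rewrite ?E0 ?E1 //.
  by apply: le_trans t1; apply/ltW/ti; lra.
move=> y y' y0 yy y1; have p : 0 < 1 + y by lra.
have p' : 0 < 1 + y' by lra.
apply: ti; rewrite /s1; first by rewrite divr_ge0 // ltW.
  by rewrite ltr_pdivrMr // mulrAC ltr_pdivlMr //; lra.
by rewrite ler_pdivrMr //; lra.
Qed.

Lemma increasing01_s2 tau : increasing01 tau -> increasing01 (tau \o @s2 R).
Proof.
move=> [t0 t1 ti]; have E1 : s2 1 = 1 :> R by rewrite /s2; field.
have E0 : s2 0 = 1/2 :> R by rewrite /s2; field.
split=> /=; rewrite ?E0 ?E1 //.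
  by apply: le_trans t0 _; apply/ltW/ti; lra.
move=> y y' y0 yy y1; have p : 0 < 2 - y by lra.
have p' : 0 < 2 - y' by lra.
apply: ti; rewrite /s2; first by rewrite invr_ge0 ltW.
  by rewrite ltf_pV2 // ?posrE //; lra.
by rewrite invf_le1 //; lra.
Qed.

(* [slab (tau 0) (tau 1)] is cut at [tau (1/2)] into the slabs of [tau \o s1] and
   [tau \o s2], of half the mass each; the errors add up because the lengths do. *)
Lemma tree_quadrature N tau u m : increasing01 tau -> 0 <= m ->
  (forall y, 0 <= y -> y <= 1 -> PHI (tau y) = u + m * PHI y) ->
  `|\int[mu]_(x in slab (tau 0) (tau 1)) g x
    - m * 2 ^- N * \sum_(a <- tree R N) psi (tau (pt a + 1)^-1)| <= m * 2 ^- N * (L * (tau 1 - tau 0)).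
Proof.
elim: N tau u m => [|N IH] tau u m ht m0 hP.
  rewrite big_seq1 expr0 invr1 !mulr1; have -> : pt ((1, 1) : {poly Cplx R} * {poly Cplx R}) = 1.
    by rewrite /pt /val /= !hornerC divr1 re1.
  have -> : (1 + 1)^-1 = 1/2 :> R by field.
  exact: slab_quadrature hP.
have [t0 t1 ti] := ht.
have th0 : tau 0 < tau (1/2) by apply: ti; lra.
have th1 : tau (1/2) < tau 1 by apply: ti; lra.
have t01 : tau 0 < tau 1 by apply: ti.
have E0 : s1 0 = 0 :> R by rewrite /s1 mul0r.
have E1 : s1 1 = 1/2 :> R by rewrite /s1; field.
have F0 : s2 0 = 1/2 :> R by rewrite /s2; field.
have F1 : s2 1 = 1 :> R by rewrite /s2; field.
have m2 : 0 <= m / 2 by lra.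
have h1 := IH _ u (m / 2) (increasing01_s1 ht) m2.
have h2 := IH _ (u + m / 2) (m / 2) (increasing01_s2 ht) m2.
have SU : slab (tau 0) (tau 1) = slab (tau 0) (tau (1/2)) `|` slab (tau (1/2)) (tau 1).
  apply/seteqP; split=> x /=.
    move=> [x0 /andP[p q]]; have [r|r] := ltP (x + 1)^-1 (tau (1/2)).
      by left; split=> //; apply/andP.
    by right; split=> //; apply/andP.
  move=> [] [x0 /andP[p q]]; split=> //; apply/andP; split=> //.
    exact: lt_trans th1.
  by apply: le_trans p; exact: ltW.
have gi := slab_integrable t0 t01 t1 g_integrable.
have -> : \int[mu]_(x in slab (tau 0) (tau 1)) g x =
    \int[mu]_(x in slab (tau 0) (tau (1/2))) g x + \int[mu]_(x in slab (tau (1/2)) (tau 1)) g x.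
  rewrite SU; apply: Rintegral_setU; rewrite -?SU //; [apply: measurable_slab; lra..|].
  apply/disj_setPS => x /= [[_ /andP[_ p]] [_ /andP[q _]]].
  by move: (le_lt_trans q p); rewrite ltxx.
have {}h1 : `|\int[mu]_(x in slab (tau 0) (tau (1/2))) g x
    - m / 2 * 2 ^- N * \sum_(a <- tree R N) psi (tau (s1 (pt a + 1)^-1))| <= m / 2 * 2 ^- N * (L * (tau (1/2) - tau 0)).
  move: h1; rewrite /= E0 E1; apply=> y y0 y1; rewrite hP ?PHI_s1 //.
  - by ring.
  - by rewrite divr_ge0 //; lra.
  - by rewrite ler_pdivrMr; lra.
have {}h2 : `|\int[mu]_(x in slab (tau (1/2)) (tau 1)) g x
    - m / 2 * 2 ^- N * \sum_(a <- tree R N) psi (tau (s2 (pt a + 1)^-1))| <= m / 2 * 2 ^- N * (L * (tau 1 - tau (1/2))).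
  move: h2; rewrite /= F0 F1; apply=> y y0 y1; rewrite hP ?PHI_s2 //.
  - by lra.
  - by rewrite invr_ge0; lra.
  - by rewrite invf_le1; lra.
(* The map applied last in the tree is the outermost one, so it selects the half of the slab in the
   first cut: [s1] and [s2] send [1 / (x + 1)] to [1 / (T x + 1)] for [T = T1] and [T = T2]. *)
have -> : \sum_(a <- tree R N.+1) psi (tau (pt a + 1)^-1) =
   \sum_(a <- tree R N) psi (tau (s1 (pt a + 1)^-1)) + \sum_(a <- tree R N) psi (tau (s2 (pt a + 1)^-1)).
  rewrite sum_treeS -big_split big_seq [RHS]big_seq; apply: eq_bigr => a aN /=.
  have [p0 _ _] := pt_tree aN; rewrite (pt_step1 aN) (pt_step2 aN) /s1 /s2.
  congr (psi (tau _) + psi (tau _)); field; rewrite ?gt_eqF //=; lra.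
rewrite halfS; set A := \int[mu]_(x in _) g x in h1 *; set B := \int[mu]_(x in _) g x in h2 *.
set t := 2 ^- N in h1 h2 *.
set S1 := \sum_(a <- _) psi (tau (s1 _)) in h1 *; set S2 := \sum_(a <- _) psi (tau (s2 _)) in h2 *.
have -> : A + B - m * (t / 2) * (S1 + S2) = (A - m / 2 * t * S1) + (B - m / 2 * t * S2) by field.
apply: le_trans (ler_normD _ _) _; apply: le_trans (lerD h1 h2) _; lra.
Qed.

Lemma quadrature N :
  `|\int[mu]_(x in `[0, +oo[) g x - 2 ^- N * \sum_(a <- tree R N) psi (pt a + 1)^-1| <= L * 2 ^- N.
Proof.
have inc : increasing01 (@id R) by split.
have := @tree_quadrature N id 0 1 inc ler01 (fun y _ _ => esym (etrans (add0r _) (mul1r _))).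
rewrite /= subr0 mulr1 !mul1r [2 ^- N * L]mulrC.
have -> : \int[mu]_(x in `[0, +oo[) g x = \int[mu]_(x in slab 0 1) g x; last by [].
rewrite slab0E // invr1 subrr itv_0y.
rewrite Rintegral_setU -?itv_0y; [|exact: measurable_set1|exact: measurable_itv|exact: g_integrable|].
  suff -> : \int[mu]_(x in [set 0]) g x = 0 by rewrite add0r.
  rewrite /Rintegral null_set_integral //; [|exact: dqmark_set0].
  have : mu.-integrable [set 0] (EFin \o g).
    apply: integrableS g_integrable; [exact: measurable_itv|exact: measurable_set1|].
    by move=> x /= ->; rewrite in_itv /= lexx.
  exact: measurable_int.
by apply/disj_setPS => x /= [->]; rewrite in_itv /= ltxx.
Qed.

End quadrature.

(** * The tree averages at [e = -1] converge to [G(z)] *)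

Section integral_of_G.
Variable R : realType.
Local Notation C := (Cplx R).
Local Notation mu := (@dqmark R).
Variable z : C.
Hypothesis hz : re z <= 3/4.

Definition psiG (y : R) : C := of_real y / (1 - z * of_real y).

Lemma psiG_den (y : R) : 0 <= y -> y <= 1 -> 1/4 <= nm (1 - z * of_real y).
Proof.
move=> y0 y1; apply: le_trans (re_le_nm _); apply: le_trans (ler_norm _).
rewrite reD reN reM re1 re_of_real im_of_real mulr0 subr0; have := ler_wpM2r y0 hz; lra.
Qed.

(** [16 = 4 ^ 2], each denominator being at least [1 - y * re z >= 1/4] in modulus. *)
Lemma psiG_lipschitz (y y' : R) : 0 <= y -> y <= 1 -> 0 <= y' -> y' <= 1 ->
  nm (psiG y - psiG y') <= 16 * `|y - y'|.
Proof.
move=> y0 y1 y0' y1'; have d := psiG_den y0 y1; have d' := psiG_den y0' y1'.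
have n0 : 1 - z * of_real y != 0 by rewrite -nm_gt0; lra.
have n0' : 1 - z * of_real y' != 0 by rewrite -nm_gt0; lra.
have -> : psiG y - psiG y' = of_real (y - y') * ((1 - z * of_real y) * (1 - z * of_real y'))^-1.
  by rewrite /psiG of_realD of_realN; field; rewrite n0 n0'.
rewrite nmM nm_of_real nmV nmM mulrC ler_wpM2r //.
have : 1/16 <= nm (1 - z * of_real y) * nm (1 - z * of_real y') by nra.
set X := nm _ * nm _ => hX; rewrite -[X^-1]mul1r ler_pdivrMr; lra.
Qed.

Lemma G_integrandE (x : R) : 0 <= x -> G_integrand z x = psiG (x + 1)^-1.
Proof.
move=> x0; have x1 : 0 < x + 1 by lra.
have y0 : 0 <= (x + 1)^-1 by rewrite invr_ge0 ltW.
have y1 : (x + 1)^-1 <= 1 by rewrite invf_le1; lra.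
have := psiG_den y0 y1; rewrite /G_integrand /psiG of_realV of_realD of_real1.
have : of_real x + 1 != 0 by rewrite -of_real1 -of_realD -nm_gt0 nm_of_real gtr0_norm.
move: (of_real x + 1) => w w0 d; have d0 : 1 - z / w != 0 by rewrite -nm_gt0; lra.
have E : 1 - z / w = (w - z) / w by field.
by rewrite E invfM invrK mulrA [w^-1 / _]mulrC -mulrA mulVf // mulr1.
Qed.

Lemma G_integrand_reim (x : R) :
  let q := (x + 1 - re z) ^+ 2 + im z ^+ 2 in
  re (G_integrand z x) = (x + 1 - re z) / q /\ im (G_integrand z x) = im z / q.
Proof.
rewrite /G_integrand /of_real; case: z => a b /=; rewrite /re /im /=.
by rewrite add0r sub0r sqrrN mulNr opprK.
Qed.

Lemma G_integrand_measurable :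
  measurable_fun (`[0, +oo[%classic : set (measurableTypeR R)) (fun x => re (G_integrand z x)) /\
  measurable_fun (`[0, +oo[%classic : set (measurableTypeR R)) (fun x => im (G_integrand z x)).
Proof.
pose t (x : R) := x + 1 - re z; pose q (x : R) := t x ^+ 2 + im z ^+ 2.
have E1 : (fun x => re (G_integrand z x)) = (fun x => t x / q x).
  by apply/funext => x; case: (G_integrand_reim x).
have E2 : (fun x => im (G_integrand z x)) = (fun x => im z / q x).
  by apply/funext => x; case: (G_integrand_reim x).
have tc (x : R) : t y @[y --> x] --> t x.
  by apply: cvgB; [apply: cvgD; [exact: cvg_id|exact: cvg_cst]|exact: cvg_cst].
have qc (x : R) : q y @[y --> x] --> q x.
  apply: cvgD; last exact: cvg_cst.
  have -> : (fun y => t y ^+ 2) = (fun y => t y * t y) by apply/funext => y; rewrite expr2.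
  by rewrite expr2; apply: cvgM; exact: tc.
have q0 (x : R) : x \in `[0, +oo[%classic -> q x != 0.
  rewrite inE /= in_itv /= andbT => x0; have t0 : 0 < t x by rewrite /t subr_gt0; apply: le_lt_trans hz _; lra.
  by rewrite gt_eqF // /q ltr_pwDl ?exprn_gt0 // sqr_ge0.
rewrite E1 E2; split.
  apply: subspace_continuous_measurable_fun; first exact: measurable_itv.
  apply: continuous_in_subspaceT => x /q0 qx.
  by apply: cvgM; [exact: tc|exact: (cvgV qx (qc x))].
apply: subspace_continuous_measurable_fun; first exact: measurable_itv.
apply: continuous_in_subspaceT => x /q0 qx.
by apply: cvgM; [exact: cvg_cst|exact: (cvgV qx (qc x))].
Qed.

Lemma nm_re_sub (u w : C) : `|re u - re w| <= nm (u - w).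
Proof. by rewrite -reN -reD; exact: re_le_nm. Qed.

Lemma nm_im_sub (u w : C) : `|im u - im w| <= nm (u - w).
Proof. by rewrite -imN -imD; exact: im_le_nm. Qed.

Lemma re_psiG_lipschitz (y y' : R) : 0 <= y -> y <= 1 -> 0 <= y' -> y' <= 1 ->
  `|re (psiG y) - re (psiG y')| <= 16 * `|y - y'|.
Proof. by move=> *; apply: le_trans (nm_re_sub _ _) _; exact: psiG_lipschitz. Qed.

Lemma im_psiG_lipschitz (y y' : R) : 0 <= y -> y <= 1 -> 0 <= y' -> y' <= 1 ->
  `|im (psiG y) - im (psiG y')| <= 16 * `|y - y'|.
Proof. by move=> *; apply: le_trans (nm_im_sub _ _) _; exact: psiG_lipschitz. Qed.

Lemma G_integrand_integrable : Cintegrable mu `[0, +oo[ (G_integrand z).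
Proof.
have [m1 m2] := G_integrand_measurable; split.
  apply: (@g_integrable _ (fun x => re (G_integrand z x)) (fun y => re (psiG y)) 16) => //.
    by move=> x x0; rewrite G_integrandE.
  exact: re_psiG_lipschitz.
apply: (@g_integrable _ (fun x => im (G_integrand z x)) (fun y => im (psiG y)) 16) => //.
  by move=> x x0; rewrite G_integrandE.
exact: im_psiG_lipschitz.
Qed.

Lemma re_sum (I : Type) (s : seq I) (F : I -> C) : re (\sum_(i <- s) F i) = \sum_(i <- s) re (F i).
Proof. by elim/big_rec2: _ => // i x y _ <-; rewrite reD. Qed.

Lemma im_sum (I : Type) (s : seq I) (F : I -> C) : im (\sum_(i <- s) F i) = \sum_(i <- s) im (F i).
Proof. by elim/big_rec2: _ => // i x y _ <-; rewrite imD. Qed.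

Lemma favg_G N : nm (favg N z (-1) - G z) <= 32 * 2 ^- N.
Proof.
have [m1 m2] := G_integrand_measurable.
have f : favg N z (-1) = of_real (2 ^- N) * \sum_(a <- tree R N) psiG (pt a + 1)^-1.
  rewrite /favg of_realV of_realX of_real_nat; congr (_ * _).
  rewrite big_seq [RHS]big_seq; apply: eq_bigr => a aN.
  by have [p0 pE _] := pt_tree aN; rewrite -G_integrandE ?(ltW p0) // /G_integrand pE.
have h1 := @quadrature _ (fun x => re (G_integrand z x)) (fun y => re (psiG y)) 16 _ re_psiG_lipschitz m1 N.
have h2 := @quadrature _ (fun x => im (G_integrand z x)) (fun y => im (psiG y)) 16 _ im_psiG_lipschitz m2 N.
apply: le_trans (nm_le_reim _) _.
have -> : 32 * 2 ^- N = 16 * 2 ^- N + 16 * 2 ^- N :> R by lra.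
rewrite !(reD, imD, reN, imN) f reM imM re_of_real im_of_real !mul0r subr0 addr0 re_sum im_sum.
apply: lerD; rewrite distrC.
  by apply: h1 => x x0; rewrite G_integrandE.
by apply: h2 => x x0; rewrite G_integrandE.
Qed.

End integral_of_G.

(** * Convergence on both discs *)

Section conclusion.
Variable R : realType.
Local Notation C := (Cplx R).
Variable h : nat -> {poly rat}.
Hypothesis hh : hsys h.

(** Absolute convergence and identification of the sum in one statement, compatible with the
    reflection [z -> z / (z - 1)]. *)
Definition summable_at (z : C) := forall eta : R, 0 < eta -> exists m, forall K, (m <= K)%N ->
  (\sum_(m <= n < K) nm (Hf h n z) <= eta) /\
  exists N0, forall N, (N0 <= N)%N -> nm (favg N z (-1) - \sum_(n < K) (-1) ^+ n * Hf h n z) <= eta.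

Lemma nm_sgn n (w : C) : nm ((-1) ^+ n * w) = nm w.
Proof. by rewrite nmM nmX nmN nm1 expr1n mul1r. Qed.

Lemma abs_convergence (z : C) : summable_at z -> cvgn (series (fun n => `|(-1) ^+ n * Hf h n z|)).
Proof.
move=> hs; pose u K : R := \sum_(n < K) nm (Hf h n z).
have und : {homo u : n m / (n <= m)%N >-> n <= m}.
  apply/nondecreasing_seqP => n.
  by rewrite /u big_ord_recr /= lerDl nm_ge0.
have [m hm] := hs 1 ltr01.
have ub : has_ubound (range u).
  exists (u m + 1) => _ [K _ <-]; have [mK|Km] := leqP m K; last first.
    by apply: le_trans (und _ _ (ltnW Km)) _; rewrite lerDl.
  rewrite /u -(big_mkord xpredT (fun n => nm (Hf h n z))) (big_cat_nat (leq0n m) mK) /= big_mkord.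
  by rewrite lerD2l; have [] := hm K mK.
have uc := nondecreasing_is_cvgn und ub.
apply/cvg_ex; exists (of_real (limn u)); apply: cvgC_nm => eta e0.
move/cvgrPdist_le : uc => /(_ _ e0)[N _ hN]; exists N => K /hN.
rewrite seriesE; under eq_bigr do rewrite normE nm_sgn.
have -> : \sum_(i < K) of_real (nm (Hf h i z)) = of_real (u K) :> C by rewrite of_real_sum.
by rewrite -of_realN -of_realD nm_of_real.
Qed.

Lemma series_to_G (z : C) : re z <= 3/4 -> summable_at z ->
  series (fun n => (-1) ^+ n * Hf h n z) @ \oo --> G z.
Proof.
move=> hz hs; apply: cvgC_nm => eta e0; have e2 : 0 < eta / 2 by lra.
have [m hm] := hs _ e2; exists m => K /hm[_ [N0 hN]]; rewrite seriesE.
have ct : (fun N => 32 * 2 ^- N : R) @ \oo --> (0 : R).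
  rewrite -[X in _ --> X](mulr0 32); apply: cvgMr; under eq_fun do rewrite -exprVn.
  by apply: cvg_expr; rewrite ger0_norm ?invr_ge0 //; lra.
move/cvgrPdist_le : ct => /(_ _ e2)[N1 _ hN1].
have h1 := hN _ (leq_maxl N0 N1).
have := hN1 _ (leq_maxr N0 N1); rewrite /= sub0r normrN => h2.
have h3 := le_trans (ler_norm _) h2.
have := favg_G hz (maxn N0 N1); rewrite -nmN opprB => h4.
have := nm_le_add (G z - favg (maxn N0 N1) z (-1)) (favg (maxn N0 N1) z (-1) - \sum_(n < K) (-1) ^+ n * Hf h n z).
rewrite addrA subrK; lra.
Qed.

Lemma conclude_at (z : C) : re z <= 3/4 -> summable_at z ->
  [/\ Cintegrable (@dqmark R) `[0, +oo[ (G_integrand z),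
      cvgn (series (fun n => `|(-1) ^+ n * Hf h n z|)) &
      series (fun n => (-1) ^+ n * Hf h n z) @ \oo --> G z].
Proof.
by move=> hz hs; split; [exact: G_integrand_integrable|exact: abs_convergence|exact: series_to_G].
Qed.

Lemma summable_disc (z : C) : nm z <= 3/4 -> summable_at z.
Proof. by move=> hz eta e0; exact: H_tail. Qed.

Lemma favg_reflect N (z : C) : z != 1 -> re z <= 3/4 ->
  favg N z (-1) = - (z - 1)^-1 - (z - 1) ^- 2 * favg N (z / (z - 1)) (-1).
Proof.
move=> z1 hz; have y0 : z - 1 != 0 by rewrite subr_eq0.
have t0 : (2 : C) ^+ N != 0 by rewrite expf_neq0 // pnatr_eq0.
rewrite /favg mulrCA -[- (z - 1)^-1](mulKf t0) -mulrBr; congr (_ * _).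
rewrite -sum_tree_const -(sum_tree_swap (fun a => (val a (-1) + 1 - z / (z - 1))^-1)) mulr_sumr -sumrB.
rewrite big_seq [RHS]big_seq; apply: eq_bigr => a aN.
have [p0 pE _] := pt_tree aN; rewrite val_swap.
have x0 : val a (-1) != 0 by rewrite pE -nm_gt0 nm_of_real gtr0_norm.
have d0 : val a (-1) + 1 - z != 0.
  apply/eqP => /(congr1 (@re R)); rewrite pE !reD reN re1 re_of_real => E.
  by have : re (0 : C) = 0 by []; rewrite -E; lra.
have -> : (val a (-1))^-1 + 1 - z / (z - 1) = - (val a (-1) + 1 - z) / (val a (-1) * (z - 1)).
  by field; rewrite y0 x0.
by field; rewrite d0 y0 x0.
Qed.

(** The inhomogeneous term is the one of [favg_reflect], so the difference between [favg] and a
    partial sum transforms by the factor [- (z - 1) ^ -2] alone. *)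
Lemma Hf0_reflect (z : C) : z != 1 -> z != 2 ->
  Hf h 0 z = - (z - 1)^-1 - (z - 1) ^- 2 * Hf h 0 (z / (z - 1)).
Proof.
move=> z1 z2; rewrite !Hf0; have y1 : z - 1 != 0 by rewrite subr_eq0.
have y2 : 2 - z != 0 by rewrite subr_eq0 eq_sym.
have -> : 2 - z / (z - 1) = - (2 - z) / (z - 1) by field.
by field; rewrite y1 y2.
Qed.

(** The disc is the Apollonius region [|z| <= (3/4) |z - 1|]: squared, this reads
    [7 |z| ^ 2 + 18 re z <= 9]. *)
Lemma disc2_facts (z : C) : nm (z + 9/7) <= 12/7 ->
  [/\ re z <= 3/4, z != 1, z != 2, 4/7 <= nm (z - 1) & nm (z / (z - 1)) <= 3/4].
Proof.
move=> hz; have n1 : 4/7 <= nm (z - 1).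
  have := nm_ge_sub (1 + 9/7) (- (z + 9/7)); rewrite nmN.
  have -> : 1 + 9/7 - (z + 9/7) = - (z - 1) by ring.
  have -> : nm (1 + 9/7 : C) = 16/7.
    have -> : 1 + 9/7 = of_real (16/7) :> C.
      by rewrite of_realM of_realV !of_real_nat; field.
    by rewrite nm_of_real ger0_norm //; lra.
  rewrite nmN; lra.
have E97 : 9/7 = of_real (9/7) :> C by rewrite of_realM of_realV !of_real_nat.
have rz : re z <= 3/7.
  have := le_trans (ler_norm _) (re_le_nm (z + 9/7)); rewrite reD {1}E97 re_of_real; lra.
split=> //; first lra.
- by apply/eqP => E; move: rz; rewrite E re1; lra.
- by apply/eqP => E; move: rz; rewrite E re_nat; lra.
rewrite nmM nmV ler_pdivrMr; last lra.
apply: sqr_le_inv; first by rewrite mulr_ge0 ?nm_ge0 //; lra.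
have : nm (z + 9/7) ^+ 2 <= (12/7) ^+ 2 by apply: lerXn2r; rewrite ?nnegrE ?nm_ge0 //; lra.
rewrite (exprMn 2 (3/4) (nm _)) !sqr_nm !reD !imD reN imN E97 re_of_real im_of_real re1 im1.
move: (re z) (im z) => x y; nra.
Qed.

Lemma summable_disc2 (z : C) : nm (z + 9/7) <= 12/7 -> summable_at z.
Proof.
move=> hz; have [rz z1 z2 n1 hz'] := disc2_facts hz.
have k4 : nm ((z - 1) ^- 2) <= 4.
  rewrite nmV nmX; have p : 0 < nm (z - 1) ^+ 2 by rewrite exprn_gt0 //; lra.
  by rewrite -[_^-1]mul1r ler_pdivrMr //; nra.
have kn (w : C) (d : R) : nm w <= d -> nm (- (z - 1) ^- 2 * w) <= 4 * d.
  by move=> hw; rewrite nmM nmN; apply: ler_pM; rewrite ?nm_ge0.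
move=> eta e0; have e4 : 0 < eta / 4 by lra.
have [m hm] := summable_disc hz' e4.
(* One past [m], because [Hf_reflect] requires [n >= 1] and [m] may be 0. *)
exists m.+1 => K mK; have [h1 [N0 h2]] := hm K (ltnW mK).
split.
  apply: le_trans (_ : 4 * (\sum_(m <= n < K) nm (Hf h n (z / (z - 1)))) <= _); last by lra.
  rewrite (big_ltn (leq_trans (leqnn _) mK)) mulrDr ler_wpDl ?mulr_ge0 ?nm_ge0 //.
  rewrite mulr_sumr big_nat [leRHS]big_nat; apply: ler_sum => n /andP[mn _].
  by rewrite Hf_reflect //; [exact: kn|exact: leq_trans mn].
exists N0 => N NN.
have -> : favg N z (-1) - \sum_(n < K) (-1) ^+ n * Hf h n z =
    - (z - 1) ^- 2 * (favg N (z / (z - 1)) (-1) - \sum_(n < K) (-1) ^+ n * Hf h n (z / (z - 1))).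
  case: K mK {hm h1 h2} => // K _.
  rewrite favg_reflect // !big_ord_recl !expr0 !mul1r Hf0_reflect //.
  have -> : \sum_(i < K) (-1) ^+ lift ord0 i * Hf h (lift ord0 i) z =
     - (z - 1) ^- 2 * \sum_(i < K) (-1) ^+ lift ord0 i * Hf h (lift ord0 i) (z / (z - 1)).
    rewrite mulr_sumr; apply: eq_bigr => i _; rewrite Hf_reflect //; ring.
  ring.
by have := kn _ _ (h2 N NN); lra.
Qed.

End conclusion.

Theorem theorem1p1 (R : realType) :
  exists H : nat -> Cplx R -> Cplx R,
    [/\ (forall z, H 0%N z = 1 / (2 - z)),
        (forall n, (1 <= n)%N ->
           solves_H H n (H n) /\
           forall K, solves_H H n K -> forall z, z != 2 -> K z = H n z),
        (exists B : nat -> {poly rat},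
           [/\ B 0%N = -1,
               (forall n z, z != 2 ->
                  H n z = eval_rat (B n) z / (z - 2) ^+ n.+1) &
               (forall n, (1 <= n)%N ->
                  [/\ (size (B n) <= n)%N,
                      (forall z : Cplx R, z != 0 ->
                         eval_rat (B n) (z + 1)
                         = (-1) ^+ n * z ^+ n.-1 * eval_rat (B n) (1 / z + 1)) &
                      (B n).[0] = 0])]) &
        (forall z : Cplx R, `|z| <= 3 / 4 \/ `|z + 9 / 7| <= 12 / 7 ->
           [/\ Cintegrable (@dqmark R) `[0, +oo[ (G_integrand z),
               cvgn (series (fun n => `|(-1) ^+ n * H n z|)) &
               series (fun n => (-1) ^+ n * H n z) @ \oo --> G z])].
Proof.
have [h hh] := hsys_exists rat.
have real_frac (a b : nat) : a%:R / b%:R = of_real (a%:R / b%:R) :> Cplx R.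
  by rewrite of_realM of_realV !of_real_nat.
exists (Hf h); split.
- exact: Hf0.
- move=> n n0; split; first exact: Hf_solves.
  by move=> K hK z z2; exact: solves_unique hK (Hf_solves _ hh n0) z z2.
- exists (Bp h); split=> [//|n z z2|n n0]; first exact: Hf_Bp.
  by split=> [|z z0|]; [exact: size_Bp|exact: Bp_sym|exact: Bp_0].
move=> z []; rewrite (real_frac 3 4, real_frac 12 7) ler_norm_nm => hz; apply: conclude_at => //.
- exact: le_trans (le_trans (ler_norm _) (re_le_nm z)) hz.
- exact: summable_disc.
- by have [] := disc2_facts hz.
- exact: summable_disc2.
Qed.
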